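(* Let $Z=\mathbb C^2$ with coordinates $(y,s)$, and let $D_y=\partial/\partial y$, $D_s=\partial/\partial s$. Consider the differential operators $$P_1=yD_y^2+2D_y+D_s,\qquad Q_1=sD_s+yD_y+3,$$ let $\mathcal J$ be the (left) ideal of $\mathcal D_Z$ generated by $P_1$ and $Q_1$, and let $\mathcal N$ be the holonomic $\mathcal D_Z$-module $\mathcal D_Z/\mathcal J$. Then $\mathcal N$ is regular along every point of $Y=\{(y,s)\mid s=y^2\}$ (i.e. along the submanifold $\{p\}$ for every $p\in Y$), but $\mathcal N$ is not regular along $Y$ itself.
   Context: $\mathcal D_X$ denotes the sheaf of holomorphic differential operators on a complex manifold $X$, filtered by order: $(\mathcal D_{X,m})_{m\ge0}$. Let $Y$ be a submanifold of $X$ with defining ideal $\mathcal I_Y$ (with $\mathcal I_Y^\ell=\mathcal O_X$ for $\ell\le0$). The V-filtration along $Y$ is $V_k\mathcal D_X=\{P\in\mathcal D_X\mid\forall\ell\in\mathbb Z,\ P\mathcal I_Y^\ell\subset\mathcal I_Y^{\ell-k}\}$. The graded ring $gr^V\mathcal D_X$ is identified with the differential operators on the normal bundle $T_YX$ with coefficients polynomial in the fibers; let $\theta$ be the Euler vector field of $T_YX$ (acting as multiplication by $k$ on functions homogeneous of degree $k$ in the fibers), and let $\vartheta\in V_0\mathcal D_X$ be an operator of order at most 1 whose image in $gr_0^V\mathcal D_X$ is $\theta$. (In coordinates where $Y=\{t_1=\dots=t_q=0\}$ one may take $\vartheta=\sum_j t_jD_{t_j}$.) A holonomic $\mathcal D_X$-module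 $\mathcal M$ is regular along $Y$ if every local section $u$ of $\mathcal M$ is annihilated by a differential operator of the form $\vartheta^N+P+Q$ for some $N$, with $P\in\mathcal D_{X,N-1}\cap V_0\mathcal D_X$ and $Q\in\mathcal D_{X,N}\cap V_{-1}\mathcal D_X$. Here the submanifold may be a single point $\{p\}$. *)

(* Defs.v *)
From HB Require Import structures.
From mathcomp Require Import all_boot all_order all_algebra.
From mathcomp Require Import complex.
From mathcomp Require Import boolp classical_sets functions reals topology
  normedtype sequences.

Set Implicit Arguments.
Unset Strict Implicit.
Unset Printing Implicit Defensive.

Import Order.TTheory GRing.Theory Num.Theory.
Import numFieldNormedType.Exports.

Local Open Scope classical_set_scope.
Local Open Scope ring_scope.

(** Formal power series in one variable, as coefficient sequences, with the
    Cauchy product.  The type is a fresh name for [nat -> A], so that its product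
    is not the pointwise one. *)

Definition fps (A : Type) : Type := nat -> A.

Section Fps.
Variable A : comNzRingType.
Implicit Types f g h : fps A.

HB.instance Definition _ := gen_eqMixin (fps A).
HB.instance Definition _ := gen_choiceMixin (fps A).

Definition fps0 : fps A := fun=> 0.
Definition fps1 : fps A := fun n => (n == 0)%:R.
Definition fps_opp f : fps A := fun n => - f n.
Definition fps_add f g : fps A := fun n => f n + g n.
Definition fps_mul f g : fps A := fun n => \sum_(i < n.+1) f i * g (n - i)%N.

Fact fps_addA : associative fps_add.
Proof. by move=> f g h; apply/funext=> n; rewrite /fps_add addrA. Qed.
Fact fps_addC : commutative fps_add.
Proof. by move=> f g; apply/funext=> n; rewrite /fps_add addrC. Qed.
Fact fps_add0 : left_id fps0 fps_add.
Proof. by move=> f; apply/funext=> n; rewrite /fps_add /fps0 add0r. Qed.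
Fact fps_addN : left_inverse fps0 fps_opp fps_add.
Proof. by move=> f; apply/funext=> n; rewrite /fps_add /fps_opp addNr. Qed.

HB.instance Definition _ :=
  GRing.isZmodule.Build (fps A) fps_addA fps_addC fps_add0 fps_addN.

Let trunc n f : {poly A} := \poly_(i < n.+1) f i.

Let coef_trunc n f i : (i <= n)%N -> (trunc n f)`_i = f i.
Proof. by move=> le_in; rewrite coef_poly ltnS le_in. Qed.

Let fps_mul_trunc m n f g :
  (n <= m)%N -> fps_mul f g n = (trunc m f * trunc m g)`_n.
Proof.
move=> le_nm; rewrite coefM; apply: eq_bigr => i _.
have le_in : (i <= n)%N by rewrite -ltnS.
by rewrite !coef_trunc ?(leq_trans (leq_subr _ _)) ?(leq_trans le_in).
Qed.

Fact fps_mulC : commutative fps_mul.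
Proof.
by move=> f g; apply/funext=> n; rewrite !(@fps_mul_trunc n) // mulrC.
Qed.

Fact fps_mulA : associative fps_mul.
Proof.
move=> f g h; apply/funext=> n.
transitivity ((trunc n f * (trunc n g * trunc n h))`_n).
  rewrite coefM; apply: eq_bigr => i _.
  have le_in : (i <= n)%N by rewrite -ltnS.
  by rewrite coef_trunc // (@fps_mul_trunc n) ?leq_subr.
rewrite mulrA coefM; apply: eq_bigr => i _.
have le_in : (i <= n)%N by rewrite -ltnS.
by rewrite (@fps_mul_trunc n) // coef_trunc ?leq_subr.
Qed.

Fact fps_mul1 : left_id fps1 fps_mul.
Proof.
move=> f; apply/funext=> n; rewrite /fps_mul big_ord_recl /= subn0 mul1r.
by rewrite big1 ?addr0 // => i _; rewrite /fps1 /= mul0r.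
Qed.

Fact fps_mulDl : left_distributive fps_mul fps_add.
Proof.
move=> f g h; apply/funext=> n; rewrite /fps_mul /fps_add -big_split /=.
by apply: eq_bigr => i _; rewrite mulrDl.
Qed.

Fact fps1_neq0 : fps1 != 0 :> fps A.
Proof.
by apply/eqP => /(congr1 (fun f : fps A => f 0%N)) /eqP; rewrite oner_eq0.
Qed.

HB.instance Definition _ := GRing.Zmodule_isComNzRing.Build (fps A)
  fps_mulA fps_mulC fps_mul1 fps_mulDl fps1_neq0.

End Fps.

(** [f i j] is the coefficient of [y^i s^j]. *)

Section Convergent.
Variable R : realType.
Local Notation C := R[i].
Implicit Types f g : fps (fps C).

Definition convergent_on f (r M : C) :=
  0 < r /\ forall i j, `|f i j| * r ^+ (i + j) <= M.

Definition convergent : {pred fps (fps C)} :=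
  fun f => `[< exists r M, convergent_on f r M >].

Lemma convergentP f :
  reflect (exists r M, convergent_on f r M) (f \in convergent).
Proof. exact: asboolP. Qed.

Lemma convergent_onW f r r' M :
  convergent_on f r M -> 0 < r' -> r' <= r -> convergent_on f r' M.
Proof.
move=> [r_gt0 fM] r'_gt0 le_r'r; split=> // i j; apply: le_trans (fM i j).
by rewrite ler_wpM2l // lerXn2r // nnegrE ltW.
Qed.

Lemma convergent_on_common f g r M r' M' :
  convergent_on f r M -> convergent_on g r' M' ->
  exists r'' : C, convergent_on f r'' M /\ convergent_on g r'' M'.
Proof.
move=> cf cg; have [r0 _] := cf; have [r'0 _] := cg.
have cmp : r >=< r' by apply: real_comparable; apply: gtr0_real.
have [le|lt] := comparable_leP cmp.
  by exists r; split=> //; apply: (convergent_onW cg).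
by exists r'; split=> //; apply: (convergent_onW cf) => //; apply: ltW.
Qed.

(* A coefficient bound with a polynomial loss becomes a genuine bound after
   halving the radius. *)
Lemma convergent_half f (r M : C) : 0 < r -> 0 <= M ->
  (forall i j, `|f i j| * r ^+ (i + j) <= M *+ (2 ^ (i + j))) ->
  f \in convergent.
Proof.
move=> r0 M0 fM; apply/convergentP; exists (r / 2%:R), M; split=> [|i j].
  by rewrite divr_gt0 // ltr0n.
rewrite expr_div_n mulrA ler_pdivrMr ?exprn_gt0 ?ltr0n //.
by rewrite -natrX mulr_natr.
Qed.

Lemma convergent_bound_ge0 f r M : convergent_on f r M -> 0 <= M.
Proof.
by case=> _ /(_ 0%N 0%N); rewrite expr0 mulr1; apply: le_trans.
Qed.

Lemma leq_succ_pow2 n : (n.+1 <= 2 ^ n)%N.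
Proof. exact: ltn_expl. Qed.

Lemma convergent_mul f g :
  f \in convergent -> g \in convergent -> f * g \in convergent.
Proof.
move=> /convergentP[r [M cf]] /convergentP[r' [M' cg]].
have [r2 [cf2 cg2]] := convergent_on_common cf cg.
have M0 := convergent_bound_ge0 cf2; have M'0 := convergent_bound_ge0 cg2.
have [r0 fM] := cf2; have [_ gM'] := cg2.
apply: (@convergent_half _ r2 (M * M')); rewrite ?mulr_ge0 // => i j.
have -> : (f * g) i j =
    \sum_(a < i.+1) \sum_(b < j.+1) f a b * g (i - a)%N (j - b)%N.
  have fpsE (h : 'I_i.+1 -> fps C) : (\sum_a h a) j = \sum_a h a j.
    exact: (big_morph (fun h : fps C => h j) (id1 := 0) (op1 := +%R)).
  exact: fpsE.
apply: le_trans (_ : \sum_(a < i.+1) \sum_(b < j.+1) M * M' <= _); last first.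
  rewrite !sumr_const !card_ord -mulrnA ler_wpMn2l ?mulr_ge0 //.
  by rewrite mulnC expnD leq_mul ?leq_succ_pow2.
rewrite -ler_pdivlMr ?exprn_gt0 //; apply: le_trans (ler_norm_sum _ _ _) _.
rewrite mulr_suml; apply: ler_sum => a _.
apply: le_trans (ler_norm_sum _ _ _) _.
rewrite mulr_suml; apply: ler_sum => b _.
rewrite ler_pdivlMr ?exprn_gt0 // normrM.
have -> : (i + j = (a + b) + ((i - a) + (j - b)))%N.
  rewrite addnACA !subnKC //; by rewrite -ltnS ltn_ord.
rewrite exprD mulrACA ler_pM ?mulr_ge0 ?normr_ge0 ?exprn_ge0 ?(ltW r0) //.
Qed.

Fact convergent_subring : subring_closed convergent.
Proof.
split=> [|f g /convergentP[r [M cf]] /convergentP[r' [M' cg]]|].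
- apply/convergentP; exists 1, 1; split=> // i j; rewrite expr1n mulr1.
  have -> : (1 : fps (fps C)) i j = ((i == 0%N) && (j == 0%N))%:R.
    by case: i => [|i]; case: j => [|j].
  by case: (_ && _); rewrite ?normr1 ?normr0.
- have [r2 [[r0 fM] [_ gM']]] := convergent_on_common cf cg.
  apply/convergentP; exists r2, (M + M'); split=> // i j.
  apply: le_trans (lerD (fM i j) (gM' i j)).
  rewrite -mulrDl ler_wpM2r ?exprn_ge0 ?(ltW r0) //.
  exact: (ler_normB (f i j) (g i j)).
- exact: convergent_mul.
Qed.

HB.instance Definition _ :=
  GRing.isSubringClosed.Build (fps (fps C)) convergent convergent_subring.

End Convergent.

(** The stalk of the sheaf of holomorphic functions on C^2 at any point: a germ
    at [p] is identified with its Taylor series at [p], so [taylor f i j] is the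
    coefficient of [(y - p.1)^i (s - p.2)^j].  The base point does not appear in
    the type; it enters through the germs [ycoord p] and [scoord p] of the
    coordinate functions and through [ideal_of]. *)

Record germ (R : realType) := Germ {
  taylor :> fps (fps R[i]);
  taylor_convergent : taylor \in @convergent R }.

Section GermRing.
Variable R : realType.
HB.instance Definition _ := [isSub for @taylor R].
HB.instance Definition _ := [Choice of germ R by <:].
HB.instance Definition _ :=
  [SubChoice_isSubComNzRing of germ R by <:].
End GermRing.

Section Operators.
Variable R : realType.
Local Notation C := R[i].
Local Notation O := (germ R).
Implicit Types f g : O.

Fact dy_convergent f :
  ((fun i j => taylor f i.+1 j *+ i.+1) : fps (fps C)) \in @convergent R.
Proof.
have /convergentP[r [M cf]] := taylor_convergent f.
have M0 := convergent_bound_ge0 cf; have [r0 fM] := cf.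
apply: (@convergent_half _ _ r (M / r)); rewrite ?divr_ge0 ?(ltW r0) // => i j.
rewrite normrMn -[X in _ <= X]mulr_natr mulrAC ler_pdivlMr // -mulrA -exprSr.
rewrite mulrnAl mulr_natr; apply: le_trans (_ : M *+ i.+1 <= _).
  by rewrite lerMn2r -addSn fM orbT.
by rewrite ler_wpMn2l // (leq_trans (leq_succ_pow2 i)) // leq_exp2l // leq_addr.
Qed.

Fact ds_convergent f :
  ((fun i j => taylor f i j.+1 *+ j.+1) : fps (fps C)) \in @convergent R.
Proof.
have /convergentP[r [M cf]] := taylor_convergent f.
have M0 := convergent_bound_ge0 cf; have [r0 fM] := cf.
apply: (@convergent_half _ _ r (M / r)); rewrite ?divr_ge0 ?(ltW r0) // => i j.
rewrite normrMn -[X in _ <= X]mulr_natr mulrAC ler_pdivlMr // -mulrA -exprSr.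
rewrite mulrnAl mulr_natr; apply: le_trans (_ : M *+ j.+1 <= _).
  by rewrite lerMn2r -addnS fM orbT.
by rewrite ler_wpMn2l // (leq_trans (leq_succ_pow2 j)) // leq_exp2l // leq_addl.
Qed.

Definition Dy f : O := Germ (dy_convergent f).
Definition Ds f : O := Germ (ds_convergent f).

(* The germ at [p] of an affine function with value [c] and linear part
   [(a, b)]. *)
Fact affine_convergent (c a b : C) :
  ((fun i j => match i, j with
     | 0%N, 0%N => c | 1%N, 0%N => a | 0%N, 1%N => b | _, _ => 0
     end) : fps (fps C)) \in @convergent R.
Proof.
apply/convergentP; exists 1, (`|c| + `|a| + `|b|); split=> // i j.
rewrite expr1n mulr1.
have c0 := normr_ge0 c; have a0 := normr_ge0 a; have b0 := normr_ge0 b.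
by case: i => [|[|i]]; case: j => [|[|j]] /=; rewrite ?normr0 ?addr_ge0 //;
  [rewrite -addrA lerDl | rewrite lerDr | rewrite addrAC lerDr]; rewrite addr_ge0.
Qed.

Definition affine_germ (c a b : C) : O := Germ (affine_convergent c a b).

Definition Z : Type := (C^o * C^o)%type.

Definition ycoord (p : Z) : O := affine_germ p.1 1 0.
Definition scoord (p : Z) : O := affine_germ p.2 0 1.

(** Germs of differential operators are endomorphisms of the stalk of
    holomorphic functions; their product is composition [\o].  The sets below
    are stalks at one point. *)

Local Notation op := (O -> O).

Definition diffop (m : nat) (a : nat -> nat -> O) : op :=
  fun f => \sum_(i < m.+1) \sum_(j < m.+1 - i) a i j * iter i Dy (iter j Ds f).

Definition D_ord (m : nat) : set op := [set P | exists a, P = diffop m a].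

Definition D_ : set op := [set P | exists m, D_ord m P].

(** A cyclic module D_Z/J is given by the stalks of J, a left ideal of D_Z.  A
    germ of section at [p] is the class of some [U] in [D_], and an operator [A]
    annihilates it iff [A \o U] lies in the stalk [J p]. *)

Definition left_ideal2 (P Q : Z -> op) (p : Z) : set op :=
  [set S | exists A B, [/\ D_ A, D_ B & S = (A \o P p) \+ (B \o Q p)]].

(** Characteristic variety of D_Z/J in T^*Z = Z * C^2: the common zeros of the
    principal symbols of the elements of J.  The inner sum is the symbol of
    order [m] of [diffop m a] at the covector [x.2]. *)

Definition char_variety (J : Z -> set op) : set (Z * Z) :=
  [set x | forall m a, J x.1 (diffop m a) ->
     \sum_(i < m.+1) taylor (a i (m - i)%N) 0%N 0%N * x.2.1 ^+ i * x.2.2 ^+ (m - i) = 0].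

(** An analytic set has dimension at most [d] iff each of its points is isolated
    in the intersection of the set with some affine subspace of codimension at
    most [d] through that point. *)

Definition analytic_dim_le (V : normedModType C) (A : set V) (d : nat) :=
  forall x, A x -> exists l : 'I_d -> {linear V -> C^o},
    \forall z \near x, A z -> (forall k, l k z = l k x) -> z = x.

(* By Bernstein's inequality the dimension is then exactly 2, unless D_Z/J = 0.
   Coherence is not part of the condition: it holds for the ideals
   [left_ideal2 P Q] when P and Q are global operators. *)
Definition holonomic (J : Z -> set op) := analytic_dim_le (char_variety J) 2.

(** [h] is the displacement from the base point. *)
Definition vanishes_at (f : O) (h : Z) : Prop :=
  (fun n => \sum_(i < n) \sum_(j < n) taylor f i j * h.1 ^+ i * h.2 ^+ j : C^o)
    @ \oo --> (0 : C^o).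

(** Stalk at [p] of the defining ideal of [Y]. *)
Definition ideal_of (Y : set Z) (p : Z) : set O :=
  [set f : O | \forall z \near p, Y z -> vanishes_at f (z - p)].

Definition ideal_mul (I I' : set O) : set O :=
  [set f | exists n (g h : 'I_n -> O),
     [/\ forall k, I (g k), forall k, I' (h k) & f = \sum_k g k * h k]].

Fixpoint ideal_expn (I : set O) (l : nat) : set O :=
  if l is l'.+1 then ideal_mul I (ideal_expn I l') else setT.

Definition ideal_expz (I : set O) (l : int) : set O :=
  match l with Posz n => ideal_expn I n | Negz _ => setT end.

Definition V_ (I : set O) (k : int) : set op :=
  [set P | D_ P /\ forall l f, ideal_expz I l f -> ideal_expz I (l - k) (P f)].

(** [gr^V D] acts on the functions on the normal bundle that are polynomial in
    the fibers, i.e. on the sum of the [I^l / I^l.+1], the homogeneous functions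
    of degree [l] being [I^l / I^l.+1].  The last clause says that the class of
    [th] in [gr_0^V D] multiplies these by [l], i.e. is the Euler field. *)
Definition euler_lift (I : set O) (th : op) : Prop :=
  [/\ D_ord 1 th, V_ I 0 th &
     forall l f, ideal_expn I l f -> ideal_expn I l.+1 (th f - f *+ l)].

(** At points [p] outside of the closure of [Y] the ideal is the whole stalk and
    the condition is void. *)
Definition regular_along (J : Z -> set op) (Y : set Z) : Prop :=
  forall p, let I := ideal_of Y p in
  forall th, euler_lift I th -> forall U, D_ U ->
  exists (N : nat) (P Q : op),
    [/\ (0 < N)%N, D_ord N.-1 P /\ V_ I 0 P, D_ord N Q /\ V_ I (-1) Q &
        J p ((iter N th \+ P \+ Q) \o U)].

Definition P1 (p : Z) : op :=
  fun f => ycoord p * Dy (Dy f) + Dy f *+ 2 + Ds f.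

Definition Q1 (p : Z) : op :=
  fun f => scoord p * Ds f + ycoord p * Dy f + f *+ 3.

Definition J : Z -> set op := left_ideal2 P1 Q1.

Definition Y : set Z := [set p | p.2 = p.1 ^+ 2].

End Operators.

Arguments J : clear implicits.
Arguments Y : clear implicits.

(* Main.v *)
Require Import Defs.
From HB Require Import structures.
From mathcomp Require Import all_boot all_order all_algebra.
From mathcomp Require Import complex ring lra zify ring_quotient.
From mathcomp Require Import boolp classical_sets functions reals topology
  normedtype sequences.

(** Write [N = D/J] with generator [e], and put [v = (s D_y - 1) e],
    [z = (s D_y - 1) v].  Then [e = (y D_y + 2) v], [(y D_y + 3) z = 0] and
    [D_s z = 0]: the submodule generated by [z] is [O[1/y]], with
    [z = y^-3], and the quotient is generated by the class of [v], which behaves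
    as [s^-3 exp(y / s)].

    Regularity along a point: let [u] be a section which can be written
    [u = sum U_i x_i] where, conversely, [x_i = delta_i u], and where the [x_i] are
    eigenvectors of the Euler field [theta0] modulo the maximal ideal.  A product
    of factors [theta0 - k] then sends [u] into [sum W_i x_i] with [W_i] of bounded
    order and arbitrarily deep in the V-filtration, and [sum W_i delta_i] is the
    operator [Q] that is looked for.  Off the axes [N] is a connection with basis
    [v], [z].  At the origin a section outside of [O[1/y]] generates [N], by
    an explicit use of [s D_y - 1], and the submodules of [O[1/y]] are
    [0], [O] and [O[1/y]].

    Irregularity along [Y]: put [t = s - y^2].  Modulo the image of the derivation
    [D_y + 2 y D_s] tangent to the curves [t = const] (that is, after integration
    along them), [theta^N + P + Q] is [theta^N] plus terms [a t^j D_s^j] with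
    [j < N] and [t a t^j D_s^j] with [j <= N].  The phase [y / s] has a critical
    point at [y = t^(1/2)], with critical value [t^(-1/2) / 2], so that on
    [s^-3 exp(y / s)] the first term is of order [t^(-N/2)] and dominates the other
    ones.  This stationary phase argument is carried out formally, over
    [C[xi]((b))] with [s = 2 b^4] and [y = b^2 (1 + b xi)]. *)

Set Implicit Arguments.
Unset Strict Implicit.
Unset Printing Implicit Defensive.

Import Order.TTheory GRing.Theory Num.Theory.
Import numFieldNormedType.Exports.

Local Open Scope classical_set_scope.
Local Open Scope ring_scope.

(** * Differential operators acting on all D-modules *)

(** In the statement an operator is a bare map on germs, which cannot be applied to an element of
    another module. Hence [uop]: an operator acts on all D-modules at once, with one family of
    coefficients. An equation modulo the ideal can then be evaluated elsewhere: what vanishes on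
    germs vanishes in the saddle module ([dop_eq0]), where [P1] and [Q1] kill the image of [e] and
    [v] becomes 1.

    The scaling of the saddle module is that of a Gaussian. For [t] of size [b^4], the second
    derivative of the phase at its critical point has size [b^-6], so the relevant width in [y] is
    [b^3], whence [y = b^2 + b^3 xi]. At leading order [D_y + 2 y D_s] becomes [b^-3] times [h |->
    h'/2 - xi h = exp(xi^2) (exp(-xi^2) h)' / 2]. That a Gaussian integral is not zero turns into:
    no nonzero constant lies in the image of this map. Now [theta^N] produces a nonzero constant
    times [b^(-2N)], while the contributions of [P] and [Q] start at [b^(2-2N)] and [b^(4-2N)].

    For regularity, both the Euler lift and the section are arbitrary; [bprod_euler] disposes of the
    first, and the second forces the study of the submodule generated by any section. *)

Section ModuleIdentities.
Variables (O : comNzRingType) (M : lmodType O).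

Inductive mexp :=
  | MAtom of nat | MZero | MAdd of mexp & mexp | MOpp of mexp
  | MScale of O & mexp | MMuln of mexp & nat | MMulz of mexp & int.

Fixpoint meval (env : seq M) e : M := match e with
  | MAtom n => nth 0 env n
  | MZero => 0
  | MAdd e1 e2 => meval env e1 + meval env e2
  | MOpp e1 => - meval env e1
  | MScale a e1 => a *: meval env e1
  | MMuln e1 n => meval env e1 *+ n
  | MMulz e1 k => meval env e1 *~ k
  end.

(** With [eqn] in place of [==], [cbn] decides each comparison of indices, so that [ring] only meets
    literal zeros and ones. *)
Fixpoint mcoef e (i : nat) : O := match e with
  | MAtom n => if eqn n i then 1 else 0
  | MZero => 0
  | MAdd e1 e2 => mcoef e1 i + mcoef e2 i
  | MOpp e1 => - mcoef e1 i
  | MScale a e1 => a * mcoef e1 i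
  | MMuln e1 n => mcoef e1 i *+ n
  | MMulz e1 k => mcoef e1 i *~ k
  end.

Lemma mevalE env e : meval env e = \sum_(i < size env) mcoef e i *: nth 0 env i.
Proof.
elim: e => [n||e1 IH1 e2 IH2|e IH|a e IH|e IH n|e IH k] /=.
- have [lt_n|le_n] := ltnP n (size env).
    rewrite (bigD1 (Ordinal lt_n)) //= big1 ?addr0 => [|i].
      by rewrite -[eqn _ _]/(n == n) eqxx scale1r.
    by rewrite -[eqn _ _]/(n == i) -val_eqE /= eq_sym => /negPf ->; rewrite scale0r.
  rewrite nth_default // big1 // => i _; rewrite -[eqn _ _]/(n == i).
  by rewrite gtn_eqF ?scale0r // (leq_trans (ltn_ord i)).
- by rewrite big1 // => i _; rewrite scale0r.
- by rewrite IH1 IH2 -big_split; apply: eq_bigr => i _; rewrite scalerDl.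
- by rewrite IH -sumrN; apply: eq_bigr => i _; rewrite scaleNr.
- by rewrite IH scaler_sumr; apply: eq_bigr => i _; rewrite scalerA.
- by rewrite IH -sumrMnl; apply: eq_bigr => i _; rewrite scalerMnl.
- rewrite IH -scaler_int scaler_sumr; apply: eq_bigr => i _.
  by rewrite scalerA mulrzl.
Qed.

Fixpoint mcheck e1 e2 n : Prop :=
  if n is n'.+1 then mcoef e1 n' = mcoef e2 n' /\ mcheck e1 e2 n' else True.

Lemma meval_eq env e1 e2 : mcheck e1 e2 (size env) -> meval env e1 = meval env e2.
Proof.
move=> H; rewrite !mevalE; apply: eq_bigr => -[i lt_i] _ /=; congr (_ *: _).
elim: (size env) lt_i H => //= n IHn lt_i [H1 H2].
by move: lt_i; rewrite ltnS leq_eqVlt => /predU1P[->//|/IHn]; apply.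
Qed.

End ModuleIdentities.

Ltac mod_index x l := lazymatch l with
  | x :: _ => constr:(0%N)
  | _ :: ?l' => let n := mod_index x l' in constr:(S n)
  end.

Ltac mod_mem x l := lazymatch l with
  | x :: _ => constr:(true)
  | _ :: ?l' => mod_mem x l'
  | _ => constr:(false)
  end.

Ltac mod_atoms t l := lazymatch t with
  | GRing.add ?a ?b => let l' := mod_atoms a l in mod_atoms b l'
  | GRing.opp ?a => mod_atoms a l
  | GRing.scale _ ?a => mod_atoms a l
  | GRing.natmul ?a _ => mod_atoms a l
  | intmul ?a _ => mod_atoms a l
  | GRing.zero => l
  | _ => let b := mod_mem t l in
    lazymatch b with true => l | false => constr:(t :: l) end
  end.

Ltac mod_reify O t l := lazymatch t with
  | GRing.add ?a ?b => let a' := mod_reify O a l in let b' := mod_reify O b l in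
      constr:(MAdd a' b')
  | GRing.opp ?a => let a' := mod_reify O a l in constr:(MOpp a')
  | GRing.scale ?c ?a => let a' := mod_reify O a l in constr:(@MScale O c a')
  | GRing.natmul ?a ?n => let a' := mod_reify O a l in constr:(MMuln a' n)
  | intmul ?a ?k => let a' := mod_reify O a l in constr:(MMulz a' k)
  | GRing.zero => constr:(@MZero O)
  | _ => let n := mod_index t l in constr:(@MAtom O n)
  end.

(* Proves linear identities in a module, by the [ring] tactic on the
   coefficients of the atoms. *)
Ltac mod_ring O M := lazymatch goal with
  | |- @eq _ ?x ?y =>
    let l1 := mod_atoms x (@nil M) in let l := mod_atoms y l1 in
    let e1 := mod_reify O x l in let e2 := mod_reify O y l in
    change (@meval O M l e1 = @meval O M l e2);
    apply: meval_eq; cbn [mcheck mcoef size eqn];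
    repeat (split; first by ring); exact: Logic.I
  end.

Section DModules.
Variables (O : comNzRingType) (e1 e2 : O -> O).

(** Abstract in [e1] and [e2] because two frames are used: [(Dy, Ds)] for the regularity at points,
    and [(curve_deriv, Ds)], adapted to the curves [s - y^2 = const], for the irregularity. *)
Record dmod := Dmod {
  dmod_car :> lmodType O;
  d1 : dmod_car -> dmod_car;
  d2 : dmod_car -> dmod_car;
  d1D : {morph d1 : x y / x + y};
  d2D : {morph d2 : x y / x + y};
  d1Z : forall a x, d1 (a *: x) = e1 a *: x + a *: d1 x;
  d2Z : forall a x, d2 (a *: x) = e2 a *: x + a *: d2 x;
  d12 : forall x, d1 (d2 x) = d2 (d1 x) }.

Definition dop (M : dmod) m (c : nat -> nat -> O) (x : M) : M :=
  \sum_(i < m.+1) \sum_(j < m.+1 - i) c i j *: iter i (@d1 M) (iter j (@d2 M) x).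

(* An operator acting on all D-modules at once: it remembers the operator and
   not only its action on functions. *)
Definition uop := forall M : dmod, M -> M.

(** The family [c] does not depend on the module: the actions on germs, on D/J and on the saddle
    module come from the same coefficients. *)
Definition isdo m (T : uop) :=
  exists c, forall (M : dmod) (x : M), T M x = dop m c x.

Implicit Types (M : dmod) (T : uop).

Lemma d1_0 M : @d1 M 0 = 0.
Proof. by apply: (addrI (d1 0)); rewrite -d1D !addr0. Qed.

Lemma d2_0 M : @d2 M 0 = 0.
Proof. by apply: (addrI (d2 0)); rewrite -d2D !addr0. Qed.

Lemma d1_sum M n (F : 'I_n -> M) : d1 (\sum_(i < n) F i) = \sum_(i < n) d1 (F i).
Proof. exact: (big_morph _ (@d1D M) (d1_0 M)). Qed.

Lemma d2_sum M n (F : 'I_n -> M) : d2 (\sum_(i < n) F i) = \sum_(i < n) d2 (F i).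
Proof. exact: (big_morph _ (@d2D M) (d2_0 M)). Qed.

Lemma d1N M (x : M) : d1 (- x) = - d1 x.
Proof. by apply: (addrI (d1 x)); rewrite -d1D !addrN d1_0. Qed.

Lemma d2N M (x : M) : d2 (- x) = - d2 x.
Proof. by apply: (addrI (d2 x)); rewrite -d2D !addrN d2_0. Qed.

Lemma d1B M (x y : M) : d1 (x - y) = d1 x - d1 y.
Proof. by rewrite d1D d1N. Qed.

Lemma d2B M (x y : M) : d2 (x - y) = d2 x - d2 y.
Proof. by rewrite d2D d2N. Qed.

Lemma d1Mn M (x : M) n : d1 (x *+ n) = d1 x *+ n.
Proof. by elim: n => [|n IHn]; rewrite ?mulr0n ?d1_0 // !mulrSr d1D IHn. Qed.

Lemma d2Mn M (x : M) n : d2 (x *+ n) = d2 x *+ n.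
Proof. by elim: n => [|n IHn]; rewrite ?mulr0n ?d2_0 // !mulrSr d2D IHn. Qed.

Lemma d2_iter_d1 M i (x : M) : d2 (iter i (@d1 M) x) = iter i (@d1 M) (d2 x).
Proof. by elim: i => //= i <-; rewrite d12. Qed.

Lemma isdo_ext m T T' : (forall M x, T M x = T' M x) -> isdo m T -> isdo m T'.
Proof. by move=> eqT [c cT]; exists c => M x; rewrite -eqT. Qed.

Lemma isdo0 m : isdo m (fun M x => 0).
Proof.
by exists (fun _ _ => 0) => M x; rewrite /dop big1 // => i _; rewrite big1 // => j _;
  rewrite scale0r.
Qed.

Lemma isdoD m T T' : isdo m T -> isdo m T' -> isdo m (fun M x => T M x + T' M x).
Proof.
move=> [c cT] [c' cT']; exists (fun i j => c i j + c' i j) => M x.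
rewrite cT cT' /dop -big_split; apply: eq_bigr => i _; rewrite -big_split.
by apply: eq_bigr => j _; rewrite scalerDl.
Qed.

Lemma isdoZ m T a : isdo m T -> isdo m (fun M x => a *: T M x).
Proof.
move=> [c cT]; exists (fun i j => a * c i j) => M x.
rewrite cT /dop scaler_sumr; apply: eq_bigr => i _; rewrite scaler_sumr.
by apply: eq_bigr => j _; rewrite scalerA.
Qed.

Lemma isdoN m T : isdo m T -> isdo m (fun M x => - T M x).
Proof.
by move=> dT; apply: isdo_ext (isdoZ (-1) dT) => M x; rewrite scaleN1r.
Qed.

Lemma isdoB m T T' : isdo m T -> isdo m T' -> isdo m (fun M x => T M x - T' M x).
Proof. by move=> dT dT'; apply: isdoD dT (isdoN dT'). Qed.

Lemma isdo_sum m n (F : 'I_n -> uop) :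
  (forall i, isdo m (F i)) -> isdo m (fun M x => \sum_(i < n) F i M x).
Proof.
elim: n F => [|n IHn] F dF.
  by apply: isdo_ext (isdo0 m) => M x; rewrite big_ord0.
apply: (@isdo_ext m (fun M x =>
    F ord0 M x + \sum_(i < n) F (lift ord0 i) M x)).
  by move=> M x; rewrite big_ord_recl.
by apply: isdoD (dF _) _; apply: (IHn (fun i => F (lift ord0 i))) => i; apply: dF.
Qed.

Lemma isdo_mono m a i j : (i + j <= m)%N ->
  isdo m (fun M x => a *: iter i (@d1 M) (iter j (@d2 M) x)).
Proof.
move=> le_m; exists (fun i' j' => ((i' == i) && (j' == j))%:R * a) => M x.
have lti : (i < m.+1)%N by lia.
have ltj : (j < m.+1 - i)%N by lia.
rewrite /dop (bigD1 (Ordinal lti)) //= [X in _ + X]big1 ?addr0.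
  rewrite (bigD1 (Ordinal ltj)) //= !eqxx mul1r big1 ?addr0 // => k.
  by rewrite -val_eqE /= => /negPf ->; rewrite mul0r scale0r.
move=> k; rewrite -val_eqE /= => /negPf ->; rewrite big1 // => l _.
by rewrite mul0r scale0r.
Qed.

Lemma isdo_dop m n c : (m <= n)%N -> isdo n (fun M => @dop M m c).
Proof.
move=> le_mn; apply: isdo_sum => i; apply: isdo_sum => j.
by apply: isdo_mono; have := ltn_ord i; have := ltn_ord j; lia.
Qed.

Lemma isdoW m n T : (m <= n)%N -> isdo m T -> isdo n T.
Proof.
by move=> le_mn [c cT]; apply: isdo_ext (isdo_dop c le_mn) => M x; rewrite cT.
Qed.

Lemma isdo_id m : isdo m (fun M x => x).
Proof.
by apply: isdo_ext (@isdo_mono m 1 0 0 (leq0n _)) => M x; rewrite scale1r.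
Qed.

Lemma isdo_d1 m T : isdo m T -> isdo m.+1 (fun M x => d1 (T M x)).
Proof.
move=> [c cT]; pose G i j : uop := fun M x =>
  e1 (c i j) *: iter i (@d1 M) (iter j (@d2 M) x) +
  c i j *: iter i.+1 (@d1 M) (iter j (@d2 M) x).
apply: (@isdo_ext _ (fun M x => \sum_(i < m.+1) \sum_(j < m.+1 - i) G i j M x)).
  move=> M x; rewrite cT d1_sum; apply: eq_bigr => i _; rewrite d1_sum.
  by apply: eq_bigr => j _; rewrite d1Z.
apply: isdo_sum => i; apply: isdo_sum => j.
by apply: isdoD; apply: isdo_mono; have := ltn_ord i; have := ltn_ord j; lia.
Qed.

Lemma isdo_d2 m T : isdo m T -> isdo m.+1 (fun M x => d2 (T M x)).
Proof.
move=> [c cT]; pose G i j : uop := fun M x =>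
  e2 (c i j) *: iter i (@d1 M) (iter j (@d2 M) x) +
  c i j *: iter i (@d1 M) (iter j.+1 (@d2 M) x).
apply: (@isdo_ext _ (fun M x => \sum_(i < m.+1) \sum_(j < m.+1 - i) G i j M x)).
  move=> M x; rewrite cT d2_sum; apply: eq_bigr => i _; rewrite d2_sum.
  by apply: eq_bigr => j _; rewrite d2Z d2_iter_d1.
apply: isdo_sum => i; apply: isdo_sum => j.
by apply: isdoD; apply: isdo_mono; have := ltn_ord i; have := ltn_ord j; lia.
Qed.

Lemma isdo_iter_d1 m i T :
  isdo m T -> isdo (i + m) (fun M x => iter i (@d1 M) (T M x)).
Proof. by move=> dT; elim: i => //= i IHi; apply: (isdo_d1 IHi). Qed.

Lemma isdo_iter_d2 m i T :
  isdo m T -> isdo (i + m) (fun M x => iter i (@d2 M) (T M x)).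
Proof. by move=> dT; elim: i => //= i IHi; apply: (isdo_d2 IHi). Qed.

Lemma isdo_comp m n T T' :
  isdo m T -> isdo n T' -> isdo (m + n) (fun M x => T M (T' M x)).
Proof.
move=> [c cT] dT'; apply: (@isdo_ext _ (fun M x => \sum_(i < m.+1)
   \sum_(j < m.+1 - i) c i j *: iter i (@d1 M) (iter j (@d2 M) (T' M x)))).
  by move=> M x; rewrite cT.
apply: isdo_sum => i; apply: isdo_sum => j; apply: isdoZ.
apply: isdoW (isdo_iter_d1 i (isdo_iter_d2 j dT')).
by have := ltn_ord i; have := ltn_ord j; lia.
Qed.

Lemma isdo_iter m n T : isdo m T -> isdo (n * m) (fun M x => iter n (T M) x).
Proof.
move=> dT; elim: n => [|n IHn]; first exact: isdo_id.
exact: (isdo_comp dT IHn).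
Qed.

Lemma isdo_scale m a : isdo m (fun M x => a *: x).
Proof. exact: isdoZ (isdo_id m). Qed.

Lemma dopD M m c : {morph @dop M m c : x y / x + y}.
Proof.
move=> x y; rewrite /dop -big_split; apply: eq_bigr => i _.
rewrite -big_split; apply: eq_bigr => j _ /=; rewrite -scalerDr; congr (_ *: _).
have iter2D n : iter n (@d2 M) (x + y) = iter n (@d2 M) x + iter n (@d2 M) y.
  by elim: n => //= n ->; rewrite d2D.
have iter1D n u v : iter n (@d1 M) (u + v) = iter n (@d1 M) u + iter n (@d1 M) v.
  by elim: n => //= n ->; rewrite d1D.
by rewrite iter2D iter1D.
Qed.

Lemma isdo_additive m T M : isdo m T -> {morph T M : x y / x + y}.
Proof. by move=> [c cT] x y; rewrite !cT dopD. Qed.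

Lemma isdo_zero m T M : isdo m T -> T M 0 = 0.
Proof.
by move=> dT; apply: (addrI (T M 0)); rewrite -(isdo_additive dT) !addr0.
Qed.

Lemma isdo_opp m T M x : isdo m T -> T M (- x) = - T M x.
Proof.
move=> dT; apply: (addrI (T M x)).
by rewrite -(isdo_additive dT) !addrN (isdo_zero M dT).
Qed.

Lemma isdo_natmul m T M x n : isdo m T -> T M (x *+ n) = T M x *+ n.
Proof.
move=> dT; elim: n => [|n IHn]; first by rewrite !mulr0n (isdo_zero M dT).
by rewrite !mulrS (isdo_additive dT) IHn.
Qed.

End DModules.

(** * Germs of holomorphic functions *)

Section FpsTheory.
Variable A : comNzRingType.
Implicit Types f g : fps A.

Lemma fps_sumE n (F : 'I_n -> fps A) k : (\sum_(i < n) F i) k = \sum_(i < n) F i k.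
Proof. exact: (big_morph (fun h : fps A => h k) (id1 := 0) (op1 := +%R)). Qed.

Lemma fps_mulE f g n : (f * g) n = \sum_(i < n.+1) f i * g (n - i)%N.
Proof. by []. Qed.

Lemma fps_mulnE f n k : (f *+ n) k = f k *+ n.
Proof. by elim: n => // n IHn; rewrite !mulrS -IHn. Qed.

Lemma coefM_fps f g (p q : {poly A}) n :
  (forall i, (i <= n)%N -> p`_i = f i) -> (forall i, (i <= n)%N -> q`_i = g i) ->
  (p * q)`_n = (f * g) n.
Proof.
move=> pf qg; rewrite coefM; apply: eq_bigr => i _.
by rewrite pf ?qg ?leq_subr // -ltnS.
Qed.

Definition fps_poly n f : {poly A} := \poly_(i < n.+1) f i.

Lemma coef_fps_poly n f i : (i <= n)%N -> (fps_poly n f)`_i = f i.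
Proof. by move=> le_in; rewrite coef_poly ltnS le_in. Qed.

Definition fps_deriv f : fps A := fun n => f n.+1 *+ n.+1.

Lemma fps_derivM f g : fps_deriv (f * g) = fps_deriv f * g + f * fps_deriv g.
Proof.
apply/funext => n.
have D h i : (i <= n)%N -> ((fps_poly n.+1 h)^`())`_i = fps_deriv h i.
  by move=> le_in; rewrite coef_deriv coef_fps_poly.
have E h i : (i <= n)%N -> (fps_poly n.+1 h)`_i = h i.
  by move=> le_in; rewrite coef_fps_poly // leqW.
transitivity (((fps_poly n.+1 f * fps_poly n.+1 g)^`())`_n).
  rewrite coef_deriv; congr (_ *+ _); symmetry.
  by apply: coefM_fps => i; apply: coef_fps_poly.
rewrite derivM coefD; congr (_ + _).
  by apply: coefM_fps => i; [apply: D | apply: E].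
by apply: coefM_fps => i; [apply: E | apply: D].
Qed.

Lemma fps_mul_affine f g n : (forall k, f k.+2 = 0) ->
  (f * g) n = f 0%N * g n + (if n is n'.+1 then f 1%N * g n' else 0).
Proof.
move=> f0; rewrite fps_mulE big_ord_recl /= subn0; congr (_ + _).
case: n => [|n]; first by rewrite big_ord0.
rewrite big_ord_recl /= subSS subn0 big1 ?addr0 // => i _.
by rewrite /bump /= !add1n f0 mul0r.
Qed.

Lemma fps_unit f u : f 0%N * u = 1 -> exists g, f * g = 1.
Proof.
move=> fu.
(* A coefficient of the inverse depends on all the earlier ones, so the recursion carries the list
   of the first [n + 1] of them; by [stable], later stages do not alter it. *)
pose fix s n : seq A := if n is n'.+1
  then rcons (s n') (- u * \sum_(i < n'.+1) f (n'.+1 - i)%N * (s n')`_i)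
  else [:: u].
have size_s n : size (s n) = n.+1 by elim: n => //= n IHn; rewrite size_rcons IHn.
have sS n : s n.+1 =
  rcons (s n) (- u * \sum_(i < n.+1) f (n.+1 - i)%N * (s n)`_i) by [].
have stable n k i : (i <= n)%N -> (s (n + k)%N)`_i = (s n)`_i.
  move=> le_in; elim: k => [|k IHk]; first by rewrite addn0.
  by rewrite addnS sS nth_rcons size_s ltnS (leq_trans le_in) ?leq_addr.
exists (fun n => (s n)`_n); apply/funext => -[|n].
  by rewrite fps_mulE big_ord1.
rewrite mulrC fps_mulE big_ord_recr /= subnn nth_rcons size_s.
rewrite ltnn eqxx mulrC mulrA mulrN fu mulN1r.
rewrite (eq_bigr (fun i : 'I_n.+1 => f (n.+1 - i)%N * (s n)`_i)) ?subrr // => i _.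
rewrite mulrC; congr (_ * _); have := stable i (n - i)%N i (leqnn i).
by rewrite subnKC // -ltnS.
Qed.

End FpsTheory.

Section GermTheory.
Variable R : realType.
Local Notation C := R[i].
Local Notation O := (germ R).
Local Notation nc := (@ComplexField.Normc.normc R).
Implicit Types (f g h : O) (p : Z R).

Lemma germ_ext f g : (forall i j, taylor f i j = taylor g i j) -> f = g.
Proof. by move=> fg; apply/val_inj/funext => i; apply/funext => j; apply: fg. Qed.

Lemma taylorD f g i j : taylor (f + g) i j = taylor f i j + taylor g i j.
Proof. by []. Qed.

Lemma taylorN f i j : taylor (- f) i j = - taylor f i j.
Proof. by []. Qed.

Lemma taylor_sum n (F : 'I_n -> O) i j :
  taylor (\sum_(k < n) F k) i j = \sum_(k < n) taylor (F k) i j.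
Proof.
exact: (big_morph (fun h : O => taylor h i j) (id1 := 0) (op1 := +%R)).
Qed.

Lemma taylorMn f n i j : taylor (f *+ n) i j = taylor f i j *+ n.
Proof. by elim: n => // n IHn; rewrite !mulrS taylorD IHn. Qed.

Lemma taylorM f g i j : taylor (f * g) i j =
  \sum_(a < i.+1) \sum_(b < j.+1) taylor f a b * taylor g (i - a)%N (j - b)%N.
Proof. exact: fps_sumE. Qed.

Lemma taylor1 i j : taylor (1 : O) i j = ((i == 0%N) && (j == 0%N))%:R.
Proof. by case: i => [|i]; case: j. Qed.

Lemma taylorDy f i j : taylor (Dy f) i j = taylor f i.+1 j *+ i.+1. Proof. by []. Qed.
Lemma taylorDs f i j : taylor (Ds f) i j = taylor f i j.+1 *+ j.+1. Proof. by []. Qed.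

Lemma taylor_affineM (c a b : C) f i j : taylor (affine_germ c a b * f) i j =
  c * taylor f i j + (if i is i'.+1 then a * taylor f i' j else 0)
  + (if j is j'.+1 then b * taylor f i j' else 0).
Proof.
have mulE (g h : fps (fps C)) k : (g + h) k = g k + h k by [].
rewrite [LHS](congr1 (fun h : fps C => h j)
  (@fps_mul_affine _ (taylor (affine_germ c a b)) (taylor f) i _)); last first.
  by move=> k; apply/funext => -[|l].
rewrite [LHS]/(_ + _).
rewrite (@fps_mul_affine _ (taylor (affine_germ c a b) 0%N)) /=; last by case.
rewrite addrAC; congr (_ + _ + _); case: i => [|i] //.
rewrite (@fps_mul_affine _ (taylor (affine_germ c a b) 1%N)) /=; last by case.
by case: j => [|j]; rewrite ?mul0r addr0.
Qed.

Lemma taylor_ycoordM p f i j : taylor (ycoord p * f) i j =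
  p.1 * taylor f i j + (if i is i'.+1 then taylor f i' j else 0).
Proof.
rewrite taylor_affineM; case: i => [|i]; case: j => [|j];
  by rewrite ?mul1r ?mul0r ?addr0.
Qed.

Lemma taylor_scoordM p f i j : taylor (scoord p * f) i j =
  p.2 * taylor f i j + (if j is j'.+1 then taylor f i j' else 0).
Proof.
rewrite taylor_affineM; case: i => [|i]; case: j => [|j];
  by rewrite ?mul1r ?mul0r ?addr0.
Qed.

Lemma DyD f g : Dy (f + g) = Dy f + Dy g.
Proof. by apply: germ_ext => i j; rewrite taylorD !taylorDy taylorD mulrnDl. Qed.

Lemma DsD f g : Ds (f + g) = Ds f + Ds g.
Proof. by apply: germ_ext => i j; rewrite taylorD !taylorDs taylorD mulrnDl. Qed.

Lemma DyN f : Dy (- f) = - Dy f.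
Proof. by apply: germ_ext => i j; rewrite taylorN !taylorDy taylorN mulNrn. Qed.

Lemma DsN f : Ds (- f) = - Ds f.
Proof. by apply: germ_ext => i j; rewrite taylorN !taylorDs taylorN mulNrn. Qed.

Lemma DyM f g : Dy (f * g) = Dy f * g + f * Dy g.
Proof.
have DyE h : taylor (Dy h) = fps_deriv (taylor h).
  by apply/funext => i; apply/funext => j; rewrite /fps_deriv fps_mulnE.
apply/val_inj.
change (taylor (Dy (f * g)) = taylor (Dy f) * taylor g + taylor f * taylor (Dy g)).
by rewrite !DyE; apply: fps_derivM.
Qed.

Lemma DsM f g : Ds (f * g) = Ds f * g + f * Ds g.
Proof.
have DsE h i : taylor (Ds h) i = fps_deriv (taylor h i) by [].
apply: germ_ext => i j.
change (fps_deriv ((taylor f * taylor g) i) j =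
  (taylor (Ds f) * taylor g) i j + (taylor f * taylor (Ds g)) i j).
rewrite (fps_mulE (taylor f)) (fps_mulE (taylor (Ds f))) (fps_mulE (taylor f)).
rewrite /fps_deriv !fps_sumE -big_split -sumrMnl; apply: eq_bigr => k _ /=.
change (fps_deriv (taylor f k * taylor g (i - k)%N) j =
  (fps_deriv (taylor f k) * taylor g (i - k)%N +
   taylor f k * fps_deriv (taylor g (i - k)%N)) j).
by rewrite fps_derivM.
Qed.

Lemma DyDs f : Dy (Ds f) = Ds (Dy f).
Proof.
apply: germ_ext => i j; rewrite taylorDy !taylorDs taylorDy -!mulrnA mulnC.
by [].
Qed.

Definition gconst (c : C) : O := affine_germ c 0 0.

Lemma taylor_gconst c i j : taylor (gconst c) i j = c *+ ((i == 0%N) && (j == 0%N)).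
Proof. by case: i => [|[|i]]; case: j => [|[|j]]. Qed.

Lemma taylor_gconstM c f i j : taylor (gconst c * f) i j = c * taylor f i j.
Proof. by rewrite taylor_affineM; case: i => [|i]; case: j => [|j]; rewrite ?mul0r ?addr0. Qed.

Lemma Dy_affine c a b : Dy (affine_germ c a b) = gconst a.
Proof. by apply: germ_ext => -[|[|i]] [|[|j]]; rewrite taylorDy taylor_gconst /= ?mul0rn. Qed.

Lemma Ds_affine c a b : Ds (affine_germ c a b) = gconst b.
Proof. by apply: germ_ext => -[|[|i]] [|[|j]]; rewrite taylorDs taylor_gconst /= ?mul0rn. Qed.

Lemma gconst1 : gconst 1 = 1.
Proof. by apply: germ_ext => i j; rewrite taylor_gconst taylor1; case: (_ && _). Qed.

Lemma gconst0 : gconst 0 = 0.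
Proof. by apply: germ_ext => i j; rewrite taylor_gconst mul0rn. Qed.

Lemma Dy1 : Dy 1 = 0 :> O. Proof. by rewrite -gconst1 Dy_affine gconst0. Qed.
Lemma Ds1 : Ds 1 = 0 :> O. Proof. by rewrite -gconst1 Ds_affine gconst0. Qed.

Lemma Dy_ycoord p : Dy (ycoord p) = 1. Proof. by rewrite Dy_affine gconst1. Qed.
Lemma Dy_scoord p : Dy (scoord p) = 0. Proof. by rewrite Dy_affine gconst0. Qed.
Lemma Ds_ycoord p : Ds (ycoord p) = 0. Proof. by rewrite Ds_affine gconst0. Qed.
Lemma Ds_scoord p : Ds (scoord p) = 1. Proof. by rewrite Ds_affine gconst1. Qed.

Lemma normCE (z : C) : `|z| = (nc z)%:C%C. Proof. by []. Qed.

Lemma nc_ge0 (z : C) : 0 <= nc z.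
Proof. by rewrite -ler0c -normCE. Qed.

Lemma nc0 : nc 0 = 0. Proof. exact: ComplexField.Normc.normc0. Qed.
Lemma nc1 : nc 1 = 1. Proof. exact: ComplexField.Normc.normc1. Qed.

Lemma nc_sum n (F : 'I_n -> C) : nc (\sum_(i < n) F i) <= \sum_(i < n) nc (F i).
Proof.
rewrite -lecR -normCE; apply: le_trans (ler_norm_sum _ _ _) _.
by rewrite rmorph_sum /=; apply: ler_sum.
Qed.

Lemma ncM (x y : C) : nc (x * y) = nc x * nc y.
Proof. exact: ComplexField.Normc.normcM. Qed.

Lemma ncD (x y : C) : nc (x + y) <= nc x + nc y.
Proof. exact: le_normcD. Qed.

Lemma ncB (x y : C) : nc (x - y) <= nc x + nc y.
Proof. by rewrite -lecR rmorphD /= -!normCE ler_normB. Qed.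

Lemma ncX (x : C) n : nc (x ^+ n) = nc x ^+ n.
Proof.
elim: n => [|n IHn]; first by rewrite !expr0 nc1.
by rewrite !exprS ncM IHn.
Qed.

Lemma nc_eq0 (x : C) : (nc x == 0) = (x == 0).
Proof.
apply/eqP/eqP => [/ComplexField.Normc.eq0_normc //|->].
exact: nc0.
Qed.

(** Transfers the bounds from the partially ordered [C] to the real field, where [lra] and [nra]
    apply; the radius is cut to at most 1 so that its powers decrease. *)
Lemma convergent_ncP (f : fps (fps C)) : reflect
  (exists r M : R, [/\ 0 < r, r <= 1, 0 <= M & forall i j, nc (f i j) * r ^+ (i + j) <= M])
  (f \in @convergent R).
Proof.
apply: (iffP idP) => [/convergentP[r [M cf]]|[r [M [r0 _ M0 fM]]]]; last first.
  apply/convergentP; exists (r%:C)%C, (M%:C)%C; split=> [|i j]; first by rewrite ltcR.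
  by rewrite normCE -rmorphXn -rmorphM lecR.
have M0 := convergent_bound_ge0 cf; have [r0 _] := cf.
have rr := RRe_real (gtr0_real r0); have MM := RRe_real (ger0_real M0).
move: cf r0 M0; rewrite -rr -MM; set r' := complex.Re r; set M' := complex.Re M.
move=> cf; rewrite ltcR lecR => r0 M0.
exists (Num.min r' 1), M'; split=> //.
- by rewrite lt_min r0 ltr01.
- by rewrite ge_min lexx orbT.
move=> i j; have [_ /(_ i j)] := cf.
rewrite normCE -rmorphXn -rmorphM lecR; apply: le_trans.
rewrite ler_wpM2l ?nc_ge0 // lerXn2r ?nnegrE ?ge_min ?lexx //.
  by rewrite le_min ltW ?ler01.
by rewrite ltW.
Qed.

Lemma germ_bound f : exists r M : R,
  [/\ 0 < r, r <= 1, 0 <= M & forall i j, nc (taylor f i j) * r ^+ (i + j) <= M].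
Proof. exact/convergent_ncP/taylor_convergent. Qed.

Lemma geom_bound (q : R) n : 0 <= q -> q <= 1 / 2 -> \sum_(i < n) q ^+ i <= 1 + 2 * q.
Proof.
move=> q0 q2; case: n => [|n]; first by rewrite big_ord0; lra.
rewrite big_ord_recl expr0 lerD2l; elim: n => [|n IHn]; first by rewrite big_ord0; lra.
rewrite big_ord_recl /= expr1.
have -> : \sum_(i < n) q ^+ bump 0 (bump 0 i) = q * \sum_(i < n) q ^+ bump 0 i.
  by rewrite mulr_sumr; apply: eq_bigr => i _; rewrite -exprS.
by nra.
Qed.

(** The product [f_00 g_ij] is the coefficient of 1 minus the sum of [f_ab g_(i-a,j-b)] over
    [(a,b) <> (0,0)]. Induction on [i + j] bounds [g] by [1 / |f_00|] at the radius [q r], once [q]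
    is small enough for that sum to be absorbed. *)
Lemma fps_inv_convergent (f g : fps (fps C)) : f \in @convergent R ->
  f 0%N 0%N != 0 -> f * g = 1 -> g \in @convergent R.
Proof.
move=> /convergent_ncP[r [M [r0 _ M0 fM]]] f00 fg.
pose c := nc (f 0%N 0%N).
have c0 : 0 < c by rewrite lt_neqAle eq_sym nc_eq0 f00 nc_ge0.
(* The sum of [q^(a+b)] over [(a,b) <> (0,0)] is at most [(1 + 2q)^2 - 1 <= 8q], and this choice
   gives [8 M q <= c]. *)
pose q := c / (8 * (M + c)).
have Mc : 0 < 8 * (M + c) by lra.
have q0 : 0 < q by rewrite divr_gt0.
have qE : 8 * (M + c) * q = c by rewrite /q mulrC divfK // gt_eqF.
have q8 : q <= 1 / 8 by nra.
pose G := c^-1; have G0 : 0 < G by rewrite invr_gt0.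
have cG : c * G = 1 by rewrite mulfV // gt_eqF.
have ind n : forall i j, (i + j < n)%N -> nc (g i j) * (q * r) ^+ (i + j) <= G.
  elim: n => [//|n IHn] i j lt_ij.
  pose h a b : C := if (a == 0%N) && (b == 0%N) then 0 else - f a b.
  have gij : f 0%N 0%N * g i j = ((i == 0%N) && (j == 0%N))%:R +
      \sum_(a < i.+1) \sum_(b < j.+1) h a b * g (i - a)%N (j - b)%N.
    have <- : (f * g) i j = ((i == 0%N) && (j == 0%N))%:R.
      by rewrite fg; case: (i) => [|?]; case: (j).
    have -> : (f * g) i j = \sum_(a < i.+1) \sum_(b < j.+1)
        f a b * g (i - a)%N (j - b)%N by exact: fps_sumE.
    rewrite -big_split /= big_ord_recl -big_split big_ord_recl /= !subn0.
    rewrite [X in _ + X]big1 ?addr0 => [|a _]; last first.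
      by rewrite -big_split big1 // => b _; rewrite /h /= mulNr subrr.
    rewrite [X in _ + X]big1 ?addr0 => [|a _]; last by rewrite /h /= mulNr subrr.
    by rewrite /h eqxx mul0r addr0.
  pose B a b : R := M * G * (q ^+ (a + b) - ((a == 0%N) && (b == 0%N))%:R).
  have le_c : c * (nc (g i j) * (q * r) ^+ (i + j)) <=
      ((i == 0%N) && (j == 0%N))%:R + \sum_(a < i.+1) \sum_(b < j.+1) B a b.
    rewrite mulrA -ncM gij.
    have qr0 : 0 <= (q * r) ^+ (i + j) by rewrite exprn_ge0 // mulr_ge0 // ltW.
    apply: le_trans (ler_wpM2r qr0 (ncD _ _)) _; rewrite mulrDl; apply: lerD.
      case: (boolP ((i == 0%N) && (j == 0%N))) => [/andP[/eqP-> /eqP->]|_].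
        by rewrite mulr1n nc1 addn0 expr0 mulr1.
      by rewrite mulr0n nc0 mul0r.
    apply: le_trans (ler_wpM2r qr0 (nc_sum _)) _; rewrite mulr_suml.
    apply: ler_sum => a _; apply: le_trans (ler_wpM2r qr0 (nc_sum _)) _.
    rewrite mulr_suml; apply: ler_sum => b _.
    rewrite /h /B; case: ifPn => [/andP[/eqP-> /eqP->]|ab0].
      by rewrite mul0r nc0 mul0r addn0 expr0 subrr mulr0.
    rewrite subr0 ncM -normcN opprK.
    have lta := ltn_ord a; have ltb := ltn_ord b.
    have -> : (i + j = (a + b) + ((i - a) + (j - b)))%N by lia.
    rewrite exprD [(q * r) ^+ (a + b)]exprMn.
    rewrite [X in X <= _](_ : _ = (nc (f a b) * r ^+ (a + b)) *
      (nc (g (i - a)%N (j - b)%N) * (q * r) ^+ (i - a + (j - b))) * q ^+ (a + b));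
      last by ring.
    rewrite ler_wpM2r ?exprn_ge0 ?(ltW q0) //.
    apply: ler_pM; [| |exact: fM|].
    - by rewrite mulr_ge0 ?nc_ge0 ?exprn_ge0 ?(ltW r0).
    - by rewrite mulr_ge0 ?nc_ge0 ?exprn_ge0 // mulr_ge0 ?(ltW q0) ?(ltW r0).
    by apply: IHn; move: ab0; rewrite negb_and -!lt0n => /orP[]; lia.
  have sumB : \sum_(a < i.+1) \sum_(b < j.+1) B a b =
      M * G * ((\sum_(a < i.+1) q ^+ a) * (\sum_(b < j.+1) q ^+ b) - 1).
    rewrite mulr_suml; under eq_bigr do rewrite -mulr_sumr sumrB.
    rewrite -mulr_sumr sumrB; congr (_ * (_ - _)).
      apply: eq_bigr => a _; rewrite mulr_sumr; apply: eq_bigr => b _.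
      by rewrite exprD.
    rewrite big_ord_recl big_ord_recl /= big1 ?addr0 // big1 ?addr0 // => a _.
    by rewrite big1.
  have [ij0|ij0] := boolP ((i == 0%N) && (j == 0%N)).
    move/andP: ij0 le_c => [/eqP-> /eqP->]; rewrite /= !big_ord1 /B /= addn0 expr0.
    by rewrite subrr mulr0 addr0 mulr1 -[X in _ <= X]cG ler_pM2l.
  move: le_c; rewrite (negPf ij0) add0r sumB => le_c.
  rewrite -(ler_pM2l c0); apply: le_trans le_c _.
  have A1 := @geom_bound q i.+1 (ltW q0); have A2 := @geom_bound q j.+1 (ltW q0).
  have S1 : 0 <= \sum_(a < i.+1) q ^+ a by apply: sumr_ge0 => a _; rewrite exprn_ge0 ?(ltW q0).
  have S2 : 0 <= \sum_(a < j.+1) q ^+ a by apply: sumr_ge0 => a _; rewrite exprn_ge0 ?(ltW q0).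
  have {}A1 := A1 ltac:(lra); have {}A2 := A2 ltac:(lra).
  set S := \sum_(a < i.+1) _ in S1 A1 *; set T := \sum_(a < j.+1) _ in S2 A2 *.
  rewrite mulrAC ler_pM2r //; apply: le_trans (_ : M * (8 * q) <= _); last by nra.
  by rewrite ler_wpM2l //; nra.
apply/convergentP; exists ((q * r)%:C)%C, (G%:C)%C; split; first by rewrite ltcR mulr_gt0.
by move=> i j; rewrite normCE -rmorphXn -rmorphM lecR; apply: (ind (i + j).+1).
Qed.

Lemma germ_inv f : taylor f 0%N 0%N != 0 -> exists g : O, f * g = 1.
Proof.
move=> f00; have [u fu] : exists u : fps C, taylor f 0%N * u = 1.
  by apply: (@fps_unit _ _ (taylor f 0%N 0%N)^-1); rewrite mulfV.
have [g fg] := fps_unit fu.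
have cg := fps_inv_convergent (taylor_convergent f) f00 fg.
by exists (Germ cg); apply/val_inj.
Qed.

End GermTheory.

(** * The maximal ideal of a point *)

Section PointIdeal.
Variable R : realType.
Local Notation C := R[i].
Local Notation O := (germ R).
Implicit Types (f g h : O) (p : Z R) (M : dmod (@Dy R) (@Ds R)).
Local Notation uop := (uop (@Dy R) (@Ds R)).
Implicit Types T : uop.

Definition germ_dmod : dmod (@Dy R) (@Ds R) :=
  @Dmod _ (@Dy R) (@Ds R) O^o (@Dy R) (@Ds R) (@DyD R) (@DsD R) (@DyM R) (@DsM R)
    (@DyDs R).

Lemma D_ord_isdo m T : isdo m T -> D_ord m (T germ_dmod : O -> O).
Proof. by move=> [c cT]; exists c; apply/funext => f; rewrite cT. Qed.

Lemma D_ordP m (P : O -> O) :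
  D_ord m P -> exists T, isdo m T /\ P = T germ_dmod.
Proof. by move=> [c ->]; exists (fun M => @dop _ _ _ M m c); split=> //; exists c. Qed.

Lemma ideal_mulTT : ideal_mul [set: O] setT = setT.
Proof.
apply/seteqP; split=> // f _; exists 1%N, (fun=> 1), (fun=> f); split=> //.
by rewrite big_ord1 mul1r.
Qed.

Lemma ideal_expzT l : ideal_expz [set: O] l = setT.
Proof.
by case: l => // n; rewrite /ideal_expz; elim: n => //= n ->; rewrite ideal_mulTT.
Qed.

Lemma ideal_of_set1_neq p q : q != p -> ideal_of [set p] q = setT.
Proof.
move=> qp; apply/seteqP; split=> // f _; rewrite /ideal_of /=.
have : nbhs (q : (C^o * C^o)%type) [set~ p].
  apply: open_nbhs_nbhs; split; last exact/eqP.
  apply: closed_openC; apply: accessible_closed_set1.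
  exact/hausdorff_accessible/norm_hausdorff.
by apply: filterS => z zp /zp.
Qed.

Lemma vanishes_at0 f : vanishes_at f 0 <-> taylor f 0%N 0%N = 0.
Proof.
have E n : \sum_(i < n.+1) \sum_(j < n.+1)
    taylor f i j * (0 : Z R).1 ^+ i * (0 : Z R).2 ^+ j = taylor f 0%N 0%N.
  rewrite big_ord_recl big_ord_recl /= !expr0 !mulr1 big1 => [|j _]; last first.
    by rewrite /= expr0n mulr0.
  rewrite addr0 big1 ?addr0 // => i _.
  by rewrite big1 // => j _; rewrite /= expr0n mulr0 mul0r.
rewrite /vanishes_at -(cvg_shiftS (fun n => _ : C^o)) /=.
rewrite (_ : (fun n => _) = fun=> (taylor f 0%N 0%N : C^o)); last exact/funext.
split=> [|->]; last exact: cvg_cst.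
by move/(cvg_lim (@norm_hausdorff _ C^o)); rewrite lim_cst //; exact: norm_hausdorff.
Qed.

Lemma ideal_of_set1 p : ideal_of [set p] p = [set f : O | taylor f 0%N 0%N = 0].
Proof.
apply/seteqP; split=> f /=.
  move/(@nbhs_singleton (C^o * C^o)%type p) => /(_ erefl).
  by rewrite subrr vanishes_at0.
move=> f0; apply: (@filterE _ _ (nbhs_filter (p : (C^o * C^o)%type))) => z ->.
by rewrite subrr; apply/vanishes_at0.
Qed.

(* [ord_ge l f] says that [f] belongs to the [l]-th power of the maximal ideal,
   the condition being void for [l <= 0]. *)
Definition ord_ge (l : int) f := forall i j, (i + j)%N%:Z < l -> taylor f i j = 0.

Definition mideal : set O := [set f | taylor f 0%N 0%N = 0].

Fact germ_divy_convergent f :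
  ((fun i j => taylor f i.+1 j) : fps (fps C)) \in @convergent R.
Proof.
have [r [M [r0 r1 M0 fM]]] := germ_bound f.
apply/convergent_ncP; exists r, (M / r); split; rewrite ?divr_ge0 ?(ltW r0) // => i j.
by rewrite ler_pdivlMr // -mulrA -exprSr -addSn.
Qed.

Fact germ_divs_convergent f :
  ((fun i j => taylor f i j.+1) : fps (fps C)) \in @convergent R.
Proof.
have [r [M [r0 r1 M0 fM]]] := germ_bound f.
apply/convergent_ncP; exists r, (M / r); split; rewrite ?divr_ge0 ?(ltW r0) // => i j.
by rewrite ler_pdivlMr // -mulrA -exprSr -addnS.
Qed.

Definition divy f : O := Germ (germ_divy_convergent f).
Definition divs f : O := Germ (germ_divs_convergent f).

Fact germ_resty_convergent f :
  ((fun i j => if i is 0%N then taylor f i j else 0) : fps (fps C)) \in @convergent R.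
Proof.
have [r [M [r0 r1 M0 fM]]] := germ_bound f.
apply/convergent_ncP; exists r, M; split=> // -[|i] j; first exact: fM.
by rewrite nc0 mul0r.
Qed.

Definition resty f : O := Germ (germ_resty_convergent f).

Local Notation yc := (ycoord (0 : Z R)).
Local Notation sc := (scoord (0 : Z R)).

Lemma taylor_ycM f i j :
  taylor (yc * f) i j = if i is i'.+1 then taylor f i' j else 0.
Proof. by rewrite taylor_ycoordM /= mul0r add0r. Qed.

Lemma taylor_scM f i j :
  taylor (sc * f) i j = if j is j'.+1 then taylor f i j' else 0.
Proof. by rewrite taylor_scoordM /= mul0r add0r. Qed.

Lemma germ_split f : f = yc * divy f + resty f.
Proof.
apply: germ_ext => i j; rewrite taylorD taylor_ycM.
by case: i => [|i]; rewrite ?add0r ?addr0.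
Qed.

Lemma divsE f : (forall i, taylor f i 0%N = 0) -> f = sc * divs f.
Proof.
by move=> f0; apply: germ_ext => i [|j]; rewrite taylor_scM // f0.
Qed.

Lemma divyE f : (forall j, taylor f 0%N j = 0) -> f = yc * divy f.
Proof.
by move=> f0; apply: germ_ext => -[|i] j; rewrite taylor_ycM // f0.
Qed.

Lemma ord_geM k l f g : ord_ge k f -> ord_ge l g -> ord_ge (k + l) (f * g).
Proof.
move=> fk gl i j lt_ij; rewrite taylorM big1 // => a _; rewrite big1 // => b _.
have lta := ltn_ord a; have ltb := ltn_ord b.
have [lt_ab|le_ab] := ltP (a + b)%N%:Z k; first by rewrite fk ?mul0r.
by rewrite gl ?mulr0 //; lia.
Qed.

Lemma ord_geW k l f : (l <= k)%R -> ord_ge k f -> ord_ge l f.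
Proof. by move=> le_lk fk i j lt_ij; apply: fk; apply: lt_le_trans le_lk. Qed.

Lemma ord_geD l f g : ord_ge l f -> ord_ge l g -> ord_ge l (f + g).
Proof. by move=> fl gl i j lt_ij; rewrite taylorD fl ?gl ?addr0. Qed.

Lemma ord_geN l f : ord_ge l f -> ord_ge l (- f).
Proof. by move=> fl i j lt_ij; rewrite taylorN fl ?oppr0. Qed.

Lemma ord_geB l f g : ord_ge l f -> ord_ge l g -> ord_ge l (f - g).
Proof. by move=> fl gl; apply: ord_geD fl (ord_geN gl). Qed.

Lemma ord_ge_le0 l f : l <= 0 -> ord_ge l f.
Proof. by move=> l0 i j; lia. Qed.

Lemma ord_ge_sum l n (F : 'I_n -> O) :
  (forall i, ord_ge l (F i)) -> ord_ge l (\sum_(i < n) F i).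
Proof.
by move=> FO i j lt_ij; rewrite taylor_sum big1 // => k _; apply: FO.
Qed.

Lemma ord_ge_Dy l f : ord_ge l f -> ord_ge (l - 1) (Dy f).
Proof. by move=> fl i j lt_ij; rewrite taylorDy fl ?mul0rn //; lia. Qed.

Lemma ord_ge_Ds l f : ord_ge l f -> ord_ge (l - 1) (Ds f).
Proof. by move=> fl i j lt_ij; rewrite taylorDs fl ?mul0rn //; lia. Qed.

Lemma midealE f : mideal f <-> ord_ge 1 f.
Proof.
split=> [f0 i j lt_ij|fO]; last exact: fO.
have -> : i = 0%N by lia.
by have -> : j = 0%N by lia.
Qed.

(** A germ of order at least [l + 1] is [y] times a germ plus [s] times a germ, both of order at
    least [l]. This turns the V-filtration at a point into a condition on Taylor coefficients. *)
Lemma ideal_expn_mideal l : ideal_expn mideal l = [set f | ord_ge l f].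
Proof.
elim: l => [|l IHl] /=.
  by apply/seteqP; split=> // f _ i j; lia.
rewrite IHl; apply/seteqP; split=> f.
  move=> [n [g [h [gI hI ->]]]]; apply: ord_ge_sum => k.
  rewrite -add1n PoszD; apply: ord_geM (hI k).
  exact/midealE/gI.
move=> fl; exists 2%N, (fun k : 'I_2 => if val k == 0%N then yc else sc),
  (fun k : 'I_2 => if val k == 0%N then divy f else divs (resty f)).
split.
- by move=> k; case: ifP.
- move=> k; case: ifP => _ i j lt_ij; first by apply: fl; lia.
  by case: i lt_ij => [|i] //= lt_ij; apply: fl; lia.
rewrite big_ord_recl big_ord1 /= [LHS]germ_split; congr (_ + _).
apply: divsE => -[|i] //=; apply: fl; lia.
Qed.

Lemma ideal_expz_mideal l : ideal_expz mideal l = [set f | ord_ge l f].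
Proof.
case: l => l; first exact: ideal_expn_mideal.
by apply/seteqP; split=> // f _ i j; rewrite NegzE; lia.
Qed.

Lemma V_midealP k (P : O -> O) : V_ mideal k P <->
  D_ P /\ forall l f, ord_ge l f -> ord_ge (l - k) (P f).
Proof.
split=> -[DP VP]; split=> // l f.
  by have := VP l f; rewrite !ideal_expz_mideal.
by rewrite !ideal_expz_mideal; apply: VP.
Qed.

Lemma ord_ge_isdo m T l f : isdo m T -> ord_ge l f -> ord_ge (l - m%:Z) (T germ_dmod f).
Proof.
move=> [c ->] fl; apply: ord_ge_sum => i; apply: ord_ge_sum => j.
have H1 k g : ord_ge l g -> ord_ge (l - k%:Z) (iter k (@Ds R) g).
  move=> gl; elim: k => [|k IHk]; first by apply: ord_geW gl; lia.
  by apply: ord_geW (ord_ge_Ds IHk); lia.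
have H2 k l' g : ord_ge l' g -> ord_ge (l' - k%:Z) (iter k (@Dy R) g).
  move=> gl; elim: k => [|k IHk]; first by apply: ord_geW gl; lia.
  by apply: ord_geW (ord_ge_Dy IHk); lia.
have lti := ltn_ord i; have ltj := ltn_ord j.
apply: (@ord_geW (0 + (l - j%:Z - i%:Z))); first lia.
apply: ord_geM; first exact: ord_ge_le0.
by apply/H2/H1.
Qed.

(** Germs are Taylor series at an unspecified point, so [ycoord 0] and [scoord 0] are the
    displacements from whichever base point is meant: this one operator lifts the Euler field at
    every point. *)
Definition theta0 : uop := fun M x => yc *: d1 x + sc *: d2 x.
Arguments theta0 : clear implicits.

Lemma isdo_theta0 : isdo 1 theta0.
Proof.
apply: isdoD; apply: isdoZ.
  exact: (isdo_d1 (isdo_id _ _ 0)).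
exact: (isdo_d2 (isdo_id _ _ 0)).
Qed.

Lemma theta0E f : theta0 germ_dmod f = yc * Dy f + sc * Ds f :> O.
Proof. by []. Qed.

Lemma taylor_theta0 f i j :
  taylor (theta0 germ_dmod f : O) i j = taylor f i j *+ (i + j).
Proof.
rewrite theta0E taylorD taylor_ycM taylor_scM mulrnDr.
by case: i => [|i]; case: j => [|j]; rewrite ?mulr0n.
Qed.

Lemma taylorMz f (k : int) i j : taylor (f *~ k) i j = taylor f i j *~ k.
Proof. by case: k => k; rewrite ?NegzE ?mulrNz ?taylorN -!pmulrn taylorMn. Qed.

Lemma ord_geMz l f (k : int) : ord_ge l f -> ord_ge l (f *~ k).
Proof. by move=> fl i j lt_ij; rewrite taylorMz fl ?mul0rz. Qed.

Lemma theta0_euler l f : ord_ge l f ->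
  ord_ge (l + 1) ((theta0 germ_dmod f : O) - f *~ l).
Proof.
move=> fl i j lt_ij; rewrite taylorD taylorN taylor_theta0 taylorMz.
have [/fl->|le_l] := ltP (i + j)%N%:Z l; first by rewrite mul0rn mul0rz subrr.
have -> : l = (i + j)%N%:Z by lia.
by rewrite -pmulrn subrr.
Qed.

(** The order stays [m]: the commutator of [theta0] with [d1^i d2^j] is [-(i+j)] times that
    monomial, so only the coefficients change, into [c']. This is what keeps the orders bounded in
    [regular_criterion]. *)
Lemma isdo_theta0_comm m T : isdo m T ->
  isdo m (fun M x => theta0 M (T M x) - T M (theta0 M x)).
Proof.
move=> [c cT]; pose c' i j : O :=
  (theta0 germ_dmod (c i j) : O) - c i j *+ (i + j).
exists c' => M x; rewrite !cT.
have thD : {morph theta0 M : x y / x + y} := isdo_additive isdo_theta0.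
have th1 y : theta0 M (d1 y) = d1 (theta0 M y) - d1 y :> M.
  rewrite /theta0 d1D !d1Z Dy_ycoord Dy_scoord scale1r scale0r add0r d12.
  by rewrite addrAC [X in _ = X + _]addrAC subrr add0r.
have th2 y : theta0 M (d2 y) = d2 (theta0 M y) - d2 y :> M.
  rewrite /theta0 d2D !d2Z Ds_ycoord Ds_scoord scale1r scale0r add0r d12.
  by rewrite addrA addrAC addrK.
have thi i y : theta0 M (iter i (@d1 _ _ _ M) y) =
    iter i (@d1 _ _ _ M) (theta0 M y) - iter i (@d1 _ _ _ M) y *+ i.
  elim: i => [|i IHi] /=; first by rewrite mulr0n subr0.
  rewrite th1 IHi d1B mulrSr opprD addrA; congr (_ - _ - _).
  by rewrite d1Mn.
have thj i y : theta0 M (iter i (@d2 _ _ _ M) y) =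
    iter i (@d2 _ _ _ M) (theta0 M y) - iter i (@d2 _ _ _ M) y *+ i.
  elim: i => [|i IHi] /=; first by rewrite mulr0n subr0.
  rewrite th2 IHi d2B mulrSr opprD addrA; congr (_ - _ - _).
  by rewrite d2Mn.
rewrite /dop (big_morph _ thD (isdo_zero M isdo_theta0)) -sumrB.
apply: eq_bigr => i _.
rewrite (big_morph _ thD (isdo_zero M isdo_theta0)) -sumrB.
apply: eq_bigr => j _.
have iter1B k u v : iter k (@d1 _ _ _ M) (u - v) =
    iter k (@d1 _ _ _ M) u - iter k (@d1 _ _ _ M) v.
  by elim: k => //= k ->; rewrite d1B.
have iter1Mn k u n : iter k (@d1 _ _ _ M) (u *+ n) = iter k (@d1 _ _ _ M) u *+ n.
  by elim: k => //= k ->; rewrite d1Mn.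
have thZ a y : theta0 M (a *: y) = (theta0 germ_dmod a : O) *: y + a *: theta0 M y :> M.
  rewrite /theta0 d1Z d2Z !scalerDr scalerDl !scalerA.
  rewrite [yc * a]mulrC [sc * a]mulrC !addrA; congr (_ + _); rewrite -!addrA.
  by congr (_ + _); rewrite addrC.
rewrite thZ thi thj iter1B iter1Mn -addrA -scalerBr /c' scalerBl.
congr (_ + _); set A := iter i _ (iter j _ (theta0 M x)); set B := iter i _ (iter j _ x).
have -> : A - B *+ j - B *+ i - A = - (B *+ (i + j)).
  by rewrite addrAC [A - _ - A]addrAC subrr add0r -opprD -mulrnDr addnC.
by rewrite scalerN -scalerMnr -scalerMnl.
Qed.

Definition regular_elt M (u : M) := forall th : uop, isdo 1 th ->
  euler_lift mideal (th germ_dmod) ->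
  exists n (P Q : uop),
    [/\ (0 < n)%N, isdo n.-1 P /\ V_ mideal 0 (P germ_dmod),
        isdo n Q /\ V_ mideal (-1) (Q germ_dmod) &
        iter n (th M) u + P M u + Q M u = 0].

End PointIdeal.
Arguments theta0 {R} M x.

Arguments mideal {R}.

(** * A criterion for regularity along a point *)

Section RegularCriterion.
Variable R : realType.
Local Notation O := (germ R).
Local Notation uop := (uop (@Dy R) (@Ds R)).
Local Notation Om := (germ_dmod R).
Implicit Types (f g h : O) (M : dmod (@Dy R) (@Ds R)) (T P Q : uop).

(** Sign opposite to that of [V_]: for a differential operator, [raises k] yields membership in
    [V_ mideal (- k)] ([raises_V]). *)
Definition raises (k : int) (T : uop) :=
  forall l f, ord_ge l f -> ord_ge (l + k) (T Om f).

Lemma raisesD k T P : raises k T -> raises k P -> raises k (fun M x => T M x + P M x).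
Proof. by move=> rT rP l f fl; apply: ord_geD; [apply: rT | apply: rP]. Qed.

Lemma raisesN k T : raises k T -> raises k (fun M x => - T M x).
Proof. by move=> rT l f fl; apply: ord_geN; apply: rT. Qed.

Lemma raisesB k T P : raises k T -> raises k P -> raises k (fun M x => T M x - P M x).
Proof. by move=> rT rP; apply: raisesD (raisesN rP). Qed.

Lemma raisesMz k T (n : int) : raises k T -> raises k (fun M x => T M x *~ n).
Proof. by move=> rT l f fl; apply: ord_geMz; apply: rT. Qed.

Lemma raises_comp k l T P :
  raises k T -> raises l P -> raises (k + l) (fun M x => T M (P M x)).
Proof.
move=> rT rP n f fn; apply: ord_geW (rT _ _ (rP _ _ fn)).
by rewrite [k + l]addrC addrA.
Qed.

Lemma raisesW k l T : (l <= k)%R -> raises k T -> raises l T.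
Proof. by move=> le_lk rT n f fn; apply: ord_geW (rT _ _ fn); rewrite lerD2l. Qed.

Lemma raises_iter n T : raises 0 T -> raises 0 (fun M x => iter n (T M) x).
Proof.
move=> rT; elim: n => [|n IHn] l f fl; first by rewrite addr0.
exact: (raises_comp rT IHn).
Qed.

Lemma raises_isdo m T : isdo m T -> raises (- m%:Z) T.
Proof. by move=> dT l f fl; apply: ord_ge_isdo. Qed.

Lemma raises_scale h : mideal h -> raises 1 (fun M x => h *: x).
Proof.
move=> hI l f fl; rewrite addrC; apply: (@ord_geM _ 1 l h f) => //.
exact/midealE.
Qed.

Lemma isdoMz m T (n : int) : isdo m T -> isdo m (fun M x => T M x *~ n).
Proof. by move=> dT; apply: isdo_ext (isdoZ n%:~R dT) => M x; rewrite scaler_int. Qed.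

Lemma isdo_addMz m T M x (n : int) : isdo m T -> T M (x *~ n) = T M x *~ n.
Proof.
move=> dT; case: n => n; first by rewrite -!pmulrn (isdo_natmul _ _ dT).
by rewrite NegzE !mulrNz (isdo_opp _ dT) -!pmulrn (isdo_natmul _ _ dT).
Qed.

Lemma isdoB_arg m T M x y : isdo m T -> T M (x - y) = T M x - T M y.
Proof. by move=> dT; rewrite (isdo_additive dT) (isdo_opp _ dT). Qed.

Lemma raises_V k m T : isdo m T -> raises (- k) T -> V_ mideal k (T Om).
Proof.
move=> dT rT; apply/V_midealP; split=> //; exists m; exact: D_ord_isdo.
Qed.

Section Euler.
Variable th : uop.
Arguments th : clear implicits.
Hypothesis dth : isdo 1 th.
Hypothesis eth : euler_lift mideal (th Om).

Lemma euler_ord l f : ord_ge l f -> ord_ge (l + 1) ((th Om f : O) - f *~ l).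
Proof.
case: l => l fl; last by apply: ord_ge_le0; rewrite NegzE; lia.
have [_ _ /(_ l f)] := eth; rewrite !ideal_expn_mideal => /(_ fl).
by rewrite -pmulrn /= -addn1 PoszD.
Qed.

Lemma raises_euler : raises 0 th.
Proof.
move=> l f fl; rewrite addr0 -[th Om f](subrK (f *~ l)).
apply: ord_geD; last exact: ord_geMz.
by apply: ord_geW (euler_ord fl); rewrite lerDl.
Qed.

Lemma raises_euler_diff : raises 1 (fun M x => th M x - theta0 M x).
Proof.
move=> l f fl; have := ord_geB (euler_ord fl) (theta0_euler fl).
by rewrite opprB addrA subrK.
Qed.

(** The product of the [theta0 - mu - j] for [j < n]. The eigenvalues are consecutive so that each
    factor removes the lowest degree still present. *)
Fixpoint bprod (mu : int) n : uop := if n is n'.+1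
  then fun M x => theta0 M (@bprod mu n' M x) - @bprod mu n' M x *~ (mu + n'%:Z)
  else fun M x => x.
Arguments bprod mu n M x : clear implicits.

(* Changing the Euler field only changes [bprod] by operators in [V_{-1}]. *)
Lemma bprod_euler mu n : exists P Q, [/\ isdo n P, raises 0 P, isdo n.+1 Q,
  raises 1 Q & forall M x, bprod mu n.+1 M x = iter n.+1 (th M) x + P M x + Q M x].
Proof.
pose D : uop := fun M x => th M x - theta0 M x.
have dD : isdo 1 D := isdoB dth (isdo_theta0 R).
have thE M x : theta0 M x = th M x - D M x by rewrite /D opprB addrC subrK.
elim: n => [|n [P [Q [dP rP dQ rQ PQ]]]].
  exists (fun M x => - (x *~ mu)), (fun M x => - D M x); split.
  - exact: isdoN (isdoMz _ (isdo_id _ _ 0)).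
  - by apply: raisesN; apply: raisesMz => l f fl; rewrite addr0.
  - exact: isdoN.
  - exact: raisesN raises_euler_diff.
  by move=> M x; rewrite /= addr0 thE addrAC.
have dthn : isdo n.+1 (fun M x => iter n.+1 (th M) x).
  by have := isdo_iter n.+1 dth; rewrite muln1.
have rthn : raises 0 (fun M x => iter n.+1 (th M) x) := raises_iter n.+1 raises_euler.
pose c := mu + n.+1%:Z.
pose P' : uop := fun M x => th M (P M x) - (iter n.+1 (th M) x + P M x) *~ c.
pose Q' : uop := fun M x =>
  th M (Q M x) - D M (iter n.+1 (th M) x + P M x + Q M x) - Q M x *~ c.
exists P', Q'; split.
- apply: isdoB; first exact: (isdo_comp dth dP).
  by apply/isdoMz/isdoD => //; apply: isdoW dP.
- apply: raisesB; first exact: (raises_comp raises_euler rP).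
  exact/raisesMz/raisesD.
- apply: isdoB; last by apply/isdoMz; apply: isdoW dQ.
  apply: isdoB; first exact: (isdo_comp dth dQ).
  apply: (isdo_comp dD (T' := fun M x => iter n.+1 (th M) x + P M x + Q M x)).
  by apply: isdoD => //; apply: isdoD => //; apply: isdoW dP.
- apply: raisesB; last exact/raisesMz.
  apply: raisesB; first exact: (raises_comp raises_euler rQ).
  apply: (@raises_comp 1 0 D (fun M x => iter n.+1 (th M) x + P M x + Q M x)).
    exact: raises_euler_diff.
  apply: raisesD; last by apply: raisesW rQ.
  exact: raisesD.
move=> M x; rewrite [LHS]/= -/(bprod mu n.+1 M x) -/c PQ thE /P' /Q'.
rewrite !(isdo_additive dth) !(mulrzDl) /= -/c.
set a := th M (th M _); set b := th M (P M x); set e := th M (Q M x).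
set i := iter n _ _; set d := D M _; mod_ring (germ R) M.
Qed.

End Euler.
Arguments bprod mu n M x : clear implicits.

Lemma regular_criterion M (u x1 x2 : M) m d T1 T2 S1 S2 (lam : int) h11 h12 h21 h22 :
  isdo m T1 -> isdo m T2 -> isdo d S1 -> isdo d S2 ->
  u = T1 M x1 + T2 M x2 -> x1 = S1 M u -> x2 = S2 M u ->
  mideal h11 -> mideal h12 -> mideal h21 -> mideal h22 ->
  theta0 M x1 = x1 *~ lam + h11 *: x1 + h12 *: x2 ->
  theta0 M x2 = x2 *~ lam + h21 *: x1 + h22 *: x2 ->
  regular_elt u.
Proof.
move=> dT1 dT2 dS1 dS2 uE x1E x2E I11 I12 I21 I22 t1 t2 th dth eth.
(* An operator of order [m] lowers degrees by at most [m], so [lam - m] is the lowest eigenvalue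
   that can occur in [T1 x1 + T2 x2]. *)
pose mu := lam - m%:Z.
have step k : exists W1 W2, [/\ isdo m W1, isdo m W2, raises (k%:Z - m%:Z) W1,
    raises (k%:Z - m%:Z) W2 & bprod mu k M u = W1 M x1 + W2 M x2].
  elim: k => [|k [W1 [W2 [dW1 dW2 rW1 rW2 E]]]].
    by exists T1, T2; split=> //; rewrite sub0r; apply: raises_isdo.
  (* On the part of [W] of degree [k - m], the commutator with [theta0] is multiplication by
     [k - m]. After subtraction of it, [cm W] starts one degree higher, with the same order as
     [W]. *)
  pose cm W : uop := fun M x => theta0 M (W M x) - W M (theta0 M x) - W M x *~ (k%:Z - m%:Z).
  have dcm W : isdo m W -> isdo m (cm W).
    by move=> dW; apply: isdoB (isdoMz _ dW); apply: isdo_theta0_comm.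
  have rcm W : isdo m W -> raises (k%:Z - m%:Z) W -> raises (k.+1%:Z - m%:Z) (cm W).
    move=> dW rW l f fl.
    have W1f := theta0_euler (rW _ _ fl).
    have W2f := rW _ _ (theta0_euler fl).
    rewrite (isdoB_arg _ _ dW) (isdo_addMz _ _ dW) in W2f.
    have := ord_geB (ord_geW (_ : (l + (k.+1%:Z - m%:Z) <= _)%R) W1f)
      (ord_geW (_ : (l + (k.+1%:Z - m%:Z) <= _)%R) W2f).
    move=> /(_ ltac:(lia) ltac:(lia)).
    rewrite /cm mulrzDr.
    set a := theta0 _ _; set b := W Om (theta0 _ _); set c := W Om f.
    by congr ord_ge; rewrite !opprD !opprK -!addrA; congr (_ + _); ring.
  pose W1' : uop := fun M x => cm W1 M x + W1 M (h11 *: x) + W2 M (h21 *: x).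
  pose W2' : uop := fun M x => cm W2 M x + W1 M (h12 *: x) + W2 M (h22 *: x).
  have dWh W h : isdo m W -> isdo m (fun M x => W M (h *: x)).
    move=> dW; rewrite -[m]addn0.
    exact: (isdo_comp dW (isdo_scale _ _ 0 h)).
  have rWh W h : raises (k%:Z - m%:Z) W -> mideal h ->
      raises (k.+1%:Z - m%:Z) (fun M x => W M (h *: x)).
    move=> rW hI; apply: raisesW (raises_comp rW (raises_scale hI)).
    by lia.
  exists W1', W2'; split.
  - by apply: isdoD; [apply: isdoD; [apply: dcm|] |]; try exact: dWh.
  - by apply: isdoD; [apply: isdoD; [apply: dcm|] |]; try exact: dWh.
  - by apply: raisesD; [apply: raisesD; [apply: rcm|] |]; try exact: rWh.
  - by apply: raisesD; [apply: raisesD; [apply: rcm|] |]; try exact: rWh.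
  rewrite /= E /W1' /W2' /cm t1 t2 /mu.
  rewrite (isdo_additive (isdo_theta0 R)).
  rewrite !(isdo_additive dW1) !(isdo_additive dW2).
  rewrite !(isdo_addMz _ _ dW1) !(isdo_addMz _ _ dW2) !mulrzDl.
  rewrite !mulrzDr !mulrNz.
  set a := theta0 _ _; set b := theta0 _ _; set w1 := W1 M x1; set w2 := W2 M x2.
  mod_ring (germ R) M.
(* After [K] factors the [W_i] raise degrees by [K - m = d + 1]; the [S_i] lose at most [d], so
   [W_i S_i] lies in [V_(-1)], and its order is at most [m + d < K]. *)
pose K := (m + d).+1.
have [W1 [W2 [dW1 dW2 rW1 rW2 E]]] := step K.
have [P [Q [dP rP dQ rQ PQ]]] := bprod_euler dth eth mu (m + d).
pose Q' : uop := fun M x => Q M x - (W1 M (S1 M x) + W2 M (S2 M x)).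
have dQ' : isdo K Q'.
  apply: isdoB => //; apply: isdoD.
    exact: isdoW (isdo_comp dW1 dS1).
  exact: isdoW (isdo_comp dW2 dS2).
have rQ' : raises 1 Q'.
  apply: raisesB => //; apply: raisesD.
    by apply: raisesW (raises_comp rW1 (raises_isdo dS1)); rewrite /K; lia.
  by apply: raisesW (raises_comp rW2 (raises_isdo dS2)); rewrite /K; lia.
exists K, P, Q'; split=> //.
- by split=> //; apply: raises_V dP _; rewrite oppr0.
- by split=> //; apply: raises_V dQ' _; rewrite opprK.
by rewrite addrA -PQ E -x1E -x2E subrr.
Qed.

End RegularCriterion.

(** * The module D/J *)

Section CyclicModule.
Variables (R : realType) (p : Z R).
Local Notation O := (germ R).
Local Notation uop := (uop (@Dy R) (@Ds R)).
Local Notation Om := (germ_dmod R).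
Local Notation y := (ycoord p).
Local Notation s := (scoord p).
Implicit Types (f g h : O) (M : dmod (@Dy R) (@Ds R)) (T : uop).

Lemma D_P (P : O -> O) : D_ P <-> exists m T, isdo m T /\ P = T Om.
Proof.
split=> [[m /D_ordP[T [dT ->]]]|[m [T [dT ->]]]]; first by exists m, T.
by exists m; apply: D_ord_isdo.
Qed.

Lemma D_additive (P : O -> O) : D_ P -> {morph P : f g / f - g}.
Proof. by move=> /D_P[m [T [dT ->]]] f g; apply: (isdoB_arg (M := Om) _ _ dT). Qed.

Lemma D_sub (P P' : O -> O) : D_ P -> D_ P' -> D_ (P - P').
Proof.
move=> /D_P[m [T [dT ->]]] /D_P[m' [T' [dT' ->]]]; apply/D_P.
exists (m + m')%N, (fun M x => T M x - T' M x); split=> //.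
by apply: isdoB; [apply: isdoW dT | apply: isdoW dT']; rewrite ?leq_addr ?leq_addl.
Qed.

Lemma D_comp (P P' : O -> O) : D_ P -> D_ P' -> D_ (P \o P').
Proof.
move=> /D_P[m [T [dT ->]]] /D_P[m' [T' [dT' ->]]]; apply/D_P.
by exists (m + m')%N, (fun M x => T M (T' M x)); split=> //; apply: isdo_comp.
Qed.

Lemma D_0 : D_ (0 : O -> O).
Proof. by apply/D_P; exists 0%N, (fun M x => 0); split=> //; apply: isdo0. Qed.

Lemma D_id : D_ (id : O -> O).
Proof. by apply/D_P; exists 0%N, (fun M x => x); split=> //; apply: isdo_id. Qed.

Lemma D_scale f : D_ ( *%R f : O -> O).
Proof. by apply/D_P; exists 0%N, (fun M x => f *: x); split=> //; apply: isdo_scale. Qed.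

Lemma D_Dy : D_ (@Dy R).
Proof.
apply/D_P; exists 1%N, (fun M x => d1 x); split=> //.
exact: (isdo_d1 (isdo_id _ _ 0)).
Qed.

Lemma D_Ds : D_ (@Ds R).
Proof.
apply/D_P; exists 1%N, (fun M x => d2 x); split=> //.
exact: (isdo_d2 (isdo_id _ _ 0)).
Qed.

Definition Jpred : {pred (O -> O)} := fun P => `[< J R p P >].

Fact Jpred_zmod : zmod_closed Jpred.
Proof.
split=> [|P P' /asboolP[A [B [dA dB ->]]] /asboolP[A' [B' [dA' dB' ->]]]]; apply/asboolP.
  by exists 0, 0; split; [exact: D_0 | exact: D_0 | apply/funext => f; rewrite /= addr0].
exists (A - A'), (B - B'); split; [exact: D_sub | exact: D_sub |].
by apply/funext => f; rewrite /= opprD addrACA.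
Qed.

HB.instance Definition _ := GRing.isZmodClosed.Build (O -> O) Jpred Jpred_zmod.

Definition cyclic_module : Type := @Quotient.quot _ Jpred.
HB.instance Definition _ := GRing.Zmodule.on cyclic_module.
Local Notation N := cyclic_module.

Definition cls (P : O -> O) : N := \pi_(@Quotient.quot _ Jpred)%qT P.

Lemma cls_eq P P' : cls P = cls P' <-> J R p (P - P').
Proof.
split=> [/eqP|JP]; last first.
  by apply/eqP; rewrite -Quotient.idealrBE; apply/asboolP.
by rewrite -Quotient.idealrBE => /asboolP.
Qed.

Lemma clsD P P' : cls (P + P') = cls P + cls P'. Proof. exact: raddfD. Qed.
Lemma cls_ind (Pr : N -> Prop) : (forall P, Pr (cls P)) -> forall x, Pr x.
Proof. by move=> H; elim/quotW; apply: H. Qed.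

Lemma cls_eq0 P : cls P = 0 <-> J R p P.
Proof.
have -> : 0 = cls 0 by rewrite /cls raddf0.
by rewrite cls_eq subr0.
Qed.

Definition act (A : O -> O) (x : N) : N := cls (A \o repr x).

(** Left composition preserves the left ideal, so the representative picked by [act] does not
    matter; [D_ A] supplies the additivity that an arbitrary map lacks. *)
Lemma actE A P : D_ A -> act A (cls P) = cls (A \o P).
Proof.
move=> dA; apply/cls_eq; have : J R p (repr (cls P) - P) by apply/cls_eq; exact: reprK.
move=> [A' [B' [dA' dB' E]]]; exists (A \o A'), (A \o B'); split; try exact: D_comp.
have subA := D_additive dA; have A0 : A 0 = 0 by have := subA 0 0; rewrite !subrr.
have addA a b : A (a + b) = A a + A b.
  by have := subA a (- b); rewrite opprK => ->; rewrite -[- b]sub0r subA A0 sub0r opprK.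
apply/funext => f; transitivity (A ((repr (cls P) - P) f)); last by rewrite E addA.
exact: esym (subA _ _).
Qed.


Lemma actD A x x' : D_ A -> act A (x + x') = act A x + act A x'.
Proof.
move=> dA; elim/cls_ind: x => P; elim/cls_ind: x' => P'.
rewrite -clsD !actE // -clsD; congr cls; apply/funext => f /=.
have subA := D_additive dA; have A0 : A 0 = 0 by have := subA 0 0; rewrite !subrr.
have := subA (P f) (- P' f); rewrite opprK => ->.
by rewrite -[- P' f]sub0r subA A0 sub0r opprK.
Qed.

Definition cls_scale (a : O) (x : N) : N := act ( *%R a) x.

Fact cls_scaleA a b x : cls_scale a (cls_scale b x) = cls_scale (a * b) x.
Proof.
elim/cls_ind: x => P; rewrite /cls_scale !actE; try exact: D_scale.
by congr cls; apply/funext => f; rewrite /= mulrA.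
Qed.

Fact cls_scale1 : left_id 1 cls_scale.
Proof.
elim/cls_ind => P; rewrite /cls_scale actE; last exact: D_scale.
by congr cls; apply/funext => f; rewrite /= mul1r.
Qed.

Fact cls_scaleDr : right_distributive cls_scale +%R.
Proof. by move=> a x x'; apply/actD/D_scale. Qed.

Fact cls_scaleDl x : {morph cls_scale^~ x : a b / a + b}.
Proof.
move=> a b; elim/cls_ind: x => P; rewrite /cls_scale !actE; try exact: D_scale.
by rewrite -clsD; congr cls; apply/funext => f; rewrite /= mulrDl.
Qed.

HB.instance Definition _ := GRing.Zmodule_isLmodule.Build O cyclic_module
  cls_scaleA cls_scale1 cls_scaleDr cls_scaleDl.

Lemma cls_d1D : {morph (act (@Dy R) : N -> N) : x x' / x + x'}.
Proof. by move=> x x'; apply/actD/D_Dy. Qed.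

Lemma cls_d2D : {morph (act (@Ds R) : N -> N) : x x' / x + x'}.
Proof. by move=> x x'; apply/actD/D_Ds. Qed.

Lemma cls_scaleE a P : a *: cls P = cls (fun f => a * P f).
Proof. exact/actE/D_scale. Qed.

Lemma cls_d1Z a (x : N) : act (@Dy R) (a *: x) = Dy a *: x + a *: act (@Dy R) x.
Proof.
elim/cls_ind: x => P; rewrite actE ?cls_scaleE ?actE ?cls_scaleE -?clsD;
  try exact: D_Dy.
by congr cls; apply/funext => f; rewrite /= DyM.
Qed.

Lemma cls_d2Z a (x : N) : act (@Ds R) (a *: x) = Ds a *: x + a *: act (@Ds R) x.
Proof.
elim/cls_ind: x => P; rewrite actE ?cls_scaleE ?actE ?cls_scaleE -?clsD;
  try exact: D_Ds.
by congr cls; apply/funext => f; rewrite /= DsM.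
Qed.

Lemma cls_d12 (x : N) : act (@Dy R) (act (@Ds R) x) = act (@Ds R) (act (@Dy R) x).
Proof.
elim/cls_ind: x => P; rewrite !actE; try exact: D_Ds; try exact: D_Dy.
by congr cls; apply/funext => f; rewrite /= DyDs.
Qed.

Definition cyclic_dmod : dmod (@Dy R) (@Ds R) :=
  @Dmod _ _ _ N (act (@Dy R)) (act (@Ds R)) cls_d1D cls_d2D cls_d1Z cls_d2Z cls_d12.

(** The dictionary between equations in the module and membership of a composite of maps in the
    stalk of [J]. *)
Lemma cls_isdo m T P : isdo m T -> cls (T Om \o P) = T cyclic_dmod (cls P).
Proof.
move=> [c cT]; rewrite cT.
have -> : T Om \o P = \sum_(i < m.+1) \sum_(j < m.+1 - i)
    (fun f => c i j * iter i (@Dy R) (iter j (@Ds R) (P f))).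
  apply/funext => f; rewrite /= cT /dop.
  have sumE n (F : 'I_n -> O -> O) : (\sum_(i < n) F i) f = \sum_(i < n) F i f.
    exact: (big_morph (fun h : O -> O => h f) (id1 := 0) (op1 := +%R)).
  by rewrite sumE; apply: eq_bigr => i _; rewrite sumE.
have cls_sum n (F : 'I_n -> O -> O) : cls (\sum_(i < n) F i) = \sum_(i < n) cls (F i).
  by apply: (big_morph cls clsD); apply/cls_eq0; apply/asboolP/(Jpred_zmod.1).
rewrite cls_sum /dop; apply: eq_bigr => i _; rewrite cls_sum; apply: eq_bigr => j _.
rewrite -cls_scaleE; congr (_ *: _).
have it2 k Q : cls (fun f => iter k (@Ds R) (Q f)) = iter k (act (@Ds R)) (cls Q).
  by elim: k => //= k <-; rewrite actE //; exact: D_Ds.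
have it1 k Q : cls (fun f => iter k (@Dy R) (Q f)) = iter k (act (@Dy R)) (cls Q).
  by elim: k => //= k <-; rewrite actE //; exact: D_Dy.
by rewrite (it1 i (fun f => iter j (@Ds R) (P f))) it2.
Qed.

Definition is_gen M (e : M) :=
  y *: d1 (d1 e) + d1 e *+ 2 + d2 e = 0 /\ s *: d2 e + y *: d1 e + e *+ 3 = 0.

Lemma cyclic_is_gen : is_gen (cls id : cyclic_dmod).
Proof.
pose T1 : uop := fun M x => y *: d1 (d1 x) + d1 x *+ 2 + d2 x.
pose T2 : uop := fun M x => s *: d2 x + y *: d1 x + x *+ 3.
have dd1 := isdo_d1 (isdo_id (@Dy R) (@Ds R) 0).
have dd2 := isdo_d2 (isdo_id (@Dy R) (@Ds R) 0).
have dT1 : isdo 2 T1.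
  apply: isdoD; last exact: isdoW dd2.
  apply: isdoD; first by apply: isdoZ; apply: (isdo_d1 dd1).
  by apply: (@isdo_ext _ _ _ _ (fun M x => d1 x + d1 x)) => //; apply: isdoD; apply: isdoW dd1.
have dT2 : isdo 1 T2.
  apply: isdoD; last by apply: (@isdoMz R _ _ 3%:Z); apply: isdo_id.
  by apply: isdoD; apply: isdoZ.
split; [rewrite -[LHS]/(T1 cyclic_dmod (cls id)) -(cls_isdo _ dT1)
  | rewrite -[LHS]/(T2 cyclic_dmod (cls id)) -(cls_isdo _ dT2)]; apply/cls_eq0.
  by exists id, 0; split; [exact: D_id | exact: D_0 | apply/funext => f; rewrite /= addr0].
by exists 0, id; split; [exact: D_0 | exact: D_id | apply/funext => f; rewrite /= add0r].
Qed.

Lemma regular_along_set1 :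
  (forall M (e : M), is_gen e -> forall m T, isdo m T -> regular_elt (T M e)) ->
  regular_along (J R) [set p].
Proof.
(* Regularity along [{p}] is required at every point. At [q <> p] the ideal is the whole stalk,
   every operator lies in every [V_k], and [th - th = 0] is an admissible equation. *)
move=> reg q; have [->|qp] := eqVneq q p; last first.
  rewrite ideal_of_set1_neq // => I th [dth _ _] U dU.
  have VT k P : D_ P -> V_ I k P by move=> dP; split=> // l f _; rewrite ideal_expzT.
  have [T [dT thT]] := D_ordP dth.
  exists 1%N, 0, (fun f => - th f); split=> //.
  - have d0 : D_ord 0 (0 : O -> O).
      by exists (fun _ _ => 0); apply/funext => f; rewrite /diffop !big_ord1 mul0r.
    by split=> //; apply: VT; exists 0%N.
  - have dN : D_ord 1 (fun f => - th f).
      by rewrite thT; apply: (D_ord_isdo (isdoN dT)).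
    by split=> //; apply: VT; exists 1%N.
  exists 0, 0; split; try exact: D_0.
  by apply/funext => f; rewrite /= addr0 subrr addr0.
rewrite ideal_of_set1 => I th eth U /D_P[m [T [dT ->]]].
have [dth _ _] := eth; have [Th [dTh thE]] := D_ordP dth.
have := reg cyclic_dmod (cls id) cyclic_is_gen m T dT Th dTh; rewrite -thE.
move=> /(_ eth)[n [P [Q [n0 [dP VP] [dQ VQ] E]]]].
exists n, (P Om), (Q Om); split=> //.
- by split=> //; apply: D_ord_isdo.
- by split=> //; apply: D_ord_isdo.
pose S : uop := fun M x => iter n (Th M) x + P M x + Q M x.
have dS : isdo n S.
  apply: isdoD => //; apply: isdoD; last by apply: isdoW dP; rewrite leq_pred.
  by have := isdo_iter n dTh; rewrite muln1.
move: E; rewrite -[LHS]/(S cyclic_dmod (T cyclic_dmod (cls id))).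
by rewrite -(cls_isdo _ dT) -(cls_isdo _ dS) thE => /cls_eq0.
Qed.

End CyclicModule.

(** * Relations in D/J *)

Section Relations.
Variables (R : realType) (p : Z R).
Local Notation y := (ycoord p).
Local Notation s := (scoord p).
Variables (M : dmod (@Dy R) (@Ds R)) (e : M).
Hypothesis gen_e : is_gen p e.

Definition velt : M := s *: d1 e - e.
Definition zelt : M := s *: d1 velt - velt.
Local Notation v := velt.
Local Notation z := zelt.

Let d1_y : Dy y = 1 := Dy_ycoord p.
Let d1_s : Dy s = 0 := Dy_scoord p.
Let d2_s : Ds s = 1 := Ds_scoord p.
Let a1 := d1 e.
Let a2 := d1 a1.
Let a3 := d1 a2.
Let a4 := d1 a3.
Let d2e : d2 e = - (y *: a2 + a1 *+ 2).
Proof. by case: gen_e => /eqP; rewrite addrC addr_eq0 => /eqP. Qed.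
Let d2a1 : d2 a1 = - (y *: a3 + a2 *+ 3).
Proof.
rewrite /a1 -d12 d2e d1N d1D d1Mn d1Z d1_y -/a2 -/a3; mod_ring (germ R) M.
Qed.
Let d2a2 : d2 a2 = - (y *: a4 + a3 *+ 4).
Proof.
rewrite /a2 -d12 d2a1 d1N d1D d1Mn d1Z d1_y -/a3 -/a4; mod_ring (germ R) M.
Qed.
(** The relation of [Q1] after elimination of [d2] by that of [P1]; [r1] and [r2] are its first two
    [d1]-derivatives. [gen_vE], [y_d1_z] and [d2_z] rest on these three. *)
Let r0 : s *: (y *: a2 + a1 *+ 2) - y *: a1 - e *+ 3 = 0.
Proof.
case: gen_e => _; rewrite d2e => r; rewrite -oppr0 -r -/a1; mod_ring (germ R) M.
Qed.
Let r1 : s *: (y *: a3 + a2 *+ 3) - y *: a2 - a1 *+ 4 = 0.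
Proof.
have := congr1 (@d1 _ _ _ M) r0.
rewrite !(d1B, d1D, d1Z, d1Mn) d1_y d1_s d1_0 -/a1 -/a2 -/a3 => <-; mod_ring (germ R) M.
Qed.
Let r2 : s *: (y *: a4 + a3 *+ 4) - y *: a3 - a2 *+ 5 = 0.
Proof.
have := congr1 (@d1 _ _ _ M) r1.
rewrite !(d1B, d1D, d1Z, d1Mn) d1_y d1_s d1_0 -/a2 -/a3 -/a4 => <-; mod_ring (germ R) M.
Qed.

Let vE : v = s *: a1 - e. Proof. by []. Qed.
Let d1v : d1 v = s *: a2 - a1.
Proof. by rewrite vE d1B d1Z d1_s scale0r add0r. Qed.
Let zE : z = s *: (s *: a2 - a1) - (s *: a1 - e).
Proof. by rewrite /zelt d1v vE. Qed.
Let d1z : d1 z = s *: (s *: a3 - a2) - (s *: a2 - a1).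
Proof. by rewrite zE !(d1B, d1Z) d1_s !scale0r !add0r. Qed.

Lemma gen_vE : e = y *: d1 v + v *+ 2.
Proof. rewrite d1v vE -[LHS]addr0 -r0; mod_ring (germ R) M. Qed.

Lemma s_d1_v : s *: d1 v = v + z.
Proof. by rewrite /zelt addrC subrK. Qed.

Lemma y_d1_z : y *: d1 z = - (z *+ 3).
Proof.
apply/eqP; rewrite -subr_eq0 opprK; apply/eqP.
rewrite d1z zE -[RHS](scaler0 _ s) -r1.
transitivity (s *: (s *: (y *: a3 + a2 *+ 3) - y *: a2 - a1 *+ 4)
  - (s *: (y *: a2 + a1 *+ 2) - y *: a1 - e *+ 3)); first by mod_ring (germ R) M.
by rewrite r0 subr0.
Qed.

Lemma d2_z : d2 z = 0.
Proof.
rewrite zE !(d2B, d2Z) d2_s d2e d2a1 d2a2 -/a1 -/a2.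
transitivity (- s *: (s *: (y *: a4 + a3 *+ 4) - y *: a3 - a2 *+ 5)
  + (s *: (y *: a3 + a2 *+ 3) - y *: a2 - a1 *+ 4)); first by mod_ring (germ R) M.
by rewrite r2 r1 scaler0 addr0.
Qed.

Lemma d2_v : d2 v = - (y *: d1 (d1 v)) - d1 v *+ 3.
Proof.
rewrite d1v !(d1B, d1Z) d1_s vE !(d2B, d2Z) d2_s d2e d2a1 -/a1 -/a2 -/a3.
mod_ring (germ R) M.
Qed.

Lemma s_d2_v : s *: d2 v = - (y *: d1 v) - v *+ 3.
Proof.
have E : s *: d1 (d1 v) = d1 v + d1 z.
  by rewrite -d1D -s_d1_v d1Z d1_s scale0r add0r.
transitivity (- (y *: (s *: d1 (d1 v))) - (s *: d1 v) *+ 3).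
  rewrite d2_v; mod_ring (germ R) M.
rewrite E s_d1_v scalerDr y_d1_z; mod_ring (germ R) M.
Qed.

End Relations.

(** * Points off the coordinate axes *)

Section Generation.
Variable R : realType.
Local Notation O := (germ R).
Local Notation uop := (uop (@Dy R) (@Ds R)).
Variable M : dmod (@Dy R) (@Ds R).
Implicit Types (f g h : O) (u w x : M) (T : uop).

Definition gen u w := exists m T, isdo m T /\ w = T M u.

Lemma gen_isdo m T u w : isdo m T -> gen u w -> gen u (T M w).
Proof.
move=> dT [n [P [dP ->]]]; exists (m + n)%N, (fun M t => T M (P M t)).
by split=> //; apply: isdo_comp.
Qed.

Lemma gen_refl u : gen u u.
Proof. by exists 0%N, (fun M t => t); split=> //; apply: isdo_id. Qed.

Lemma genD u w x : gen u w -> gen u x -> gen u (w + x).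
Proof.
move=> [m [T [dT ->]]] [n [P [dP ->]]].
exists (m + n)%N, (fun M t => T M t + P M t); split=> //.
by apply: isdoD; [apply: isdoW dT | apply: isdoW dP]; rewrite ?leq_addr ?leq_addl.
Qed.

Lemma genZ f u w : gen u w -> gen u (f *: w).
Proof. exact: gen_isdo (isdo_scale _ _ 0 f). Qed.

Lemma genN u w : gen u w -> gen u (- w).
Proof. by move=> /(genZ (-1)); rewrite scaleN1r. Qed.

Lemma genB u w x : gen u w -> gen u x -> gen u (w - x).
Proof. by move=> gw gx; apply: genD gw (genN gx). Qed.

Lemma gen_d1 u w : gen u w -> gen u (d1 w).
Proof. exact: gen_isdo (isdo_d1 (isdo_id _ _ 0)). Qed.

Lemma gen_d2 u w : gen u w -> gen u (d2 w).
Proof. exact: gen_isdo (isdo_d2 (isdo_id _ _ 0)). Qed.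

Lemma gen_unit f u w : taylor f 0%N 0%N != 0 -> gen u (f *: w) -> gen u w.
Proof.
move=> /germ_inv[g fg] /(genZ g).
by rewrite scalerA mulrC fg scale1r.
Qed.

Lemma gen_common u w x : gen u w -> gen u x ->
  exists d S1 S2, [/\ isdo d S1, isdo d S2, w = S1 M u & x = S2 M u].
Proof.
move=> [m [T [dT ->]]] [n [P [dP ->]]]; exists (m + n)%N, T, P; split=> //.
  by apply: isdoW dT; rewrite leq_addr.
by apply: isdoW dP; rewrite leq_addl.
Qed.

Lemma regular_gen2 (u x1 x2 : M) m T1 T2 (lam : int) h11 h12 h21 h22 :
  isdo m T1 -> isdo m T2 -> u = T1 M x1 + T2 M x2 -> gen u x1 -> gen u x2 ->
  mideal h11 -> mideal h12 -> mideal h21 -> mideal h22 ->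
  theta0 M x1 = x1 *~ lam + h11 *: x1 + h12 *: x2 ->
  theta0 M x2 = x2 *~ lam + h21 *: x1 + h22 *: x2 ->
  regular_elt u.
Proof.
move=> dT1 dT2 uE g1 g2; have [d [S1 [S2 [dS1 dS2 E1 E2]]]] := gen_common g1 g2.
exact: (regular_criterion dT1 dT2 dS1 dS2 uE E1 E2).
Qed.

Lemma regular_gen1 (u x : M) m T (lam : int) h :
  isdo m T -> u = T M x -> gen u x -> mideal h ->
  theta0 M x = x *~ lam + h *: x -> regular_elt u.
Proof.
move=> dT uE gx hI t; apply: (regular_gen2 (x1 := x) (x2 := x) dT (isdo0 _ _ m)
  _ gx gx hI _ hI _ (lam := lam) (h12 := 0) (h22 := 0)) => //.
- by rewrite addr0.
- by rewrite t scale0r addr0.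
by rewrite t scale0r addr0.
Qed.

Lemma regular0 : regular_elt (0 : M).
Proof.
apply: (regular_gen1 (x := 0) (T := fun M t => t) (m := 0%N) (lam := 0) (h := 0)) => //.
- exact: isdo_id.
- exact: gen_refl.
by rewrite (isdo_zero M (isdo_theta0 R)) mulr0z scaler0 addr0.
Qed.

Lemma isdo_ind (Pr : M -> Prop) m T u : isdo m T -> Pr 0 ->
  (forall w x, Pr w -> Pr x -> Pr (w + x)) -> (forall f w, Pr w -> Pr (f *: w)) ->
  (forall w, Pr w -> Pr (d1 w)) -> (forall w, Pr w -> Pr (d2 w)) ->
  Pr u -> Pr (T M u).
Proof.
move=> [c ->] P0 PD PZ P1 P2 Pu; rewrite /dop.
apply: (big_ind Pr) => // i _; apply: (big_ind Pr) => // j _; apply: PZ.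
have P2j k : Pr (iter k (@d2 _ _ _ M) u) by elim: k => //= k; apply: P2.
have P1i k w : Pr w -> Pr (iter k (@d1 _ _ _ M) w) by move=> Pw; elim: k => //= k; apply: P1.
exact/P1i/P2j.
Qed.

Lemma germ_neq0 f : f <> 0 -> exists i j, taylor f i j != 0.
Proof.
move=> f0; apply: contrapT => H; apply: f0; apply: germ_ext => i j.
by apply/eqP/negPn/negP => fij; apply: H; exists i, j.
Qed.

Lemma taylor_iter_Dy f i : exists n : nat -> nat, (forall a, 0 < n a)%N /\
  forall a b, taylor (iter i (@Dy R) f) a b = taylor f (a + i)%N b *+ n a.
Proof.
elim: i => [|i [n [n0 E]]].
  by exists (fun=> 1%N); split=> [//|a b]; rewrite addn0.
exists (fun a => n a.+1 * a.+1)%N; split=> [a|a b]; first by rewrite muln_gt0 n0.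
by rewrite [LHS]taylorDy E -mulrnA addSnnS.
Qed.

Lemma taylor_iter_Ds f j : exists n : nat -> nat, (forall a, 0 < n a)%N /\
  forall a b, taylor (iter j (@Ds R) f) a b = taylor f a (b + j)%N *+ n b.
Proof.
elim: j => [|i [n [n0 E]]].
  by exists (fun=> 1%N); split=> [//|a b]; rewrite addn0.
exists (fun a => n a.+1 * a.+1)%N; split=> [a|a b]; first by rewrite muln_gt0 n0.
by rewrite [LHS]taylorDs E -mulrnA addSnnS.
Qed.

(** A nonzero germ becomes a unit after finitely many derivatives: this is how a section is shown to
    generate the element of which it is a multiple. *)
Lemma taylor_iter_neq0 f i j : taylor f i j != 0 ->
  taylor (iter i (@Dy R) (iter j (@Ds R) f)) 0%N 0%N != 0.
Proof.
move=> fij; have [n [n0 E]] := taylor_iter_Dy (iter j (@Ds R) f) i.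
have [n' [n'0 E']] := taylor_iter_Ds f j.
by rewrite E add0n mulrn_eq0 negb_or -lt0n n0 E' add0n mulrn_eq0 negb_or -lt0n n'0.
Qed.

End Generation.

Section AwayFromAxes.
Variables (R : realType) (p : Z R).
Hypotheses (p1 : p.1 != 0) (p2 : p.2 != 0).
Local Notation O := (germ R).
Local Notation y := (ycoord p).
Local Notation s := (scoord p).
Local Notation yc := (ycoord (0 : Z R)).
Local Notation sc := (scoord (0 : Z R)).
Variables (M : dmod (@Dy R) (@Ds R)) (e : M).
Hypothesis gen_e : is_gen p e.
Local Notation v := (velt p e).
Local Notation z := (zelt p e).

Lemma ycoord_unit : exists yi, y * yi = 1. Proof. exact: germ_inv. Qed.
Lemma scoord_unit : exists si, s * si = 1. Proof. exact: germ_inv. Qed.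

Lemma mideal_yc (h : O) : mideal (yc * h).
Proof. exact: (taylor_ycM h 0 0). Qed.
Lemma mideal_sc (h : O) : mideal (sc * h).
Proof. exact: (taylor_scM h 0 0). Qed.

Lemma mideal_sub (g h : O) : mideal g -> mideal h -> mideal (g - h).
Proof.
rewrite /mideal => g0 h0; change (taylor g 0%N 0%N - taylor h 0%N 0%N = 0).
by rewrite g0 h0 subrr.
Qed.

(** Here [y] and [s] are units, so the derivatives of [v] and [z] are holomorphic combinations of
    [v] and [z]; [theta0] sends both into the maximal ideal times their span, and [lam = 0] always
    serves. What remains is to find generators of the submodule generated by [u = f v + g z]. *)
Lemma regular_away m T : isdo m T -> regular_elt (T M e).
Proof.
have [yi yyi] := ycoord_unit; have [si ssi] := scoord_unit.
have d1v : d1 v = si *: v + si *: z.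
  by rewrite -scalerDr -(s_d1_v p e) scalerA mulrC ssi scale1r.
have d1z : d1 z = - (yi *+ 3) *: z.
  have := congr1 (GRing.scale yi) (y_d1_z gen_e).
  rewrite scalerA mulrC yyi scale1r => ->; mod_ring (germ R) M.
have d2z : d2 z = 0 := d2_z gen_e.
pose b : O := - (si * y * si); pose a : O := b - si *+ 3.
have d2v : d2 v = a *: v + b *: z.
  have := congr1 (GRing.scale si) (s_d2_v gen_e).
  rewrite scalerA mulrC ssi scale1r d1v => ->; rewrite /a /b; mod_ring (germ R) M.
pose nf w := exists f g, w = f *: v + g *: z.
move=> dT; have [f [g uE]] : nf (T M e).
  apply: (isdo_ind dT).
  - by exists 0, 0; rewrite !scale0r addr0.
  - move=> _ _ [f [g ->]] [f' [g' ->]]; exists (f + f'), (g + g').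
    mod_ring (germ R) M.
  - by move=> h _ [f [g ->]]; exists (h * f), (h * g); mod_ring (germ R) M.
  - move=> _ [f [g ->]]; exists (Dy f + f * si), (f * si + Dy g - g * yi *+ 3).
    rewrite d1D !d1Z d1v d1z; mod_ring (germ R) M.
  - move=> _ [f [g ->]]; exists (Ds f + f * a), (f * b + Ds g).
    rewrite d2D !d2Z d2v d2z; mod_ring (germ R) M.
  rewrite (gen_vE gen_e) d1v; exists (y * si + 1 *+ 2), (y * si); mod_ring (germ R) M.
set u := T M e in uE *.
have gen_z h : h <> 0 -> gen u (h *: z) -> gen u z.
  move=> /germ_neq0[i [j hij]] gh.
  have gD k : gen u (k *: z) -> gen u (Dy k *: z) /\ gen u (Ds k *: z).
    move=> gk; split.
      have := genD (gen_d1 gk) (genZ (yi *+ 3) gk).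
      rewrite d1Z d1z; congr gen; mod_ring (germ R) M.
    by have := gen_d2 gk; rewrite d2Z d2z scaler0 addr0.
  apply: gen_unit (taylor_iter_neq0 hij) _.
  have gj : gen u (iter j (@Ds R) h *: z) by elim: (j) => //= k /gD[].
  by elim: (i) => //= k /gD[].
have [f0|f0] := eqVneq f 0.
  have [g0|/eqP g0] := eqVneq g 0.
    by rewrite uE f0 g0 !scale0r addr0; apply: regular0.
  have uz : u = g *: z by rewrite uE f0 scale0r add0r.
  have gz : gen u z by apply: (gen_z g) => //; rewrite -uz; apply: gen_refl.
  apply: (regular_gen1 (isdo_scale _ _ 0 g) uz gz (mideal_yc (- (yi *+ 3))) (lam := 0)).
  rewrite /theta0 d1z d2z; mod_ring (germ R) M.
(* Differentiate [f] into a unit; after each derivative a multiple of the section is subtracted,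
   which cancels the contribution of the connection to the [v]-component. *)
have [g1 gw] : exists g1, gen u (v + g1 *: z).
  move/eqP/germ_neq0: f0 => [i [j fij]].
  pose E k := exists g1, gen u (k *: v + g1 *: z).
  have ED k : E k -> E (Dy k) /\ E (Ds k).
    move=> [g1 gk]; split.
      exists (k * si + Dy g1 - g1 * yi *+ 3 - si * g1).
      have := genB (gen_d1 gk) (genZ si gk).
      rewrite d1D !d1Z d1v d1z; congr gen; mod_ring (germ R) M.
    exists (k * b + Ds g1 - a * g1).
    have := genB (gen_d2 gk) (genZ a gk).
    rewrite d2D !d2Z d2v d2z; congr gen; mod_ring (germ R) M.
  have Ef : E f by exists g; rewrite -uE; apply: gen_refl.
  have : E (iter i (@Dy R) (iter j (@Ds R) f)).
    have Ej : E (iter j (@Ds R) f) by elim: (j) => //= k /ED[].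
    by elim: (i) => //= k /ED[].
  set k := iter i _ _ => -[g1 gk].
  have [k' kk'] := germ_inv (taylor_iter_neq0 fij).
  exists (k' * g1); have := genZ k' gk; congr gen.
  by rewrite scalerDr !scalerA [k' * k]mulrC kk' scale1r.
set w := v + g1 *: z in gw.
have regvz : gen u z -> regular_elt u.
  move=> gz; have gv : gen u v by have := genB gw (genZ g1 gz); rewrite addrK.
  apply: (regular_gen2 (isdo_scale _ _ 0 f) (isdo_scale _ _ 0 g) uE gv gz
    (h11 := yc * si + sc * a) (h12 := yc * si + sc * b) (h21 := 0)
    (h22 := yc * (- (yi *+ 3))) (lam := 0)) => //.
  - by rewrite -[sc * a]opprK -mulrN; apply/mideal_sub/mideal_sc/mideal_yc.
  - by rewrite -[sc * b]opprK -mulrN; apply/mideal_sub/mideal_sc/mideal_yc.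
  - exact: mideal_yc.
  - rewrite /theta0 d1v d2v; mod_ring (germ R) M.
  rewrite /theta0 d1z d2z; mod_ring (germ R) M.
(* [h], [r1], [r2] are the [z]-components of [u - f w] and of the two derivatives of [w] reduced
   modulo [w]. If one of them is nonzero, [u] generates [z], hence [v]; if all vanish, the multiples
   of [w] are stable under derivation and [w] alone suffices. *)
pose h := g - f * g1.
have hE : u - f *: w = h *: z by rewrite uE /w /h; mod_ring (germ R) M.
have [h0|/eqP h0] := eqVneq h 0; last first.
  by apply/regvz/(gen_z h h0); rewrite -hE; apply/genB/genZ => //; apply: gen_refl.
pose r1 := si + Dy g1 - g1 * yi *+ 3 - si * g1.
have r1E : d1 w - si *: w = r1 *: z.
  rewrite /w d1D !d1Z d1v d1z /r1; mod_ring (germ R) M.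
have [r10|/eqP r10] := eqVneq r1 0; last first.
  by apply/regvz/(gen_z r1 r10); rewrite -r1E; apply/genB/genZ => //; apply: gen_d1.
pose r2 := b + Ds g1 - a * g1.
have r2E : d2 w - a *: w = r2 *: z.
  rewrite /w d2D !d2Z d2v d2z /r2; mod_ring (germ R) M.
have [r20|/eqP r20] := eqVneq r2 0; last first.
  by apply/regvz/(gen_z r2 r20); rewrite -r2E; apply/genB/genZ => //; apply: gen_d2.
move: hE r1E r2E; rewrite h0 r10 r20 !scale0r => /subr0_eq uw /subr0_eq w1 /subr0_eq w2.
apply: (regular_gen1 (isdo_scale _ _ 0 f) uw gw (h := yc * si + sc * a) (lam := 0)).
  by rewrite -[sc * a]opprK -mulrN; apply/mideal_sub/mideal_sc/mideal_yc.
rewrite /theta0 w1 w2; mod_ring (germ R) M.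
Qed.

End AwayFromAxes.

(** * The origin *)

Section Origin.
Variable R : realType.
Local Notation C := R[i].
Local Notation O := (germ R).
Local Notation y := (ycoord (0 : Z R)).
Local Notation s := (scoord (0 : Z R)).
Variables (M : dmod (@Dy R) (@Ds R)) (e : M).
Hypothesis gen_e : is_gen 0 e.
Local Notation v := (velt 0 e).
Local Notation z := (zelt 0 e).
Local Notation D1 n x := (iter n (@d1 _ _ _ M) x).
Implicit Types (f g h : O) (u w W : M).

Lemma taylor_yX n i j : taylor (y ^+ n) i j = ((i == n) && (j == 0%N))%:R.
Proof.
elim: n i j => [|n IHn] i j; first exact: taylor1.
by rewrite exprS taylor_ycM; case: i => [//|i]; rewrite IHn eqSS.
Qed.

Lemma divy_iter f n : (forall a b, (a < n)%N -> taylor f a b = 0) ->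
  exists g, f = y ^+ n * g /\ forall a b, taylor g a b = taylor f (n + a)%N b.
Proof.
elim: n f => [|n IHn] f f0; first by exists f; split=> //; rewrite mul1r.
have [|g [fg E]] := IHn (divy f).
  by move=> a b lt_a; apply: f0.
exists g; split=> [|a b]; last by rewrite E addSn.
by rewrite exprS -mulrA -fg -divyE // => b; apply: f0.
Qed.

Lemma divs_iter f n : (forall a b, (b < n)%N -> taylor f a b = 0) ->
  exists g, f = s ^+ n * g /\ forall a b, taylor g a b = taylor f a (n + b)%N.
Proof.
elim: n f => [|n IHn] f f0; first by exists f; split=> //; rewrite mul1r.
have [|g [fg E]] := IHn (divs f).
  by move=> a b lt_b; apply: f0.
exists g; split=> [|a b]; last by rewrite E addSn.
by rewrite exprS -mulrA -fg -divsE // => b; apply: f0.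
Qed.

Lemma gconstM (a b : C) : gconst a * gconst b = gconst (a * b).
Proof. by apply: germ_ext => i j; rewrite taylor_gconstM !taylor_gconst mulrnAr. Qed.

Lemma gconst_nat n : gconst n%:R = n%:R :> O.
Proof. by apply: germ_ext => i j; rewrite taylor_gconst taylorMn taylor1 -!mulrnA mulnC. Qed.

Lemma D1D n u w : D1 n (u + w) = D1 n u + D1 n w.
Proof. by elim: n => //= n ->; rewrite d1D. Qed.

Lemma D1s n w : D1 n (s *: w) = s *: D1 n w.
Proof. by elim: n => //= n ->; rewrite d1Z Dy_scoord scale0r add0r. Qed.

Lemma D1sX n l w : D1 n (s ^+ l *: w) = s ^+ l *: D1 n w.
Proof.
elim: l w => [|l IHl] w; first by rewrite !scale1r.
by rewrite exprS -!scalerA D1s IHl.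
Qed.

Lemma s_D1_v n : s *: D1 n.+1 v = D1 n v + D1 n z.
Proof. by rewrite iterSr -D1s s_d1_v D1D. Qed.

Lemma y_D1_z k : y *: D1 k.+1 z = - (D1 k z *+ (k + 3)).
Proof.
elim: k => [|k IHk]; first by rewrite /= y_d1_z.
have := congr1 (@d1 _ _ _ M) IHk; rewrite d1Z Dy_ycoord scale1r d1N d1Mn -!iterS.
by move=> /(canRL (addKr _)) ->; mod_ring (germ R) M.
Qed.

Lemma d2_D1_z k : d2 (D1 k z) = 0.
Proof. by rewrite d2_iter_d1 d2_z //; elim: k => //= k ->; rewrite d1_0. Qed.

Definition invk k : O := gconst (k + 3)%:R^-1.

Lemma invkE k : invk k *+ (k + 3) = 1.
Proof.
rewrite -mulr_natr -gconst_nat gconstM mulVf ?gconst1 //.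
by rewrite pnatr_eq0 addn3.
Qed.

Lemma D1_z_raise k : D1 k z = - (invk k * y) *: D1 k.+1 z.
Proof.
rewrite scaleNr -scalerA y_D1_z scalerN opprK -scalerMnr scalerMnl invkE.
by rewrite scale1r.
Qed.

(** With [z = y^-3], [D1 k z] is a constant times [y^(-k-3)], and these sections make up [O[1/y]]. A
    single term is enough because [D1_z_raise] brings any two to a common pole order. *)
Definition zf W := exists k g, W = g *: D1 k z.

Lemma zf_raise k g n : exists g', g *: D1 k z = g' *: D1 (k + n)%N z.
Proof.
elim: n => [|n [g' E]]; first by exists g; rewrite addn0.
exists (g' * - (invk (k + n) * y)).
by rewrite addnS -scalerA -D1_z_raise.
Qed.

Lemma zf0 : zf 0.
Proof. by exists 0%N, 0; rewrite scale0r. Qed.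

Lemma zfD W W' : zf W -> zf W' -> zf (W + W').
Proof.
move=> [k [g ->]] [k' [g' ->]]; have [h ->] := zf_raise k g k'.
have [h' ->] := zf_raise k' g' k; exists (k + k')%N, (h + h').
by rewrite [(k' + k)%N]addnC scalerDl.
Qed.

Lemma zfZ f W : zf W -> zf (f *: W).
Proof. by move=> [k [g ->]]; exists k, (f * g); rewrite scalerA. Qed.

Lemma zfN W : zf W -> zf (- W).
Proof. by move=> /(zfZ (-1)); rewrite scaleN1r. Qed.

Lemma zfB W W' : zf W -> zf W' -> zf (W - W').
Proof. by move=> zW /zfN; apply: zfD. Qed.

Lemma zf_D1z k : zf (D1 k z).
Proof. by exists k, 1; rewrite scale1r. Qed.

Lemma zf_d1 W : zf W -> zf (d1 W).
Proof.
move=> [k [g ->]]; rewrite d1Z; apply: zfD; apply/zfZ; first exact: zf_D1z.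
exact: (zf_D1z k.+1).
Qed.

Lemma zf_d2 W : zf W -> zf (d2 W).
Proof.
by move=> [k [g ->]]; rewrite d2Z d2_D1_z scaler0 addr0; apply/zfZ/zf_D1z.
Qed.

(** Modulo [O[1/y]] one has [D1 n v = s D1 (n+1) v], so a single derivative of [v] suffices; raising
    [n] costs a factor [s] in the coefficient. *)
Definition nf w := exists n f W, zf W /\ w = f *: D1 n v + W.

Lemma nf_raise n f W m : zf W ->
  exists f' W', zf W' /\ f *: D1 n v + W = f' *: D1 (n + m)%N v + W'.
Proof.
move=> zW; elim: m => [|m [f' [W' [zW' ->]]]]; first by exists f, W; rewrite addn0.
exists (f' * s), (W' - f' *: D1 (n + m)%N z); split.
  by apply: zfB => //; apply/zfZ/zf_D1z.
rewrite addnS -scalerA s_D1_v; mod_ring (germ R) M.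
Qed.

Lemma nfD w w' : nf w -> nf w' -> nf (w + w').
Proof.
move=> [n [f [W [zW ->]]]] [n' [f' [W' [zW' ->]]]].
have [g [X [zX ->]]] := nf_raise n f n' zW.
have [g' [X' [zX' ->]]] := nf_raise n' f' n zW'.
exists (n + n')%N, (g + g'), (X + X'); split; first exact: zfD.
rewrite [(n' + n)%N]addnC; mod_ring (germ R) M.
Qed.

Lemma nfZ g w : nf w -> nf (g *: w).
Proof.
move=> [n [f [W [zW ->]]]]; exists n, (g * f), (g *: W); split; first exact: zfZ.
by rewrite scalerDr scalerA.
Qed.

Lemma nf_D1v n : nf (D1 n v).
Proof. by exists n, 1, 0; rewrite scale1r addr0; split=> //; apply: zf0. Qed.

Lemma nf_zf W : zf W -> nf W.
Proof. by move=> zW; exists 0%N, 0, W; rewrite scale0r add0r. Qed.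

Lemma nf_d1 w : nf w -> nf (d1 w).
Proof.
move=> [n [f [W [zW ->]]]]; rewrite d1D d1Z; apply: nfD; last exact/nf_zf/zf_d1.
by apply: nfD; apply: nfZ; [apply: nf_D1v | apply: (nf_D1v n.+1)].
Qed.

Lemma nf_d2 w : nf w -> nf (d2 w).
Proof.
move=> [n [f [W [zW ->]]]]; rewrite d2D d2Z d2_iter_d1.
apply: nfD; last exact/nf_zf/zf_d2.
apply: nfD; apply: nfZ; first exact: nf_D1v.
have : nf (d2 v).
  rewrite d2_v // -scaler_nat -!scaleNr; apply: nfD; apply: nfZ.
    exact: (nf_D1v 2).
  exact: (nf_D1v 1).
by elim: n => //= n IHn /IHn; apply: nf_d1.
Qed.

Lemma nf_isdo m (T : uop (@Dy R) (@Ds R)) : isdo m T -> nf (T M e).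
Proof.
move=> dT; apply: (isdo_ind dT).
- exact/nf_zf/zf0.
- exact: nfD.
- exact: nfZ.
- exact: nf_d1.
- exact: nf_d2.
rewrite (gen_vE gen_e) -scaler_nat; apply: nfD; apply: nfZ.
  exact: (nf_D1v 1).
exact: (nf_D1v 0).
Qed.

Lemma yX_D1_z k : exists2 c : C, c != 0 & y ^+ k *: D1 k z = gconst c *: z.
Proof.
elim: k => [|k [c c0 E]]; first by exists 1; rewrite ?oner_eq0 // gconst1.
exists (- c * (k + 3)%:R).
  by rewrite mulf_eq0 oppr_eq0 (negPf c0) pnatr_eq0 addn3.
rewrite exprSr -scalerA y_D1_z scalerN -scalerMnr E -gconstM gconst_nat.
have -> : gconst (- c) = - gconst c :> O.
  by apply: germ_ext => i j; rewrite taylorN !taylor_gconst mulNrn.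
mod_ring (germ R) M.
Qed.

Lemma gen_gconst (c : C) u w : c != 0 -> gen u (gconst c *: w) -> gen u w.
Proof. by move=> c0; apply: gen_unit; rewrite taylor_gconst. Qed.

(* [D1 K z] has a pole of order [K + 3] along [y = 0]: a section with a genuine
   pole generates [z]. *)
Lemma gen_pole u r k i j : gen u (r *: D1 k z) -> (i <= k + 2)%N ->
  taylor r i j != 0 -> gen u z.
Proof.
move=> gr le_i rij.
have ex : exists i, `[< exists j, taylor r i j != 0 >] by exists i; apply/asboolP; exists j.
(* [i0] is the order of vanishing of [r] along [y = 0]. As [d2] kills [D1 k z], derivatives in [s]
   act on [r] alone and turn its leading coefficient in [y] into a unit. *)
case: (ex_minnP ex) => i0 /asboolP[j0 r0] min_i0.
have le_i0 : (i0 <= i)%N by apply: min_i0; apply/asboolP; exists j.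
have gr' : gen u (iter j0 (@Ds R) r *: D1 k z).
  elim: (j0) => //= l /gen_d2; rewrite d2Z d2_D1_z scaler0 addr0.
  by [].
have [n [n0 E]] := taylor_iter_Ds r j0.
have [|r' [rE r'E]] := @divy_iter (iter j0 (@Ds R) r) i0.
  move=> a b lt_a; rewrite E; apply/eqP; rewrite mulrn_eq0; apply/orP; right.
  apply/negP => /negP rab; move: lt_a; rewrite ltnNge => /negP; apply.
  by apply: min_i0; apply/asboolP; exists (b + j0)%N.
have r'0 : taylor r' 0%N 0%N != 0.
  by rewrite r'E addn0 E add0n mulrn_eq0 negb_or -lt0n n0.
rewrite rE mulrC -scalerA in gr'; move/(gen_unit r'0): gr' => gy.
have [c c0 yk] := yX_D1_z k.
(* From [y d1 z = - 3 z] one gets [d1 (y z) = - 2 z]. *)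
have gyz : gen u (y *: z) -> gen u z.
  move=> /gen_d1; rewrite d1Z Dy_ycoord y_d1_z // => gz.
  apply: (@gen_gconst (- 2%:R)); first by rewrite oppr_eq0 pnatr_eq0.
  move: gz; congr gen.
  have -> : gconst (- 2%:R) = - 2%:R :> O.
    by rewrite -gconst_nat; apply: germ_ext => a b; rewrite taylorN !taylor_gconst mulNrn.
  mod_ring (germ R) M.
have [le_ik|lt_ki] := leqP i0 k.
  move/(genZ (y ^+ (k - i0))): gy; rewrite scalerA -exprD subnK // yk.
  exact: gen_gconst.
move: gy; rewrite -(subnK (ltnW lt_ki)) exprD -scalerA yk.
rewrite scalerA mulrC -scalerA => /(gen_gconst c0).
(* Pole orders 2 and 1 remain, those of [y z] and [y^2 z]; the latter reduces to the former by
   [d1 (y^2 z) = - y z]. *)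
have : (i0 - k == 1)%N || (i0 - k == 2)%N by lia.
case/orP => /eqP->; first by rewrite expr1.
rewrite expr2 -scalerA => gyy; apply: gyz; move/gen_d1: gyy.
rewrite !d1Z Dy_ycoord y_d1_z // => gz.
move/genN: gz; congr gen; mod_ring (germ R) M.
Qed.

(** Applied to [v + G] with [G] in [O[1/y]], the operator [s d1 - 1] gives [z + s d1 G - G]. This
    has a genuine pole: otherwise, in powers of [s], [G] would have to contain [y^-3], then a
    multiple of [s y^-4], and so on, with unbounded poles. Then [gen_pole] applies. *)
Lemma gen_v_z u g k : gen u (v + g *: D1 k z) -> gen u z.
Proof.
move=> gw; have [c c0 yk] := yX_D1_z k.+1.
pose c' : O := gconst c^-1.
have zE : z = (c' * y ^+ k.+1) *: D1 k.+1 z.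
  by rewrite -scalerA yk scalerA gconstM mulVf // gconst1 scale1r.
pose r := c' * y ^+ k.+1 - invk k * (y * (s * Dy g - g)) + s * g.
have gr : gen u (r *: D1 k.+1 z).
  have := genB (genZ s (gen_d1 gw)) gw.
  rewrite d1D d1Z scalerDr s_d1_v; congr gen.
  rewrite [in LHS](_ : v + z + s *: (Dy g *: D1 k z + g *: d1 (D1 k z)) - (v + g *: D1 k z) =
    z + (s * Dy g - g) *: D1 k z + (s * g) *: D1 k.+1 z); last first.
    rewrite iterS; mod_ring (germ R) M.
  rewrite [X in X + _ + _ = _]zE (D1_z_raise k) /r; mod_ring (germ R) M.
have rE i j : taylor r i j = c^-1 * ((i == k.+1) && (j == 0%N))%:R
   - (k + 3)%:R^-1 * (if i is i'.+1 then
       (if j is j'.+1 then taylor g i j' *+ i else 0) - taylor g i' j else 0)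
   + (if j is j'.+1 then taylor g i j' else 0).
  rewrite /r !taylorD taylorN /c' /invk !taylor_gconstM taylor_yX taylor_ycM taylor_scM.
  by case: i => [//|i]; rewrite taylorD taylorN taylor_scM; case: j.
apply: contrapT => nz; have r0 i j : (i <= k + 3)%N -> taylor r i j = 0.
  move=> le_i; apply/eqP/negPn/negP => rij; apply: nz.
  by apply: (gen_pole (k := k.+1) gr _ rij); lia.
have k3 : (k + 3)%:R != 0 :> C by rewrite pnatr_eq0 addn3.
(* From the highest pole downwards: once row [i - 1] of [g] vanishes, the coefficient of
   [y^i s^(j+1)] in [r] is [(1 - i / (k + 3)) g_ij], and [i < k + 3]. *)
have g0 i j : (i <= k)%N -> taylor g i j = 0.
  elim: i j => [|i IHi] j le_i; have := r0 _ j.+1 (leq_trans le_i (leq_addr 3 k)).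
    by rewrite rE /= mulr0 mulr0 subrr add0r.
  rewrite rE /= eqSS ltn_eqF ?mulr0; last by lia.
  rewrite IHi ?subr0 ?sub0r; last by lia.
  set x := taylor g i.+1 j => E.
  have : ((k + 3)%:R - i.+1%:R) * x = 0.
    by rewrite -[RHS](mulr0 (k + 3)%:R) -E; field; rewrite -(natrD _ k 3) k3.
  move/eqP; rewrite mulf_eq0 subr_eq0 eqr_nat => /orP[|/eqP //].
  by rewrite gtn_eqF //; lia.
(* All that is left of the coefficient of [y^(k+1)] is [c^-1], the contribution of [z] itself. *)
have := r0 k.+1 0%N; rewrite rE !eqxx /= mulr1 g0 // subrr mulr0 subr0 addr0.
by move=> /(_ ltac:(lia)) /eqP; rewrite invr_eq0 (negPf c0).
Qed.

Lemma sX_D1_v l n : exists W, zf W /\ s ^+ l *: D1 (l + n)%N v = D1 n v + W.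
Proof.
elim: l => [|l [W [zW E]]]; first by exists 0; rewrite scale1r addr0; split=> //; apply: zf0.
exists (W + s ^+ l *: D1 (l + n)%N z); split; first by apply/zfD/zfZ/zf_D1z.
by rewrite exprSr -scalerA addSn s_D1_v scalerDr E addrA.
Qed.

(* The operator [s d1 - 1] kills [v] modulo the sections with poles on [y = 0],
   on which it acts through its coefficient by [s Dy]. *)
Lemma gen_v u f n W : zf W -> f <> 0 -> gen u (f *: D1 n v + W) ->
  exists W', zf W' /\ gen u (v + W').
Proof.
move=> zW f0 gf.
pose E h := exists W, zf W /\ gen u (h *: D1 n v + W).
have ED h : E h -> E (s * Dy h).
  move=> [X [zX gX]]; exists (h *: D1 n z + s *: d1 X - X); split.
    by apply: zfB => //; apply: zfD; apply: zfZ; [exact: zf_D1z | exact: zf_d1].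
  have := genB (genZ s (gen_d1 gX)) gX; congr gen.
  rewrite d1D d1Z -iterS; transitivity
    ((s * Dy h) *: D1 n v + h *: (s *: D1 n.+1 v) + s *: d1 X - h *: D1 n v - X).
    mod_ring (germ R) M.
  rewrite s_D1_v; mod_ring (germ R) M.
have EZ g h : E h -> E (g * h).
  move=> [X [zX gX]]; exists (g *: X); split; first exact: zfZ.
  by have := genZ g gX; rewrite scalerDr scalerA.
have Ef : E f by exists W.
have ex : exists j, `[< exists i, taylor f i j != 0 >].
  by have [i [j fij]] := germ_neq0 f0; exists j; apply/asboolP; exists i.
case: (ex_minnP ex) => j /asboolP[i fij] min_j.
(* Since [Dy] kills [s], iterating [s Dy] gives [s^i Dy^i f]. As [j] is the order of [f] in [s],
   [Dy^i f] is then [s^j] times a unit. *)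
have Ei : E (s ^+ i * iter i (@Dy R) f).
  elim: (i) => [|l /ED]; first by rewrite mul1r.
  have -> : Dy (s ^+ l * iter l (@Dy R) f) = s ^+ l * iter l.+1 (@Dy R) f.
    rewrite DyM; have -> : Dy (s ^+ l) = 0; last by rewrite mul0r add0r.
    elim: (l) => [|m IHm]; first by rewrite expr0 Dy1.
    by rewrite exprS DyM IHm Dy_scoord mul0r mulr0 addr0.
  by rewrite mulrA -exprS.
have [m [m0 mE]] := taylor_iter_Dy f i.
have [|F [FE F0]] := @divs_iter (iter i (@Dy R) f) j.
  move=> a b lt_b; rewrite mE; apply/eqP; rewrite mulrn_eq0; apply/orP; right.
  apply/negP => /negP fab; move: lt_b; rewrite ltnNge => /negP; apply.
  by apply: min_j; apply/asboolP; exists (a + i)%N.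
have [G FG] : exists G, F * G = 1.
  by apply: germ_inv; rewrite F0 addn0 mE add0n mulrn_eq0 negb_or -lt0n m0.
have [X [zX gX]] : E (s ^+ (i + j)).
  have := EZ G _ Ei; congr E.
  by rewrite FE exprD -[RHS]mulr1 -FG; ring.
(* The factor [s^(i+j)] is absorbed by applying [d1] as many times, because [s^l D1 (l+n) v] is
   [D1 n v] modulo [O[1/y]]; multiplying by [s^n] then leads back to [v]. *)
have gl l : gen u (s ^+ (i + j) *: D1 (l + n)%N v + D1 l X).
  elim: l => [//|l /gen_d1]; rewrite d1D -(D1sX 1).
  by [].
have [X1 [zX1 X1E]] := sX_D1_v (i + j) n.
have [X2 [zX2 X2E]] := sX_D1_v n 0.
have zD1 l Y : zf Y -> zf (D1 l Y) by move=> zY; elim: l => //= l; apply: zf_d1.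
exists (X2 + s ^+ n *: (X1 + D1 (i + j)%N X)); split.
  by apply: zfD => //; apply/zfZ/zfD => //; apply: zD1.
have := genZ (s ^+ n) (gl (i + j)%N); congr gen.
by rewrite X1E -addrA scalerDr -[in D1 n v](addn0 n) X2E addrA.
Qed.

Lemma regular_origin m (T : uop (@Dy R) (@Ds R)) : isdo m T -> regular_elt (T M e).
Proof.
move=> /nf_isdo[n [f [_ [[k [g ->]] uE]]]]; set u := T M e in uE *.
have isdo_D1 h l : isdo l (fun (N : dmod (@Dy R) (@Ds R)) t => h *: iter l (@d1 _ _ _ N) t).
  by rewrite -[X in isdo X]addn0; exact: (isdo_mono _ _ h (leqnn (l + 0)%N)).
have thz : theta0 M z = z *~ (- 3%:Z) + 0 *: z.
  rewrite /theta0 y_d1_z // d2_z //; mod_ring (germ R) M.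
have [f0|/eqP f0] := eqVneq f 0; last first.
  have zgz : zf (g *: D1 k z) by apply/zfZ/zf_D1z.
  have guf : gen u (f *: D1 n v + g *: D1 k z) by rewrite -uE; apply: gen_refl.
  have [W [[k' [g' ->]] gw]] := gen_v zgz f0 guf.
  have gz := gen_v_z gw.
  have gD1z : gen u (D1 k' z) by elim: (k') => //= l; apply: gen_d1.
  have gv : gen u v by have := genB gw (genZ g' gD1z); rewrite addrK.
  (* The eigenvalue agrees with that of [z], as [regular_gen2] demands: [s^-3 exp(y / s)] and [y^-3]
     are both homogeneous of degree -3. *)
  have thv : theta0 M v = v *~ (- 3%:Z) + 0 *: v + 0 *: z.
    rewrite /theta0 s_d2_v //; mod_ring (germ R) M.
  apply: (regular_gen2 (isdoW (leq_addr k n) (isdo_D1 f n))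
    (isdoW (leq_addl n k) (isdo_D1 g k)) uE gv gz _ _ _ _ thv
    (h21 := 0) (h22 := 0)) => //.
  by rewrite thz; mod_ring (germ R) M.
have uz : u = g *: D1 k z by rewrite uE f0 scale0r add0r.
have [g0|/eqP g0] := eqVneq g 0.
  by rewrite uz g0 scale0r; apply: regular0.
have [[i [j [le_i gij]]]|nz] := pselect (exists i j, (i <= k + 2)%N /\ taylor g i j != 0).
  have gz : gen u z by apply: gen_pole le_i gij; rewrite -uz; apply: gen_refl.
  exact: (regular_gen1 (isdo_D1 g k) uz gz _ thz).
have [a b lt_a|h [gE _]] := @divy_iter g (k + 3).
  apply/eqP/negPn/negP => gab; apply: nz; exists a, b; split=> //; lia.
have [c c0 yk] := yX_D1_z k.
(* The constant function 1 of [O[1/y]]. As [g] is divisible by [y^(k+3)], [u] is a germ times [w],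
   and differentiating that germ into a unit recovers [w]. *)
pose w := y ^+ 3 *: z.
have w1 : d1 w = 0.
  rewrite /w d1Z; have -> : Dy (y ^+ 3) = y ^+ 2 *+ 3.
    by rewrite !exprS expr0 !DyM Dy_ycoord Dy1; ring.
  have -> : y ^+ 3 *: d1 z = y ^+ 2 *: (y *: d1 z) by rewrite scalerA -exprSr.
  rewrite y_d1_z //; mod_ring (germ R) M.
have w2 : d2 w = 0.
  rewrite /w d2Z d2_z // !exprS expr0 !DsM Ds_ycoord Ds1.
  by rewrite !(mul0r, mulr0, addr0) scale0r scaler0 addr0.
have uw : u = (h * gconst c) *: w.
  rewrite uz gE exprD /w; transitivity (h *: (y ^+ 3 *: (y ^+ k *: D1 k z))).
    mod_ring (germ R) M.
  rewrite yk; mod_ring (germ R) M.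
have hc0 : h * gconst c <> 0.
  move=> hc; apply: g0; rewrite gE -[h]mulr1 -gconst1 -(mulfV c0) -gconstM.
  by rewrite [h * _]mulrA hc mul0r mulr0.
have [i [j hij]] := germ_neq0 hc0.
have gw : gen u w.
  apply: gen_unit (taylor_iter_neq0 hij) _.
  have gj : gen u (iter j (@Ds R) (h * gconst c) *: w).
    elim: (j) => [|l /gen_d2]; first by rewrite -uw; apply: gen_refl.
    by rewrite d2Z w2 scaler0 addr0.
  by elim: (i) => //= l /gen_d1; rewrite d1Z w1 scaler0 addr0.
apply: (regular_gen1 (isdo_scale _ _ 0 (h * gconst c)) uw gw (lam := 0) (h := 0)) => //.
by rewrite /theta0 w1 w2 !scaler0 mulr0z scale0r.
Qed.

End Origin.

(** * Holonomicity *)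

Section Holonomic.
Variable R : realType.
Local Notation C := R[i].
Local Notation V := ((C^o * C^o) * (C^o * C^o))%type.

(** The characteristic variety lies in the four planes given by [y eta = 0] and [s sigma = 0]. On
    each of them [y + eta] and [s + sigma] restrict to coordinates, so a common fibre has at most
    four points, the list [F] of [holonomic_J]. *)
Definition form1 : V -> C^o := fun x => x.1.1 + x.2.1.
Definition form2 : V -> C^o := fun x => x.1.2 + x.2.2.

Fact form1_linear : linear form1.
Proof. by move=> a x x'; rewrite /form1 /= scalerDr addrACA. Qed.
Fact form2_linear : linear form2.
Proof. by move=> a x x'; rewrite /form2 /= scalerDr addrACA. Qed.
HB.instance Definition _ := GRing.isLinear.Build C V C^o *:%R form1 form1_linear.
HB.instance Definition _ := GRing.isLinear.Build C V C^o *:%R form2 form2_linear.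

Lemma char_variety_sub (x : V) : char_variety (J R) x ->
  x.1.1 * x.2.1 ^+ 2 = 0 /\ x.1.2 * x.2.2 + x.1.1 * x.2.1 = 0.
Proof.
case: x => -[y s] [eta sigma] /= ch; split.
- pose a (i j : nat) : germ R := match i, j with
    | 2%N, 0%N => ycoord (y, s) | 1%N, 0%N => 2%:R | 0%N, 1%N => 1 | _, _ => 0 end.
  have E : diffop 2 a = P1 (y, s).
    apply/funext => f; rewrite /diffop !big_ord_recl !big_ord0 /= /P1 mulr_natl.
    ring.
  have := ch 2%N a; rewrite E => /(_ _)/wrap[].
    exists id, 0; split; [exact: D_id | exact: D_0 |].
    by apply/funext => f; rewrite /= addr0.
  rewrite !big_ord_recl big_ord0 -[X in X = 0 -> _]/(0 * eta ^+ 0 * sigma ^+ 2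
    + (0 * eta ^+ 1 * sigma ^+ 1 + (y * eta ^+ 2 * sigma ^+ 0 + 0))).
  by rewrite !mul0r !add0r expr0 mulr1 addr0.
pose a (i j : nat) : germ R := match i, j with
  | 1%N, 0%N => ycoord (y, s) | 0%N, 0%N => 3%:R | 0%N, 1%N => scoord (y, s) | _, _ => 0 end.
have E : diffop 1 a = Q1 (y, s).
  apply/funext => f; rewrite /diffop !big_ord_recl !big_ord0 /= /Q1 mulr_natl.
  by ring.
have := ch 1%N a; rewrite E => /(_ _)/wrap[].
  exists 0, id; split; [exact: D_0 | exact: D_id |].
  by apply/funext => f; rewrite /= add0r.
rewrite !big_ord_recl big_ord0 -[X in X = 0 -> _]/(s * eta ^+ 0 * sigma ^+ 1
  + (y * eta ^+ 1 * sigma ^+ 0 + 0)).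
by rewrite !expr0 !mulr1 addr0.
Qed.

Lemma holonomic_J : holonomic (J R).
Proof.
move=> x chx.
exists (fun k : 'I_2 => if val k == 0%N then form1 : {linear V -> C^o} else form2).
pose c := form1 x; pose d := form2 x.
pose F : seq V := [:: ((0, 0), (c, d)); ((0, d), (c, 0)); ((c, d), (0, 0)); ((c, 0), (0, d))].
have F_near : nbhs (x : V) [set z | z \in F -> z = x].
  elim: F => [|w F IHF]; first by apply: filterE => z.
  have [->|wx] := eqVneq w x.
    by apply: filterS IHF => z IH; rewrite /= inE => /orP[/eqP //|/IH].
  have xw : nbhs (x : V) [set~ w].
    apply: open_nbhs_nbhs; split; last by move/esym/eqP; rewrite (negPf wx).
    apply: closed_openC; apply: accessible_closed_set1.
    exact/hausdorff_accessible/norm_hausdorff.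
  apply: filterS2 xw IHF => z zw IH; rewrite /= inE => /orP[/eqP //|/IH //].
apply: filterS F_near => z zF /char_variety_sub[z1 z2] lz.
have c1 : form1 z = c := lz ord0.
have d1 : form2 z = d := lz (lift ord0 ord0).
apply: zF; rewrite /F !inE -c1 -d1 /form1 /form2; move: z1 z2; clear.
case: z => -[y s] [eta sigma] /= /eqP; rewrite mulf_eq0 expf_eq0 /=.
move=> H1 /eqP H2.
case/orP: H1 => /eqP y0; move: H2; rewrite y0 ?mul0r ?mulr0 addr0 mulf_eq0;
  case/orP => /eqP ->; rewrite ?add0r ?addr0 eqxx ?orbT //.
Qed.

End Holonomic.

(** * The ideal of the curve *)

Section IdealOfCurve.
Variable R : realType.
Local Notation C := R[i].
Local Notation O := (germ R).
Local Notation nc := (@ComplexField.Normc.normc R).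
Local Notation y := (ycoord (0 : Z R)).
Local Notation s := (scoord (0 : Z R)).
Implicit Types (f g h : O).

Definition tcurve : O := s - y ^+ 2.
Local Notation t := tcurve.

Lemma Ds_t : Ds t = 1.
Proof.
by rewrite /tcurve DsD DsN Ds_scoord expr2 DsM Ds_ycoord mul0r mulr0 addr0 subr0.
Qed.

Lemma taylor_tM f i j : taylor (t * f) i j =
  (if j is j'.+1 then taylor f i j' else 0) - (if i is i'.+2 then taylor f i' j else 0).
Proof.
rewrite /tcurve mulrBl taylorD taylorN taylor_scM expr2 -mulrA taylor_ycM.
by case: i => [|[|i]] //; rewrite taylor_ycM.
Qed.

Lemma le_pow2 n : (n.+1%:R : R) <= 2 ^+ n.
Proof. by rewrite -natrX ler_nat; apply: ltn_expl. Qed.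

Lemma cvg0_pow2 (u : nat -> C^o) (K : R) : 0 <= K ->
  (forall m, nc (u m.+2) * 2 ^+ m <= K) -> u @ \oo --> (0 : C^o).
Proof.
move=> K0 uK; rewrite -(cvg_shiftn 2); apply/cvgrPdist_lt => e e0.
have eR : (complex.Re e)%:C%C = e by exact/RRe_real/gtr0_real.
set e' := complex.Re e in eR; have e'0 : 0 < e' by rewrite -ltcR eR.
near=> m; rewrite sub0r normrN normCE -eR ltcR /= addn2.
have : K / e' < m%:R by near: m; apply: nbhs_infty_gtr.
rewrite ltr_pdivrMr // => Ke.
have := uK m; have := le_pow2 m; have := nc_ge0 (u m.+2).
set a := nc _; set b := 2 ^+ m; rewrite -natr1 => a0 mb ab.
rewrite ltNge; apply/negP => ea.
have eb : e' * (m%:R + 1) <= e' * b by rewrite ler_pM2l.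
have : e' * b <= a * b by rewrite ler_wpM2r // exprn_ge0.
lra.
Unshelve. all: by end_near.
Qed.

(** On the curve the two terms of [s - y^2] cancel, but [vanishes_at] sums over squares of indices,
    so the partial sums reduce to three strips along the edges. For [|w| < r / 4] the entries of a
    strip are at most [M 4^-m], and there are at most [m + 1 <= 2^m] of them. *)
Lemma vanishes_tM h : exists2 d : R, 0 < d &
  forall w : C, nc w < d -> vanishes_at (t * h) ((w, w ^+ 2) : Z R).
Proof.
have [r [M [r0 r1 M0 hM]]] := germ_bound h.
exists (r / 4); first by rewrite divr_gt0.
move=> w wr; rewrite /vanishes_at.
pose g i j : C := taylor h i j * w ^+ (i + j.*2).+2.
have g_bound i j : nc (g i j) * 4 ^+ (i + j) <= M.
  rewrite /g ncM ncX; have w0 := nc_ge0 w; have w1 : nc w <= 1 by lra.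
  apply: le_trans (hM i j); rewrite -mulrA ler_wpM2l ?nc_ge0 //.
  have -> : ((i + j.*2).+2 = (i + j) + j.+2)%N by lia.
  rewrite exprD mulrAC -exprMn; apply: le_trans (_ : (nc w * 4) ^+ (i + j) <= _).
    by rewrite ler_piMr ?exprn_ge0 ?mulr_ge0 // exprn_ile1.
  by rewrite lerXn2r ?nnegrE ?mulr_ge0 ?(ltW r0) //; lra.
apply: (@cvg0_pow2 _ (3 * M)); first by rewrite mulr_ge0.
move=> m.
have -> : \sum_(i < m.+2) \sum_(j < m.+2) taylor (t * h) i j * ((w, w ^+ 2) : Z R).1 ^+ i *
    ((w, w ^+ 2) : Z R).2 ^+ j = \sum_(j < m.+1) g m j + \sum_(j < m.+1) g m.+1 j
    - \sum_(i < m) g i m.+1.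
  have E1 : \sum_(i < m.+2) \sum_(j < m.+2) (if val j is j'.+1 then taylor h i j' else 0) *
      w ^+ i * (w ^+ 2) ^+ j = \sum_(i < m.+2) \sum_(j < m.+1) g i j.
    apply: eq_bigr => i _; rewrite big_ord_recl /= !mul0r add0r; apply: eq_bigr => j _.
    by rewrite /g -exprM -mulrA -exprD; congr (_ * _ ^+ _); rewrite /bump /=; lia.
  have E2 : \sum_(i < m.+2) \sum_(j < m.+2) (if val i is i'.+2 then taylor h i' j else 0) *
      w ^+ i * (w ^+ 2) ^+ j = \sum_(i < m) \sum_(j < m.+2) g i j.
    rewrite big_ord_recl big1 ?add0r => [|j _]; last by rewrite /= !mul0r.
    rewrite big_ord_recl big1 ?add0r => [|j _]; last by rewrite /= !mul0r.
    apply: eq_bigr => i _; apply: eq_bigr => j _ /=.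
    by rewrite /g -exprM -mulrA -exprD; congr (_ * _ ^+ _); rewrite /bump /=; lia.
  transitivity (\sum_(i < m.+2) \sum_(j < m.+1) g i j - \sum_(i < m) \sum_(j < m.+2) g i j).
    rewrite -E1 -E2 -sumrB; apply: eq_bigr => i _; rewrite -sumrB; apply: eq_bigr => j _.
    by rewrite taylor_tM !mulrBl.
  pose G (i : nat) := \sum_(j < m.+1) g i j.
  have EA : \sum_(i < m.+2) G i = \sum_(i < m) G i + G m + G m.+1.
    by rewrite big_ord_recr big_ord_recr.
  have EB : \sum_(i < m) \sum_(j < m.+2) g i j =
      \sum_(i < m) G i + \sum_(i < m) g i m.+1.
    by rewrite -big_split; apply: eq_bigr => i _; rewrite big_ord_recr.
  rewrite [X in X - _]EA EB /G; ring.
have B n (F : 'I_n -> C) : (n <= m.+1)%N -> (forall i, nc (F i) * 4 ^+ m <= M) ->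
    nc (\sum_(i < n) F i) * 2 ^+ m <= M.
  move=> le_n FM; apply: le_trans (_ : (\sum_(i < n) nc (F i)) * 2 ^+ m <= _).
    by rewrite ler_wpM2r ?exprn_ge0 // nc_sum.
  rewrite -(ler_pM2r (_ : 0 < 2 ^+ m)) ?exprn_gt0 // -mulrA -exprMn -natrM mulr_suml.
  apply: le_trans (ler_sum _ (fun i _ => FM i)) _.
  rewrite sumr_const card_ord -[M *+ n]mulr_natr ler_wpM2l //.
  by apply: le_trans (le_pow2 m); rewrite ler_nat.
have gB i j : (m <= i + j)%N -> nc (g i j) * 4 ^+ m <= M.
  move=> le_m; apply: le_trans (g_bound i j); rewrite ler_wpM2l ?nc_ge0 //.
  by rewrite ler_weXn2l //; lra.
set a := \sum_(j < m.+1) g m j; set b := \sum_(j < m.+1) g m.+1 j.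
set c := \sum_(i < m) _.
have aB : nc a * 2 ^+ m <= M by apply: B => // i; apply: gB; lia.
have bB : nc b * 2 ^+ m <= M by apply: B => // i; apply: gB; lia.
have cB : nc c * 2 ^+ m <= M by apply: B => // i; apply: gB; lia.
have p0 : 0 < (2 : R) ^+ m by rewrite exprn_gt0.
have := ncB (a + b) c; have := ncD a b.
by nra.
Qed.

(** Division by [s - y^2] with respect to [s]: the quotient [q] is determined by
    [f_(i,j+1) = q_(i,j) - q_(i-2,j+1)], and the remainder depends on [y] only ([taylor_rem]). *)
Fixpoint quot_coef (f : fps (fps C)) i j : C := f i j.+1 +
  match i with i'.+2 => quot_coef f i' j.+1 | _ => 0 end.

Lemma quot_coef_bound (f : fps (fps C)) (r M : R) i j : 0 < r -> 0 <= M -> r <= 1 ->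
  (forall i j, nc (f i j) * r ^+ (i + j) <= M) ->
  nc (quot_coef f i j) * r ^+ (i + j).+1 <= M *+ i.+1.
Proof.
move=> r0 M0 r1 fM; have [n] := ubnP i; elim: n i j => // n IHn i j lt_in.
case: i lt_in => [|[|i]] lt_in.
- by rewrite /= addr0 -addnS; apply: fM.
- rewrite /= addr0 -addnS; apply: le_trans (fM 1%N j.+1) _.
  by rewrite mulr2n lerDl.
rewrite [quot_coef _ _ _]/(f i.+2 j.+1 + quot_coef f i j.+1).
have X0 : 0 <= r ^+ (i.+2 + j).+1 by rewrite exprn_ge0 // ltW.
apply: le_trans (ler_wpM2r X0 (ncD _ _)) _; rewrite mulrDl mulrS.
apply: lerD; first by rewrite -addnS; apply: fM.
have H := IHn i j.+1 ltac:(lia).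
have -> : ((i.+2 + j).+1 = (i + j.+1).+1.+1)%N by lia.
rewrite exprSr mulrA; apply: le_trans (_ : M *+ i.+1 <= _).
  apply: le_trans H; rewrite ler_piMr // mulr_ge0 ?nc_ge0 // exprn_ge0 //; exact: ltW.
by rewrite ler_wpMn2l.
Qed.

Lemma convergent_half_nc (f : fps (fps C)) (r M : R) : 0 < r -> 0 <= M ->
  (forall i j, nc (f i j) * r ^+ (i + j) <= M *+ (2 ^ (i + j))) ->
  f \in @convergent R.
Proof.
move=> r0 M0 fM; apply: (@convergent_half _ _ r%:C%C M%:C%C).
- by rewrite ltcR.
- by rewrite lecR.
by move=> i j; rewrite normCE -rmorphXn -rmorphM -rmorphMn lecR.
Qed.

Fact quot_convergent f :
  ((fun i j => quot_coef (taylor f) i j) : fps (fps C)) \in @convergent R.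
Proof.
have [r [M [r0 r1 M0 fM]]] := germ_bound f.
apply: (@convergent_half_nc _ r (M / r)) => // [|i j]; first by rewrite divr_ge0 // ltW.
have := quot_coef_bound i j r0 M0 r1 fM.
rewrite exprSr mulrA -ler_pdivlMr // => /le_trans; apply.
rewrite mulrnAl ler_wpMn2l ?divr_ge0 ?(ltW r0) //.
by apply: leq_trans (ltn_expl i (ltnSn 1)) _; rewrite leq_exp2l // leq_addr.
Qed.

Definition quot f : O := Germ (quot_convergent f).

Lemma taylor_quot f i j : taylor (quot f) i j = taylor f i j.+1 +
  match i with i'.+2 => taylor (quot f) i' j.+1 | _ => 0 end.
Proof. by case: i. Qed.

Lemma taylor_rem f i j : taylor (f - t * quot f) i j.+1 = 0.
Proof.
rewrite taylorD taylorN taylor_tM taylor_quot.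
by case: i => [|[|i]]; rewrite ?addr0 ?subr0 ?subrr // addrK subrr.
Qed.

Lemma identity_principle f (d : R) : 0 < d -> (forall i j, taylor f i j.+1 = 0) ->
  (forall w : C, nc w < d -> vanishes_at f ((w, w ^+ 2) : Z R)) -> f = 0.
Proof.
move=> d0 fy fv; suff H i : taylor f i 0%N = 0.
  by apply: germ_ext => i [|j]; [exact: H | exact: fy].
have [r [M [r0 r1 M0 fM]]] := germ_bound f.
have [n] := ubnP i; elim: n i => // n IHn i lt_in.
apply/eqP/negPn/negP => fi; pose c := nc (taylor f i 0%N).
have c0 : 0 < c by rewrite lt_neqAle eq_sym nc_eq0 fi nc_ge0.
(* For [`|w|] small, the partial sums are at distance at most [K |w|^(i+1)] of
   [f_i w^i]. *)
pose K := 2 * M / r ^+ i.+1.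
have K0 : 0 <= K by rewrite divr_ge0 ?exprn_ge0 ?mulr_ge0 // ltW.
have [w [w0 wd wr wK]] : exists w : R, [/\ 0 < w, w < d, w <= r / 2 & K * w < c / 2].
  have K1 : 0 < 4 * (K + 1) by lra.
  pose a := c / (4 * (K + 1)); exists (Num.min (d / 2) (Num.min (r / 2) a)).
  have aE : a * (4 * (K + 1)) = c by rewrite /a divfK // gt_eqF.
  have a0 : 0 < a by rewrite divr_gt0.
  set m := Num.min _ _; have md : m <= d / 2 by rewrite ge_min lexx.
  have mr : m <= r / 2 by rewrite !ge_min lexx orbT.
  have ma : m <= a by rewrite !ge_min lexx !orbT.
  split; [by rewrite !lt_min !divr_gt0 | lra | lra | by nra].
have ncw : nc w%:C%C = w by have := normCE w%:C%C; rewrite ger0_norm ?ler0c ?(ltW w0) // => -[].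
have := fv w%:C%C; rewrite ncw => /(_ wd); rewrite /vanishes_at.
set u := fun n => _; move=> ucv.
have e0 : 0 < (c / 2 * w ^+ i)%:C%C by rewrite ltcR mulr_gt0 ?exprn_gt0 ?divr_gt0.
move/cvgrPdist_lt: ucv => /(_ _ e0)[N _ uN].
have := uN (N + i).+1 ltac:(rewrite /=; lia); rewrite sub0r normrN normCE ltcR.
set m := (N + i).+1.
have -> : u m = \sum_(a < m) taylor f a 0%N * (w%:C%C) ^+ a.
  rewrite /u; apply: eq_bigr => a _; rewrite {1}/m big_ord_recl big1 ?addr0 => [|b _].
    by rewrite /= expr0 mulr1.
  by rewrite fy !mul0r.
have -> : \sum_(a < m) taylor f a 0%N * (w%:C%C) ^+ a = taylor f i 0%N * (w%:C%C) ^+ i +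
   \sum_(a < N) taylor f (i.+1 + a)%N 0%N * (w%:C%C) ^+ (i.+1 + a).
  have -> : m = (i.+1 + N)%N by rewrite /m; lia.
  rewrite big_split_ord /= big_ord_recr /= big1 ?add0r //.
  by move=> a _; rewrite IHn ?mul0r // (leq_trans (ltn_ord a)).
set S := \sum_(a < N) _.
have SK : nc S <= K * w ^+ i.+1.
  apply: le_trans (nc_sum _) _.
  apply: le_trans (_ : \sum_(a < N) (M / r ^+ i.+1 * w ^+ i.+1) * (1 / 2) ^+ a <= _).
    apply: ler_sum => a _; rewrite ncM ncX ncw exprD.
    have := fM (i.+1 + a)%N 0%N; rewrite addn0 exprD; set x := nc _ => xM.
    have xp : x * r ^+ a <= M / r ^+ i.+1.
      by rewrite ler_pdivlMr ?exprn_gt0 // -mulrA [r ^+ a * _]mulrC.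
    have wa : w ^+ a <= r ^+ a * (1 / 2) ^+ a.
      by rewrite -exprMn lerXn2r ?nnegrE ?(ltW w0) //; lra.
    have W0 : 0 <= w ^+ i.+1 by rewrite exprn_ge0 // ltW.
    rewrite mulrA; apply: le_trans (ler_wpM2l (mulr_ge0 (nc_ge0 _) W0) wa) _.
    rewrite -/x [X in X <= _](_ : _ = x * r ^+ a * (w ^+ i.+1 * (1 / 2) ^+ a)); last by ring.
    rewrite -[X in _ <= X]mulrA; apply: ler_wpM2r xp.
    by rewrite mulr_ge0 // exprn_ge0 //; lra.
  rewrite -mulr_sumr /K [2 * M]mulrC -!mulrA ler_wpM2l //.
  rewrite [2 * _]mulrC -!mulrA ler_wpM2l ?invr_ge0 ?exprn_ge0 ?(ltW r0) //.
  rewrite ler_wpM2l ?exprn_ge0 ?(ltW w0) //.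
  by apply: le_trans (geom_bound _ _ _) _; lra.
have : c * w ^+ i <= nc (taylor f i 0%N * (w%:C%C) ^+ i + S) + nc S.
  apply: le_trans (ncB _ _); rewrite addrK ncM ncX ncw //.
have W0 : 0 < w ^+ i by rewrite exprn_gt0.
rewrite exprS in SK; set X := nc (_ + _).
by nra.
Qed.

(** The remainder of the division by [t] vanishes on the curve and depends only on [y], which is a
    coordinate there; hence it is zero. *)
Lemma ideal_of_Y : ideal_of (Y R) 0 = [set f : O | exists g, f = t * g].
Proof.
have near_Y f : ideal_of (Y R) 0 f <-> exists2 d : R, 0 < d &
    forall w : C, nc w < d -> vanishes_at f ((w, w ^+ 2) : Z R).
  split.
    move=> /(nbhs_ballP (0 : (C^o * C^o)%type))[e e0 He].
    have eR : (complex.Re e)%:C%C = e by exact/RRe_real/gtr0_real.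
    set e' := complex.Re e in eR; have e'0 : 0 < e' by rewrite -ltcR eR.
    exists (Num.min e' 1); first by rewrite lt_min e'0 ltr01.
    move=> w; rewrite lt_min => /andP[we w1].
    have := He (w, w ^+ 2); rewrite /= subr0; apply=> //.
    split; rewrite /ball /= sub0r normrN normCE -eR ltcR //.
    rewrite ncX expr2; have := nc_ge0 w; nra.
  move=> [d d0 Hd].
  apply/(nbhs_ballP (0 : (C^o * C^o)%type)); exists d%:C%C; first by rewrite /= ltcR.
  move=> [w w'] [/= wd _]; rewrite /Y /= => ->; rewrite subr0; apply: Hd.
  by move: wd; rewrite /ball /= sub0r normrN normCE ltcR.
apply/seteqP; split=> f /=.
  move=> /near_Y[d d0 fd]; exists (quot f); apply/eqP; rewrite -subr_eq0; apply/eqP.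
  have [d' d'0 td] := vanishes_tM (quot f).
  apply: (@identity_principle _ (Num.min d d')); first by rewrite lt_min d0.
    by move=> i j; apply: taylor_rem.
  move=> w; rewrite lt_min => /andP[wd wd'].
  have cv := cvgB (fd w wd) (td w wd'); rewrite subr0 in cv; rewrite /vanishes_at.
  apply: (cvg_trans _ (cv _)); apply: near_eq_cvg; apply: nearW => n.
  pose S h : C := \sum_(i < n) \sum_(j < n)
    taylor h i j * ((w, w ^+ 2) : Z R).1 ^+ i * ((w, w ^+ 2) : Z R).2 ^+ j.
  have SB : S f - S (t * quot f) = S (f - t * quot f).
    rewrite /S -sumrB; apply: eq_bigr => i _; rewrite -sumrB; apply: eq_bigr => j _.
    by rewrite taylorD taylorN !mulrBl.
  exact: SB.
by move=> [g ->]; apply/near_Y/vanishes_tM.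
Qed.

End IdealOfCurve.

(** * Laurent series *)

Section Laurent.
Variable A : comNzRingType.
Implicit Types (F G : fps A) (k l : int).

(* [laurent_fun n F] is the Laurent series [b^-n F]. *)
Definition laurent_fun n F : int -> A :=
  fun k => if (k + n%:Z)%R is Posz j then F j else 0.

Definition laurent_pred : {pred int -> A} :=
  fun m => `[< exists n F, m = laurent_fun n F >].

Record laurent := Laurent { lcoef :> int -> A; lcoefP : lcoef \in laurent_pred }.

HB.instance Definition _ := [isSub for lcoef].
HB.instance Definition _ := [Choice of laurent by <:].

Definition fpsX : fps A := fun n => (n == 1%N)%:R.

Lemma fpsXM F n : (fpsX * F) n = if n is n'.+1 then F n' else 0.
Proof.
rewrite fps_mul_affine // /fpsX /= mul0r add0r; case: n => // n.
by rewrite mul1r.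
Qed.

Lemma laurent_funS n F : laurent_fun n F = laurent_fun n.+1 (fpsX * F).
Proof.
apply/funext => k; rewrite /laurent_fun -addn1 PoszD addrA.
case E : (k + n%:Z) => [j|j]; first by rewrite -PoszD addn1 fpsXM.
(* For [k + n = -1] the new index is 0, where the shifted series has coefficient zero. *)
by case: j E => [|j] E //; rewrite /= fpsXM.
Qed.

Lemma laurent_funD n d F : laurent_fun n F = laurent_fun (n + d) (fpsX ^+ d * F).
Proof.
elim: d => [|d IHd]; first by rewrite addn0 mul1r.
by rewrite IHd laurent_funS addnS exprS mulrA.
Qed.

Lemma laurent_fun_inj n : injective (laurent_fun n).
Proof.
move=> F G /funeqP FG; apply/funext => j; have := FG (j%:Z - n%:Z).
by rewrite /laurent_fun subrK.
Qed.

Lemma laurent_fun_common m m' : m \in laurent_pred -> m' \in laurent_pred ->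
  exists n F F', m = laurent_fun n F /\ m' = laurent_fun n F'.
Proof.
move=> /asboolP[n [F ->]] /asboolP[n' [F' ->]].
exists (n + n')%N, (fpsX ^+ n' * F), (fpsX ^+ n * F').
by rewrite {2}[(n + n')%N]addnC -!laurent_funD.
Qed.

Lemma laurent_funB n F F' : laurent_fun n (F - F') = laurent_fun n F - laurent_fun n F'.
Proof.
apply/funext => k; rewrite [RHS]/(laurent_fun n F k - laurent_fun n F' k) /laurent_fun.
by case: (k + n%:Z) => // j; apply/esym/(subr0 0).
Qed.

Fact laurent_zmod : zmod_closed laurent_pred.
Proof.
split=> [|m m' Lm Lm']; apply/asboolP.
  exists 0%N, 0; apply/funext => k; rewrite /laurent_fun; by case: (k + _).
have [n [F [F' [-> ->]]]] := laurent_fun_common Lm Lm'.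
by exists n, (F - F'); rewrite laurent_funB.
Qed.
HB.instance Definition _ := GRing.isZmodClosed.Build (int -> A) laurent_pred laurent_zmod.
HB.instance Definition _ := [SubChoice_isSubZmodule of laurent by <:].

Fact mk_subproof n F : laurent_fun n F \in laurent_pred.
Proof. by apply/asboolP; exists n, F. Qed.

Definition mk n F : laurent := Laurent (mk_subproof n F).

Lemma laurent_ext (m m' : laurent) : (forall k, m k = m' k) -> m = m'.
Proof. by move=> mm; apply/val_inj/funext. Qed.

Lemma mk_shift n d F : mk n F = mk (n + d) (fpsX ^+ d * F).
Proof. by apply/val_inj; apply: laurent_funD. Qed.

Lemma mk_inj n : injective (mk n).
Proof. by move=> F G /(congr1 lcoef) /laurent_fun_inj. Qed.

Lemma mk_ex (m : laurent) : exists p : nat * fps A, m = mk p.1 p.2.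
Proof. by have /asboolP[n [F E]] := lcoefP m; exists (n, F); apply/val_inj. Qed.

Lemma mk_exN (m : laurent) N : exists n F, (N <= n)%N /\ m = mk n F.
Proof.
have [[n F] ->] := mk_ex m; exists (n + N)%N, (fpsX ^+ N * F).
by rewrite leq_addl -mk_shift.
Qed.

Lemma mk_ex2 (m m' : laurent) : exists n F F', m = mk n F /\ m' = mk n F'.
Proof.
have [n [F [F' [E E']]]] := laurent_fun_common (lcoefP m) (lcoefP m').
by exists n, F, F'; split; apply/val_inj.
Qed.

Lemma mkD n F G : mk n F + mk n G = mk n (F + G).
Proof.
apply/val_inj; rewrite -[RHS]/(laurent_fun n (F + G)) -[G]opprK laurent_funB.
rewrite -[LHS]/(laurent_fun n F + laurent_fun n (- - G)); congr (_ + _).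
by rewrite -[- - G]sub0r laurent_funB [laurent_fun n 0](_ : _ = 0) ?sub0r //; apply/funext => k;
  rewrite /laurent_fun; case: (k + _).
Qed.

Definition lrep (m : laurent) := projT1 (cid (mk_ex m)).
Lemma lrepE m : m = mk (lrep m).1 (lrep m).2.
Proof. exact: projT2 (cid (mk_ex m)). Qed.

Definition lmul (m m' : laurent) : laurent :=
  mk ((lrep m).1 + (lrep m').1) ((lrep m).2 * (lrep m').2).

Lemma mk_eq n F n' F' : mk n F = mk n' F' -> fpsX ^+ n' * F = fpsX ^+ n * F'.
Proof.
rewrite (mk_shift n n') (mk_shift n' n) [(n' + n)%N]addnC; exact: mk_inj.
Qed.

Lemma lmulE n F n' F' : lmul (mk n F) (mk n' F') = mk (n + n') (F * F').
Proof.
rewrite /lmul; set p := lrep _; set p' := lrep _.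
have /mk_eq E : mk n F = mk p.1 p.2 := lrepE _.
have /mk_eq E' : mk n' F' = mk p'.1 p'.2 := lrepE _.
rewrite (mk_shift (p.1 + p'.1) (n + n')) (mk_shift (n + n') (p.1 + p'.1)).
rewrite [X in mk X _]addnC; congr mk; rewrite !exprD.
by rewrite mulrACA -E -E' mulrACA.
Qed.

Definition lone := mk 0 1.

Fact lmulA : associative lmul.
Proof.
move=> m m' m''; have [[n F] ->] := mk_ex m; have [[n' F'] ->] := mk_ex m'.
by have [[n'' F''] ->] := mk_ex m''; rewrite !lmulE addnA mulrA.
Qed.

Fact lmulC : commutative lmul.
Proof.
move=> m m'; have [[n F] ->] := mk_ex m; have [[n' F'] ->] := mk_ex m'.
by rewrite !lmulE addnC mulrC.
Qed.

Fact lmul1 : left_id lone lmul.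
Proof. by move=> m; have [[n F] ->] := mk_ex m; rewrite lmulE mul1r. Qed.

Fact lmulDl : left_distributive lmul +%R.
Proof.
move=> m m' m''; have [n [F [F' [-> ->]]]] := mk_ex2 m m'.
by have [[n'' F''] ->] := mk_ex m''; rewrite mkD !lmulE mkD mulrDl.
Qed.

Fact lone_neq0 : lone != 0.
Proof.
apply/eqP => /(congr1 (fun m : laurent => m 0)).
rewrite [LHS]/(1%R : A) [RHS]/(0%R : A); apply/eqP; exact: oner_neq0.
Qed.

HB.instance Definition _ := GRing.Zmodule_isComNzRing.Build laurent
  lmulA lmulC lmul1 lmulDl lone_neq0.

Lemma mkM n F n' F' : mk n F * mk n' F' = mk (n + n') (F * F').
Proof. exact: lmulE. Qed.

Definition liota : fps A -> laurent := mk 0.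

Lemma liotaD F G : liota (F + G) = liota F + liota G. Proof. by rewrite mkD. Qed.
Lemma liotaM F G : liota (F * G) = liota F * liota G. Proof. by rewrite mkM. Qed.
Definition lb := liota fpsX.
Definition lb' := mk 1 1.

Lemma lbb' : lb * lb' = 1.
Proof. by rewrite mkM mulr1 -[1]/(mk 0 1) (mk_shift 0 1) mulr1 expr1. Qed.

Definition vge k (m : laurent) := forall j, j < k -> m j = 0.

Lemma lcoefD (m m' : laurent) k : (m + m') k = m k + m' k. Proof. by []. Qed.
Lemma lcoefN (m : laurent) k : (- m) k = - m k. Proof. by []. Qed.

Lemma vgeD k m m' : vge k m -> vge k m' -> vge k (m + m').
Proof. by move=> vm vm' j lt_jk; rewrite lcoefD vm ?vm' ?addr0. Qed.

Lemma vgeN k m : vge k m -> vge k (- m).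
Proof. by move=> vm j lt_jk; rewrite lcoefN vm ?oppr0. Qed.

Lemma vgeW k l m : (l <= k)%R -> vge k m -> vge l m.
Proof. by move=> le_lk vm j lt_jl; apply: vm; apply: lt_le_trans le_lk. Qed.

Lemma vge0 k : vge k 0. Proof. by []. Qed.

Lemma vge_liota F : vge 0 (liota F).
Proof. by case=> // n _. Qed.

Lemma vge_ex m : exists k, vge k m.
Proof.
have [[n F] ->] := mk_ex m; exists (- n%:Z) => j lt_j /=.
by rewrite /laurent_fun; case E : (j + n%:Z) => [i|//]; lia.
Qed.

Lemma vgeM_lead k l m m' : vge k m -> vge l m' ->
  vge (k + l) (m * m') /\ (m * m') (k + l) = m k * m' l.
Proof.
move=> vm vm'.
have [n [F [le_n mE]]] := mk_exN m `|k|; have [n' [F' [le_n' mE']]] := mk_exN m' `|l|.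
have [K KE] : exists K : nat, k + n%:Z = K%:Z by exists (absz (k + n%:Z)%R); lia.
have [L LE] : exists L : nat, l + n'%:Z = L%:Z by exists (absz (l + n'%:Z)%R); lia.
have F0 i : (i < K)%N -> F i = 0.
  move=> lt_i; have := vm (i%:Z - n%:Z) ltac:(lia).
  by rewrite mE /= /laurent_fun subrK.
have F'0 i : (i < L)%N -> F' i = 0.
  move=> lt_i; have := vm' (i%:Z - n'%:Z) ltac:(lia).
  by rewrite mE' /= /laurent_fun subrK.
have mk_k : m k = F K by rewrite mE /= /laurent_fun KE.
have mk_l : m' l = F' L by rewrite mE' /= /laurent_fun LE.
have coef j : (m * m') j = laurent_fun (n + n') (F * F') j by rewrite mE mE' mkM.
split=> [j lt_j|].
  rewrite coef /laurent_fun; case E : (j + _) => [i|//].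
  rewrite fps_mulE big1 // => a _; have lt_ai := ltn_ord a.
  have [lt_a|le_a] := ltnP a K; first by rewrite F0 ?mul0r.
  by rewrite F'0 ?mulr0 //; lia.
rewrite coef /laurent_fun; have -> : k + l + (n + n')%N%:Z = (K + L)%N%:Z by lia.
have ltK : (K < (K + L).+1)%N by lia.
rewrite fps_mulE (bigD1 (Ordinal ltK)) //= addKn mk_k mk_l big1 ?addr0 // => a.
rewrite -val_eqE /= => aK; have lt_ai := ltn_ord a; have [lt_a|le_a] := ltnP a K; first by rewrite F0 ?mul0r.
by rewrite F'0 ?mulr0 //; lia.
Qed.

Lemma vgeM k l m m' : vge k m -> vge l m' -> vge (k + l) (m * m').
Proof. by move=> vm /(vgeM_lead vm)[]. Qed.

Section CoefDerivation.
Variable d : A -> A.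
Hypothesis dD : forall x y, d (x + y) = d x + d y.
Hypothesis dM : forall x y, d (x * y) = d x * y + x * d y.

Let d0 : d 0 = 0. Proof. by apply: (addrI (d 0)); rewrite -dD !addr0. Qed.

Definition fps_map F : fps A := fun n => d (F n).

Lemma fps_mapM F G : fps_map (F * G) = fps_map F * G + F * fps_map G.
Proof.
apply/funext => n.
change (fps_map (F * G) n = (fps_map F * G) n + (F * fps_map G) n).
rewrite !fps_mulE -big_split /fps_map fps_mulE (big_morph d dD d0); apply: eq_bigr => i _.
exact: dM.
Qed.

Lemma laurent_fun_map n F : (fun k => d (laurent_fun n F k)) = laurent_fun n (fps_map F).
Proof. by apply/funext => k; rewrite /laurent_fun; case: (k + _). Qed.

Fact lmap_subproof (m : laurent) : (fun k => d (m k)) \in laurent_pred.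
Proof.
by have [[n F] ->] := mk_ex m; apply/asboolP; exists n, (fps_map F); apply: laurent_fun_map.
Qed.

Definition lmap (m : laurent) : laurent := Laurent (lmap_subproof m).

Lemma lmap_mk n F : lmap (mk n F) = mk n (fps_map F).
Proof. by apply/val_inj; apply: laurent_fun_map. Qed.

Lemma lmapD m m' : lmap (m + m') = lmap m + lmap m'.
Proof. by apply: laurent_ext => k; rewrite lcoefD /= dD. Qed.

Lemma lmapM m m' : lmap (m * m') = lmap m * m' + m * lmap m'.
Proof.
have [[n F] ->] := mk_ex m; have [[n' F'] ->] := mk_ex m'.
by rewrite mkM !lmap_mk !mkM mkD fps_mapM.
Qed.

End CoefDerivation.

(* [b d/db] *)
Definition fps_euler F : fps A := fun n => F n *+ n.

Lemma fps_eulerM F G : fps_euler (F * G) = fps_euler F * G + F * fps_euler G.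
Proof.
apply/funext => n.
change (fps_euler (F * G) n = (fps_euler F * G) n + (F * fps_euler G) n).
rewrite !fps_mulE -big_split /fps_euler fps_mulE -sumrMnl; apply: eq_bigr => i _ /=.
by rewrite mulrnAl mulrnAr -mulrnDr subnKC // -ltnS.
Qed.

Lemma laurent_fun_euler n F : (fun k => laurent_fun n F k *~ k) =
  laurent_fun n (fps_euler F - F *+ n).
Proof.
apply/funext => k; rewrite /laurent_fun; case E : (k + _) => [j|j]; last by rewrite mul0rz.
have -> : k = j%:Z - n%:Z by rewrite -E addrK.
by rewrite mulrzBr -!pmulrn -[RHS]/(fps_euler F j - (F *+ n) j) fps_mulnE.
Qed.

Fact leuler_subproof (m : laurent) : (fun k => m k *~ k) \in laurent_pred.
Proof.
have [[n F] ->] := mk_ex m; apply/asboolP; exists n, (fps_euler F - F *+ n).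
exact: laurent_fun_euler.
Qed.

Definition leuler (m : laurent) : laurent := Laurent (leuler_subproof m).

Lemma leuler_mk n F : leuler (mk n F) = mk n (fps_euler F - F *+ n).
Proof. by apply/val_inj; apply: laurent_fun_euler. Qed.

Lemma leulerD m m' : leuler (m + m') = leuler m + leuler m'.
Proof. by apply: laurent_ext => k; rewrite lcoefD /= mulrzDl. Qed.

Lemma leulerM m m' : leuler (m * m') = leuler m * m' + m * leuler m'.
Proof.
have [[n F] ->] := mk_ex m; have [[n' F'] ->] := mk_ex m'.
by rewrite mkM !leuler_mk !mkM mkD fps_eulerM; congr mk; rewrite /= mulrnDr; ring.
Qed.

End Laurent.

(** * Substitution into formal power series and the chain rule *)

Section Substitution.
Variables (A : comNzRingType).
Local Notation B := (fps A).
Implicit Types (u w : B).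

Definition agree n u w := forall i, (i <= n)%N -> u i = w i.

Lemma agreeM n u u' w w' : agree n u u' -> agree n w w' -> agree n (u * w) (u' * w').
Proof.
move=> uu ww i le_in; rewrite !fps_mulE; apply: eq_bigr => j _.
have lt_j := ltn_ord j; rewrite uu ?ww //; lia.
Qed.

Lemma fps_ord_exp (x : B) i n : x 0%N = 0 -> (n < i)%N -> (x ^+ i) n = 0.
Proof.
move=> x0; elim: i n => // i IHi n lt_n; rewrite exprS fps_mulE big1 // => j _.
have lt_j := ltn_ord j; case: (posnP j) => [->|j0]; first by rewrite x0 mul0r.
by rewrite IHi ?mulr0 //; lia.
Qed.

Lemma fps_ordM_exp (x u : B) i n : x 0%N = 0 -> (n < i)%N -> (u * x ^+ i) n = 0.
Proof.
move=> x0 lt_n; rewrite fps_mulE big1 // => j _.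
by rewrite fps_ord_exp ?mulr0 //; have := ltn_ord j; lia.
Qed.

Variables (K : comNzRingType) (x : B).
Hypothesis x0 : x 0%N = 0.

(** As [x] has no constant term, [x^i] starts in degree [i] and coefficient [n] only involves the
    terms with [i <= n]; [substE] permits any longer truncation. The map [h] on coefficients allows
    the nesting needed for two variables. *)
Definition subst (h : K -> B) (F : fps K) : B :=
  fun n => (\sum_(i < n.+1) h (F i) * x ^+ i) n.

Lemma substE h F n N : (n <= N)%N -> subst h F n = (\sum_(i < N.+1) h (F i) * x ^+ i) n.
Proof.
move=> le_n; rewrite -(subnKC le_n) -addSn big_split_ord /=.
rewrite -[RHS]/((\sum_(i < n.+1) h (F i) * x ^+ i) n + _) [X in _ + X](_ : _ = 0) ?addr0 //.
by rewrite fps_sumE big1 // => i _; apply: fps_ordM_exp => //; lia.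
Qed.

Lemma subst_agree h F N : agree N (subst h F) (\sum_(i < N.+1) h (F i) * x ^+ i).
Proof. by move=> i le_i; apply: substE. Qed.

Section Morphism.
Variable h : {rmorphism K -> B}.

Lemma subst_poly (F : fps K) N : \sum_(i < N.+1) h (F i) * x ^+ i = (map_poly h (fps_poly N F)).[x].
Proof.
have -> : map_poly h (fps_poly N F) = \poly_(i < N.+1) h (F i).
  apply/polyP => i; rewrite coef_map !coef_poly; case: ifP => // _; exact: rmorph0.
by rewrite horner_poly.
Qed.

(** Up to degree [n] both sides are values at [x] of truncations, and [P - Q * S] has no coefficient
    of index at most [n]. *)
Lemma substM F G : subst h (F * G) = subst h F * subst h G.
Proof.
apply/funext => n.
rewrite (agreeM (subst_agree h F (N := n)) (subst_agree h G (N := n))) //.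
rewrite !subst_poly (substE _ _ (leqnn n)) subst_poly.
set P := fps_poly n (F * G); set Q := fps_poly n F; set S := fps_poly n G.
have PQ : (map_poly h P).[x] n - ((map_poly h Q).[x] * (map_poly h S).[x]) n =
    (map_poly h (P - Q * S)).[x] n.
  by rewrite rmorphB rmorphM hornerD hornerN hornerM.
apply/eqP; rewrite -subr_eq0 PQ; apply/eqP.
rewrite horner_coef fps_sumE big1 // => i _; rewrite coef_map.
have [le_in|lt_ni] := leqP i n; last exact: fps_ordM_exp.
have E0 : (P - Q * S)`_i = 0; last by rewrite E0 /= rmorph0 mul0r.
rewrite coefB coef_fps_poly // (@coefM_fps _ F G) ?subrr //.
  by move=> j le_j; apply: coef_fps_poly; apply: leq_trans le_in.
by move=> j le_j; apply: coef_fps_poly; apply: leq_trans le_in.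
Qed.

Lemma substD F G : subst h (F + G) = subst h F + subst h G.
Proof.
apply/funext => n; rewrite -[RHS]/(subst h F n + subst h G n) /subst.
rewrite -[RHS]/((_ + _) n) -big_split /=; congr (_ n); apply: eq_bigr => i _.
change (h (F i + G i) * x ^+ i = h (F i) * x ^+ i + h (G i) * x ^+ i).
by rewrite rmorphD mulrDl.
Qed.

Lemma subst1 : subst h 1 = 1.
Proof.
apply/funext => n; rewrite /subst big_ord_recl big1 ?addr0 => [|i _].
  by rewrite -[X in h X]/(1 : K) rmorph1 mul1r.
by rewrite -[X in h X]/(0 : K) rmorph0 mul0r.
Qed.

End Morphism.

(* Chain rule, for the derivations that do not lower the order in [b]. *)
Lemma subst_deriv (h : {rmorphism K -> B}) (D : B -> B) F :
  (forall u w, D (u + w) = D u + D w) ->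
  (forall u w, D (u * w) = D u * w + u * D w) ->
  (forall n u w, agree n u w -> agree n (D u) (D w)) ->
  D (subst h F) = subst (D \o h) F + subst h (fps_deriv F) * D x.
Proof.
move=> DD DM Dagree; apply/funext => n.
have D0 : D 0 = 0 by apply: (addrI (D 0)); rewrite -DD !addr0.
have D1 : D 1 = 0.
  by have := DM 1 1; rewrite !mulr1 mul1r -[X in X = _]addr0 => /addrI <-.
have DX i : D (x ^+ i.+1) = (x ^+ i * D x) *+ i.+1.
  elim: i => [|i IHi]; first by rewrite expr1 expr0 mul1r.
  by rewrite exprS DM IHi [RHS]mulrS [x ^+ i.+1]exprS mulrC [in LHS]mulrnAr mulrA.
rewrite (Dagree n _ _ (fun i le_i => substE _ _ (leqW le_i))) //.
rewrite (big_morph D DD D0) (eq_bigr (fun i : 'I_n.+2 => D (h (F i)) * x ^+ i + h (F i) * D (x ^+ i))).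
  rewrite big_split -[RHS]/(subst (D \o h) F n + (subst h (fps_deriv F) * D x) n).
  rewrite -[LHS]/(_ n + _ n); congr (_ + _).
    by rewrite (substE _ _ (leqnSn n)).
  have -> : \sum_(i < n.+2) h (F i) * D (x ^+ i) =
      \sum_(i < n.+1) h (F i.+1) * D (x ^+ i.+1).
    by rewrite big_ord_recl /= expr0 D1 mulr0 add0r.
  rewrite (agreeM (subst_agree h (fps_deriv F) (N := n)) (fun i _ => erefl (D x i))) //.
  rewrite mulr_suml; congr (_ n); apply: eq_bigr => i _.
  by rewrite DX /fps_deriv rmorphMn /= mulrnAr !mulrnAl mulrA.
by move=> i _; rewrite DM.
Qed.

End Substitution.

(** * The saddle point module *)

Section SaddleModule.
Variable R : realType.
Local Notation C := R[i].
Local Notation O := (germ R).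
Local Notation A := {poly C}.
Local Notation B := (fps A).
Local Notation L := (laurent A).
Local Notation y := (ycoord (0 : Z R)).
Local Notation s := (scoord (0 : Z R)).
Implicit Types (f g : O) (m : L).

Definition fps_const (a : A) : B := fun n => if n is 0%N then a else 0.

Lemma fps_const_zmod : zmod_morphism fps_const.
Proof.
move=> a b; apply/funext => -[//|n]; symmetry; exact: (subr0 (0 : A)).
Qed.

Lemma fps_const_monoid : monoid_morphism fps_const.
Proof.
split=> [|a b]; apply/funext => -[|n] //; rewrite fps_mul_affine //= ?addr0 //.
by rewrite mul0r mulr0 addr0.
Qed.

Definition coefB (c : C) : B := fps_const c%:P.

Lemma coefB_zmod : zmod_morphism coefB.
Proof. by move=> a b; rewrite /coefB polyCB fps_const_zmod. Qed.
Lemma coefB_monoid : monoid_morphism coefB.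
Proof.
split=> [|a b]; first by rewrite /coefB fps_const_monoid.1.
by rewrite /coefB polyCM fps_const_monoid.2.
Qed.
HB.instance Definition _ := GRing.isZmodMorphism.Build C B coefB coefB_zmod.
HB.instance Definition _ := GRing.isMonoidMorphism.Build C B coefB coefB_monoid.

(* The curve [y = b^2 (1 + b xi)], [s = 2 b^4]: near [xi = 0] it follows the
   critical points [s = 2 y^2] of the restriction of [y / s] to the curves
   [s - y^2 = const]. *)
Local Notation X := (fpsX A).
Local Notation xi := (fps_const 'X).
Definition yB : B := X ^+ 2 + X ^+ 3 * xi.
Definition sB : B := X ^+ 4 *+ 2.

Lemma X0 : X 0%N = 0. Proof. by []. Qed.
Lemma yB0 : yB 0%N = 0.
Proof.
rewrite -[LHS]/((X ^+ 2) 0%N + (X ^+ 3 * xi) 0%N) !exprS -!mulrA !fpsXM.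
exact: addr0.
Qed.
Lemma sB0 : sB 0%N = 0.
Proof. by rewrite /sB fps_mulnE exprS fpsXM mul0rn. Qed.

Definition phi1 : fps C -> B := subst sB coefB.

Lemma substB (K : comNzRingType) (x : B) (h : {rmorphism K -> B}) : zmod_morphism (subst x h).
Proof.
move=> F G; apply: (addIr (subst x h G)).
by rewrite -substD subrK subrK.
Qed.

Lemma phi1_zmod : zmod_morphism phi1. Proof. exact: substB. Qed.
Lemma phi1_monoid : monoid_morphism phi1.
Proof. by split; [exact: subst1 | exact: (substM sB0)]. Qed.
HB.instance Definition _ := GRing.isZmodMorphism.Build (fps C) B phi1 phi1_zmod.
HB.instance Definition _ := GRing.isMonoidMorphism.Build (fps C) B phi1 phi1_monoid.

Definition phi : fps (fps C) -> B := subst yB phi1.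

Lemma subst_affine (K : comNzRingType) (x : B) (h : {rmorphism K -> B}) (F : fps K) :
  x 0%N = 0 -> (forall k, F k.+2 = 0) -> subst x h F = h (F 0%N) + h (F 1%N) * x.
Proof.
move=> x0 F0; apply/funext => n; rewrite (substE x0 h F (leqnSn n)).
rewrite 2!big_ord_recl /= expr0 mulr1 expr1 big1 ?addr0 // => i _.
by rewrite F0 rmorph0 mul0r.
Qed.

Definition toL f : L := liota (phi (taylor f)).
Local Notation lb := (lb A).
Local Notation lb' := (lb' A).
Local Notation lxi := (liota xi).
Definition lc (c : C) : L := liota (coefB c).

Lemma toLM f g : toL (f * g) = toL f * toL g.
Proof. by rewrite /toL /phi [taylor _]/(taylor f * taylor g) (substM yB0) liotaM. Qed.
Lemma toLD f g : toL (f + g) = toL f + toL g.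
Proof. by rewrite /toL /phi [taylor _]/(taylor f + taylor g) substD liotaD. Qed.
Lemma toL1 : toL 1 = 1.
Proof. by rewrite /toL /phi [taylor _]/(1) subst1. Qed.

Lemma liotaMn (F : B) n : liota (F *+ n) = liota F *+ n.
Proof.
elim: n => [|n IHn]; last by rewrite !mulrS liotaD IHn.
by rewrite !mulr0n; apply: laurent_ext => k; rewrite /= /laurent_fun; case: (k + _).
Qed.

Lemma liotaX (F : B) n : liota (F ^+ n) = liota F ^+ n.
Proof. by elim: n => [|n IHn]; rewrite ?expr0 // !exprS liotaM IHn. Qed.

Lemma toL_y : toL y = lb ^+ 2 + lb ^+ 3 * lxi.
Proof.
rewrite /toL /phi (@subst_affine _ _ _ _ yB0) => [|k]; last by apply/funext => -[].
have -> : taylor y 0%N = 0 by apply/funext => -[|[|j]].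
have -> : taylor y 1%N = 1 by apply/funext => -[|j].
by rewrite rmorph0 rmorph1 add0r mul1r /yB liotaD liotaX (liotaM (X ^+ 3)) liotaX.
Qed.

Lemma toL_s : toL s = lb ^+ 4 *+ 2.
Proof.
rewrite /toL /phi (@subst_affine _ _ _ _ yB0) => [|k]; last by apply/funext => -[].
have -> : taylor s 1%N = 0 by apply/funext => -[|[|j]].
rewrite rmorph0 mul0r addr0 /= /phi1 (@subst_affine _ _ _ _ sB0) //.
by rewrite rmorph0 rmorph1 add0r mul1r /sB liotaMn liotaX.
Qed.

Definition dxi : L -> L := lmap (d := @deriv C) (@derivD C).
Definition db : L -> L := @leuler A.

Lemma dxiD m m' : dxi (m + m') = dxi m + dxi m'.
Proof. exact: (lmapD (@derivD C)). Qed.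
Lemma dxiM m m' : dxi (m * m') = dxi m * m' + m * dxi m'.
Proof. exact: (lmapM (@derivD C) (@derivM C)). Qed.
Lemma dbD m m' : db (m + m') = db m + db m'. Proof. exact: leulerD. Qed.
Lemma dbM m m' : db (m * m') = db m * m' + m * db m'. Proof. exact: leulerM. Qed.

Lemma dxi_db m : dxi (db m) = db (dxi m).
Proof.
apply: laurent_ext => k /=; case: k => n; rewrite ?NegzE ?mulrNz -!pmulrn.
  by rewrite derivMn.
by rewrite derivN derivMn.
Qed.

Lemma dxi_lb' : dxi lb' = 0.
Proof.
apply: laurent_ext => k; rewrite /= /laurent_fun; case: (k + _) => [[|n]|n] //=;
  rewrite ?derivC ?deriv0 //.
Qed.
Lemma db_lb' : db lb' = - lb'.
Proof.
rewrite /db leuler_mk; apply: laurent_ext => k.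
rewrite lcoefN /= /laurent_fun; case: (k + _) => [[|n]|n] //=; rewrite ?oppr0 //.
- by rewrite -[LHS]/(0 - 1) sub0r.
by rewrite -[LHS]/(0 *+ n.+1 - 0) mul0rn subrr.
Qed.
Lemma dxi_lxi : dxi lxi = 1.
Proof.
apply: laurent_ext => k; rewrite /= /laurent_fun; case: (k + _) => [[|n]|n] //=;
  rewrite ?derivX ?deriv0 //.
Qed.
Lemma db_liota (F : B) : db (liota F) = liota (fps_euler F).
Proof. by rewrite /db /liota leuler_mk mulr0n subr0. Qed.
Lemma dxi_liota (F : B) : dxi (liota F) = liota (fps_map (@deriv C) F).
Proof. exact: lmap_mk. Qed.

Lemma liota0 : liota (0 : B) = 0.
Proof. by rewrite -(mulr0n 0) liotaMn mulr0n. Qed.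

Lemma db_const a : db (liota (fps_const a)) = 0.
Proof.
rewrite db_liota -liota0; congr liota; apply/funext => -[|n]; rewrite /fps_euler ?mulr0n //.
exact: mul0rn.
Qed.
Lemma dxi_lc c : dxi (lc c) = 0.
Proof.
rewrite /lc dxi_liota -liota0; congr liota; apply/funext => -[|n];
  rewrite /fps_map /= ?derivC ?deriv0 //.
Qed.

Lemma dxi_1 : dxi 1 = 0.
Proof. by have := dxiM 1 1; rewrite !mulr1 mul1r -[X in X = _]addr0 => /addrI <-. Qed.
Lemma db_1 : db 1 = 0.
Proof. by have := dbM 1 1; rewrite !mulr1 mul1r -[X in X = _]addr0 => /addrI <-. Qed.

Lemma lb'b : lb' * lb = 1. Proof. by rewrite mulrC; apply: lbb'. Qed.

Lemma dxi_lb : dxi lb = 0.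
Proof.
have : dxi (lb' * lb) = 0 by rewrite lb'b dxi_1.
rewrite dxiM dxi_lb' mul0r add0r => /(congr1 ( *%R lb)).
by rewrite mulr0 mulrA lbb' mul1r.
Qed.
Lemma db_lb : db lb = lb.
Proof.
have : db (lb' * lb) = 0 by rewrite lb'b db_1.
rewrite dbM db_lb' mulNr lb'b addrC => /eqP; rewrite subr_eq0 => /eqP.
by move=> /(congr1 ( *%R lb)); rewrite mulrA lbb' mul1r mulr1.
Qed.

Lemma dxi_yL : dxi (toL y) = lb ^+ 3.
Proof.
rewrite toL_y !exprS expr0 !(dxiD, dxiM) dxi_lb dxi_lxi dxi_1; ring.
Qed.
Lemma db_yL : db (toL y) = lb ^+ 2 *+ 2 + lb ^+ 3 * lxi *+ 3.
Proof.
rewrite toL_y !exprS expr0 !(dbD, dbM) db_lb db_const db_1; ring.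
Qed.
Lemma dxi_sL : dxi (toL s) = 0.
Proof.
rewrite toL_s mulr2n !exprS expr0 !(dxiD, dxiM) dxi_lb dxi_1; ring.
Qed.
Lemma db_sL : db (toL s) = toL s *+ 4.
Proof.
rewrite toL_s !mulr2n !exprS expr0 !(dbD, dbM) db_lb db_1; ring.
Qed.

(** The chain rule used twice, once for each of the nested substitutions [phi] and [phi1]. *)
Lemma toL_deriv (D : B -> B) (DL : L -> L) f :
  (forall u w, D (u + w) = D u + D w) ->
  (forall u w, D (u * w) = D u * w + u * D w) ->
  (forall n u w, agree n u w -> agree n (D u) (D w)) ->
  (forall c, D (coefB c) = 0) -> (forall F, DL (liota F) = liota (D F)) ->
  DL (toL f) = toL (Ds f) * DL (toL s) + toL (Dy f) * DL (toL y).
Proof.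
move=> DD DM Dagree Dc DLE.
have yE : phi (taylor y) = yB.
  apply: (@mk_inj A 0); change (toL y = liota yB); rewrite toL_y /yB liotaD.
  by rewrite liotaX (liotaM (X ^+ 3)) liotaX.
have sE : phi (taylor s) = sB.
  apply: (@mk_inj A 0); change (toL s = liota sB); rewrite toL_s /sB.
  by rewrite liotaMn !liotaX.
rewrite /toL !DLE -!liotaM -liotaD; congr liota; rewrite yE sE.
rewrite /phi (subst_deriv yB0 phi1 (taylor f) DD DM Dagree); congr (_ + _ * _); last first.
  congr subst; apply/funext => i; apply/funext => j.
  by rewrite /fps_deriv fps_mulnE.
have D1E (g : fps C) : D (phi1 g) = phi1 (fps_deriv g) * D sB.
  rewrite /phi1 (subst_deriv sB0 coefB g DD DM Dagree).
  rewrite (_ : subst sB (D \o coefB) g = 0) ?add0r //.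
  apply/funext => n; rewrite /subst big1 // => i _; by rewrite /= Dc mul0r.
apply/funext => n.
rewrite (agreeM (subst_agree yB0 phi1 (taylor (Ds f)) (N := n)) (fun i _ => erefl (D sB i))) //.
rewrite /subst mulr_suml; congr (_ n); apply: eq_bigr => i _ /=.
by rewrite D1E mulrAC.
Qed.

Lemma dxi_toL f : dxi (toL f) = toL (Dy f) * lb ^+ 3.
Proof.
rewrite (@toL_deriv (fps_map (@deriv C)) dxi) ?dxi_sL ?dxi_yL ?mulr0 ?add0r //.
- by move=> u w; apply/funext => n; apply: derivD.
- exact: (fps_mapM (@derivD C) (@derivM C)).
- by move=> n u w uw i le_i; rewrite /fps_map uw.
- by move=> c; apply/funext => -[|n]; rewrite /fps_map /= ?derivC ?deriv0.
exact: dxi_liota.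
Qed.

Lemma db_toL f : db (toL f) = toL (Ds f) * (toL s *+ 4) +
  toL (Dy f) * (lb ^+ 2 *+ 2 + lb ^+ 3 * lxi *+ 3).
Proof.
rewrite (@toL_deriv (@fps_euler A) db) ?db_sL ?db_yL //.
- by move=> u w; apply/funext => n; apply: mulrnDl.
- exact: fps_eulerM.
- by move=> n u w uw i le_i; rewrite /fps_euler uw.
- by move=> c; apply/funext => -[|n]; rewrite /fps_euler ?mulr0n //; apply: mul0rn.
exact: db_liota.
Qed.

Definition q2 : L := lc (2%:R^-1).
Definition q4 : L := q2 ^+ 2.

Lemma q2E : q2 *+ 2 = 1.
Proof.
rewrite -liotaMn -rmorphMn /= -mulr_natr mulVf ?rmorph1 // pnatr_eq0 //.
Qed.
Lemma q4E : q4 *+ 4 = 1.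
Proof.
have -> : q4 *+ 4 = (q2 *+ 2) ^+ 2 by rewrite /q4; ring.
by rewrite q2E expr1n.
Qed.

Definition sinv : L := q2 * lb' ^+ 4.

Lemma sinvE : sinv * toL s = 1.
Proof.
rewrite toL_s /sinv; transitivity ((q2 *+ 2) * (lb' * lb) ^+ 4); first by ring.
by rewrite q2E lb'b expr1n mulr1.
Qed.

(** At constant [xi], [b d/db] sends [s] to [4 s] and [y] to [2 b^2 + 3 b^3 xi = b^3 wL]. Hence
    [b d/db = 4 s d/ds + b^3 wL d/dy], which is solved for [s d/ds] in [Es]. *)
Definition wL : L := lb' *+ 2 + lxi *+ 3.
(* [Py] is [d/dy] and [Es] is [s d/ds]. *)
Definition Py m : L := lb' ^+ 3 * dxi m.
Definition Es m : L := q4 * (db m - wL * dxi m).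

Lemma PyD m m' : Py (m + m') = Py m + Py m'.
Proof. by rewrite /Py dxiD mulrDr. Qed.
Lemma PyM m m' : Py (m * m') = Py m * m' + m * Py m'.
Proof. by rewrite /Py dxiM; ring. Qed.
Lemma EsD m m' : Es (m + m') = Es m + Es m'.
Proof. by rewrite /Es dbD dxiD; ring. Qed.
Lemma EsM m m' : Es (m * m') = Es m * m' + m * Es m'.
Proof. by rewrite /Es dbM dxiM; ring. Qed.

Lemma Py_toL f : Py (toL f) = toL (Dy f).
Proof.
rewrite /Py dxi_toL; transitivity (toL (Dy f) * (lb' * lb) ^+ 3); first by ring.
by rewrite lb'b expr1n mulr1.
Qed.

Lemma Es_toL f : Es (toL f) = toL (Ds f) * toL s.
Proof.
rewrite /Es db_toL dxi_toL /wL.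
transitivity (toL (Ds f) * toL s * (q4 *+ 4) +
  q4 * toL (Dy f) * (lb ^+ 2 *+ 2) * (1 - lb' * lb)); first by ring.
by rewrite lb'b subrr mulr0 addr0 q4E mulr1.
Qed.

Lemma Py_sinv : Py sinv = 0.
Proof.
have : Py (sinv * toL s) = 0 by rewrite sinvE /Py dxi_1 mulr0.
rewrite PyM Py_toL Dy_scoord.
have -> : toL 0 = 0 by apply: (addrI (toL 0)); rewrite -toLD !addr0.
by rewrite mulr0 addr0 => /(congr1 ( *%R sinv)); rewrite mulr0 mulrCA sinvE mulr1.
Qed.

Lemma Es_sinv : Es sinv = - sinv.
Proof.
have : Es (sinv * toL s) = 0 by rewrite sinvE /Es dxi_1 db_1 mulr0 subrr mulr0.
rewrite EsM Es_toL Ds_scoord toL1 mul1r => /(congr1 ( *%R sinv)).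
rewrite mulr0 mulrDr mulrCA sinvE !mulr1 => /eqP.
by rewrite addr_eq0 => /eqP.
Qed.

Lemma Py_Es m : Py (Es m) = Es (Py m).
Proof.
have dq c : dxi (lc c) = 0 := dxi_lc c.
have dq2 : db q2 = 0 by apply: db_const.
rewrite /Py /Es /q4 /wL !exprS !expr0 !mulr1.
have dxiN u : dxi (- u) = - dxi u.
  by apply: (addrI (dxi u)); rewrite -dxiD !addrN -(mul0r 0) dxiM !(mulr0, mul0r) addr0.
have dxi2 u : dxi (u *+ 2) = dxi u *+ 2 by rewrite !mulr2n dxiD.
have dxi3 u : dxi (u *+ 3) = dxi u *+ 3 by rewrite !mulrS !mulr0n !addr0 !dxiD.
rewrite !(dxiM, dxiD, dxiN, dxi2, dxi3, dbM) dxi_lb' dxi_lxi db_lb' dq dxi_db; ring.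
Qed.

(** [Dyop] and [Dsop] are the derivatives of [m s^-3 exp(y / s)] divided by [s^-3 exp(y / s)]: the
    exponential itself never has to exist, and 1 stands for [v]. *)
Definition Dyop m : L := Py m + sinv * m.
Definition Dsop m : L := sinv * (Es m - (toL y * sinv + 3%:R) * m).

Lemma DyopD m m' : Dyop (m + m') = Dyop m + Dyop m'.
Proof. by rewrite /Dyop PyD; ring. Qed.
Lemma DsopD m m' : Dsop (m + m') = Dsop m + Dsop m'.
Proof. by rewrite /Dsop EsD; ring. Qed.
Lemma Dyop_toL f m : Dyop (toL f * m) = toL (Dy f) * m + toL f * Dyop m.
Proof. by rewrite /Dyop PyM Py_toL; ring. Qed.
Lemma Dsop_toL f m : Dsop (toL f * m) = toL (Ds f) * m + toL f * Dsop m.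
Proof.
rewrite /Dsop EsM Es_toL.
transitivity (toL (Ds f) * m * (sinv * toL s) +
  toL f * (sinv * (Es m - (toL y * sinv + 3%:R) * m))); first by ring.
by rewrite sinvE mulr1.
Qed.

(** Flatness of the rank one connection, with [P], [E], [Y], [S] in the roles of [d/dy], [s d/ds],
    [y], [1/s]: the mixed derivatives of [y / s - c log s] agree. *)
Lemma connections_commute (K : comNzRingType) (P E : K -> K) (Y S c m : K) :
  (forall u w, P (u + w) = P u + P w) -> (forall u w, P (u * w) = P u * w + u * P w) ->
  (forall u w, E (u + w) = E u + E w) -> (forall u w, E (u * w) = E u * w + u * E w) ->
  (forall u, P (E u) = E (P u)) -> P S = 0 -> E S = - S -> P c = 0 -> P Y = 1 ->
  let D u := S * (E u - (Y * S + c) * u) in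
  P (D m) + S * D m = D (P m + S * m).
Proof.
move=> PD PM ED EM PE PS ES Pc PY /=.
have PN u : P (- u) = - P u.
  apply: (addrI (P u)); rewrite -PD !addrN -(mul0r 0) PM.
  by rewrite !(mulr0, mul0r) addr0.
by rewrite !(PM, PD, PN, ED, EM) PS ES Pc PY PE; ring.
Qed.

Lemma Dyop_Dsop m : Dyop (Dsop m) = Dsop (Dyop m).
Proof.
apply: connections_commute; [exact: PyD | exact: PyM | exact: EsD | exact: EsM
  | exact: Py_Es | exact: Py_sinv | exact: Es_sinv | |].
  by rewrite /Py !mulrS mulr0n addr0 !dxiD dxi_1; ring.
by rewrite Py_toL Dy_ycoord toL1.
Qed.

Definition curve_deriv f : O := Dy f + (y * Ds f) *+ 2.

Definition saddle_car : Type := L.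
HB.instance Definition _ := GRing.Zmodule.on saddle_car.

Definition saddle_scale f (m : saddle_car) : saddle_car := toL f * (m : L).

Fact saddle_scaleA f g m : saddle_scale f (saddle_scale g m) = saddle_scale (f * g) m.
Proof. by rewrite /saddle_scale toLM mulrA. Qed.
Fact saddle_scale1 : left_id 1 saddle_scale.
Proof. by move=> m; rewrite /saddle_scale toL1 mul1r. Qed.
Fact saddle_scaleDr : right_distributive saddle_scale +%R.
Proof. by move=> f m m'; rewrite /saddle_scale mulrDr. Qed.
Fact saddle_scaleDl m : {morph saddle_scale^~ m : f g / f + g}.
Proof. by move=> f g; rewrite /saddle_scale toLD mulrDl. Qed.
HB.instance Definition _ := GRing.Zmodule_isLmodule.Build O saddle_car
  saddle_scaleA saddle_scale1 saddle_scaleDr saddle_scaleDl.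

Definition D1op m : L := Dyop m + (toL y * Dsop m) *+ 2.

Fact D1opD (m m' : saddle_car) : D1op (m + m') = D1op m + D1op m' :> saddle_car.
Proof. by rewrite /D1op DyopD DsopD; ring. Qed.
Fact DsopD' (m m' : saddle_car) : Dsop (m + m') = Dsop m + Dsop m' :> saddle_car.
Proof. exact: DsopD. Qed.

Lemma toL2 f : toL (f *+ 2) = toL f *+ 2. Proof. by rewrite !mulr2n toLD. Qed.

Fact D1opZ f (m : saddle_car) :
  D1op (f *: m) = curve_deriv f *: m + f *: (D1op m : saddle_car) :> saddle_car.
Proof.
change (D1op (toL f * m) = toL (curve_deriv f) * m + toL f * D1op m).
rewrite /D1op /curve_deriv toLD toL2 toLM Dyop_toL Dsop_toL; ring.
Qed.
Fact DsopZ f (m : saddle_car) :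
  Dsop (f *: m) = Ds f *: m + f *: (Dsop m : saddle_car) :> saddle_car.
Proof. exact: Dsop_toL. Qed.
Fact D1op_Dsop (m : saddle_car) : D1op (Dsop m) = Dsop (D1op m) :> saddle_car.
Proof.
have t0 : toL 0 = 0 by apply: (addrI (toL 0)); rewrite -toLD !addr0.
rewrite /D1op mulr2n !DsopD !Dsop_toL Dyop_Dsop Ds_ycoord t0 mul0r add0r.
congr (_ + _); exact: DsopD.
Qed.

Definition saddle_dmod : dmod curve_deriv (@Ds R) :=
  @Dmod _ curve_deriv (@Ds R) saddle_car D1op Dsop D1opD DsopD' D1opZ DsopZ D1op_Dsop.

End SaddleModule.

(** * Leading terms *)

Section LeadingTerms.
Variable R : realType.
Local Notation C := R[i].
Local Notation A := {poly C}.
Local Notation L := (laurent A).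
Local Notation y := (ycoord (0 : Z R)).
Local Notation s := (scoord (0 : Z R)).
Local Notation t := (tcurve R).
Local Notation lb := (lb A).
Local Notation lb' := (lb' A).
Local Notation lxi := (liota (fps_const 'X) : L).
Local Notation q2 := (q2 R).
Local Notation q4 := (q4 R).
Implicit Types (k l : int) (m : L) (a : A).

(** The coefficient [a] may be zero: this is a lower bound on the valuation together with one
    coefficient, stable under sums without case distinctions. *)
Definition lead k m a := vge k m /\ m k = a.

Lemma leadD k m m' a a' : lead k m a -> lead k m' a' -> lead k (m + m') (a + a').
Proof. by move=> [v <-] [v' <-]; split=> //; apply: vgeD. Qed.

Lemma leadN k m a : lead k m a -> lead k (- m) (- a).
Proof. by move=> [v <-]; split=> //; apply: vgeN. Qed.

Lemma leadB k m m' a a' : lead k m a -> lead k m' a' -> lead k (m - m') (a - a').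
Proof. by move=> ml m'l; apply: leadD ml (leadN m'l). Qed.

Lemma leadM k l m m' a a' : lead k m a -> lead l m' a' -> lead (k + l) (m * m') (a * a').
Proof. by move=> [v <-] [v' <-]; have [? ?] := vgeM_lead v v'. Qed.

Lemma leadX k m a n : lead k m a -> lead (k *+ n) (m ^+ n) (a ^+ n).
Proof.
move=> ml; elim: n => [|n IHn]; last by rewrite mulrS !exprS; apply: leadM.
by split=> //; case=> // j.
Qed.

Lemma lead_hi k l m : k < l -> vge l m -> lead k m 0.
Proof.
by move=> lt_kl v; split; [apply: vgeW v; exact: ltW | exact: v].
Qed.

Lemma lead_eq k m a m' a' : lead k m a -> m = m' -> a = a' -> lead k m' a'.
Proof. by move=> + <- <-. Qed.

Lemma lead_lb : lead 1 lb 1.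
Proof. by split=> // -[[|n]|n]. Qed.

Lemma lead_lb' : lead (- 1) lb' 1.
Proof.
split=> // j lt_j; rewrite /= /laurent_fun; case E : (j + 1%:Z) => [n|//]; lia.
Qed.

Lemma lead_lc (c : C) : lead 0 (lc c) c%:P.
Proof. by split=> // -[]. Qed.

Lemma lead_lxi : lead 0 lxi 'X.
Proof. by split=> // -[]. Qed.

Lemma vge_toL f : vge 0 (toL f : L). Proof. exact: vge_liota. Qed.

Lemma lead_dxi k m a : lead k m a -> lead k (dxi m) a^`().
Proof.
by move=> [v <-]; split=> // j lt_j; rewrite /= v ?deriv0.
Qed.

Lemma lead_db k m a : lead k m a -> lead k (db m) (a *~ k).
Proof. by move=> [v <-]; split=> // j lt_j; rewrite /= v ?mul0rz. Qed.

Lemma lead_nat n : lead 0 (n%:R : L) n%:R.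
Proof.
elim: n => [|n IHn]; first by split.
by rewrite !mulrS; apply: leadD => //; split=> // -[].
Qed.

Lemma lead_sinv : lead (- 4%:Z) (sinv R) (2^-1)%:P.
Proof.
apply: lead_eq (leadM (lead_lc _) (leadX 4 lead_lb')) (erefl _) _.
by rewrite expr1n mulr1.
Qed.

Lemma ysinvE : toL y * sinv R = q2 * (lb' ^+ 2 + lb' * lxi).
Proof.
rewrite toL_y /sinv.
transitivity (q2 * ((lb' * lb) ^+ 2 * lb' ^+ 2 + (lb' * lb) ^+ 3 * lb' * lxi)); first by ring.
by rewrite lb'b !expr1n !mul1r.
Qed.

Lemma lead_ysinv : lead (- 2%:Z) (toL y * sinv R) (2^-1)%:P.
Proof.
rewrite ysinvE -[- 2%:Z]add0r -[_%:P]mulr1; apply: leadM; first exact: lead_lc.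
apply: lead_eq (leadD (a' := 0) (leadX 2 lead_lb') _) (erefl _) _.
  by apply: (@lead_hi _ (-1 + 0)) => //; exact: (leadM lead_lb' lead_lxi).1.
by rewrite expr1n addr0.
Qed.

Lemma lead_Py k m a : lead k m a -> lead (k - 3%:Z) (Py m) a^`().
Proof.
move=> ml; have := leadM (leadX 3 lead_lb') (lead_dxi ml).
by rewrite expr1n mul1r addrC.
Qed.

Lemma half2E : (2^-1)%:P * 2%:R = 1 :> A.
Proof.
have -> : (2%:R : A) = (2%:R)%:P by rewrite polyCMn.
by rewrite -polyCM mulVf // pnatr_eq0.
Qed.

Lemma lead_Es k m a : lead k m a -> lead (k - 1) (Es m) (- (2^-1)%:P * a^`()).
Proof.
move=> ml; rewrite /Es.
have q4l : lead 0 q4 ((2^-1)%:P ^+ 2) by exact: (leadX 2 (lead_lc _)).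
have wl : lead (-1) (wL R) 2%:R.
  have -> : wL R = lb' * 2%:R + lxi * 3%:R by rewrite /wL !mulr_natr.
  apply: lead_eq (leadD (a' := 0) (leadM lead_lb' (lead_nat 2)) _) (erefl _) _.
    by apply: (@lead_hi _ 0) => //; exact: (leadM lead_lxi (lead_nat 3)).1.
  by rewrite mul1r addr0.
have dl : lead (k - 1) (db m) 0.
  by apply: (@lead_hi _ k); [rewrite ltrBlDr ltrDl | exact: (lead_db ml).1].
have wdl := leadM wl (lead_dxi ml); rewrite addrC in wdl.
have H := leadM q4l (leadB dl wdl); rewrite add0r in H; apply: (lead_eq H) => //.
rewrite sub0r expr2 mulrN mulNr; congr (- _).
by rewrite -!mulrA; congr (_ * _); rewrite mulrA half2E mul1r.
Qed.

(* Completing the square: the terms of [D1op] of order [b^-4] cancel because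
   the base curve consists of critical points. *)
Lemma D1opE m : D1op m = Py m + (toL y * sinv R) * 2%:R * Es m
  - (lb' ^+ 3 * lxi + q2 * lb' ^+ 2 * lxi ^+ 2) * m - 6%:R * (toL y * sinv R) * m.
Proof.
have -> : lb' ^+ 3 * lxi + q2 * lb' ^+ 2 * lxi ^+ 2 =
    (toL y * sinv R) ^+ 2 *+ 2 - sinv R.
  have -> : (toL y * sinv R) ^+ 2 *+ 2 - sinv R =
      (q2 *+ 2) * (q2 * (lb' ^+ 2 + lb' * lxi) ^+ 2) - q2 * lb' ^+ 4.
    by rewrite ysinvE /sinv; ring.
  rewrite q2E mul1r; transitivity (lb' ^+ 3 * lxi * (q2 *+ 2) + q2 * lb' ^+ 2 * lxi ^+ 2).
    by rewrite q2E mulr1.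
  ring.
rewrite /D1op /Dyop /Dsop; ring.
Qed.

(** The conjugate by [exp(-xi^2)] of half the derivative in [xi]. The factor 1/2 arises because [s]
    varies along the curves [t = const]: the term [2 y D_s] takes back half of [D_y]. *)
Lemma lead_D1op k m a : lead k m a ->
  lead (k - 3%:Z) (D1op m) ((2^-1)%:P * a^`() - 'X * a).
Proof.
move=> ml; rewrite D1opE.
have l1 := lead_Py ml.
have l2 : lead (k - 3%:Z) (toL y * sinv R * 2%:R * Es m) (- (2^-1)%:P * a^`()).
  have := leadM (leadM lead_ysinv (lead_nat 2)) (lead_Es ml).
  by rewrite half2E mul1r; congr lead; lia.
have l3 : lead (k - 3%:Z) ((lb' ^+ 3 * lxi + q2 * lb' ^+ 2 * lxi ^+ 2) * m) ('X * a).
  rewrite addrC; apply: leadM ml.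
  apply: lead_eq (leadD (a' := 0) (leadM (leadX 3 lead_lb') lead_lxi) _) (erefl _) _.
    apply: (@lead_hi _ (-2%:Z)) => //.
    exact: (leadM (leadM (lead_lc _) (leadX 2 lead_lb')) (leadX 2 lead_lxi)).1.
  by rewrite expr1n mul1r addr0.
have l4 : lead (k - 3%:Z) (6%:R * (toL y * sinv R) * m) 0.
  apply: (@lead_hi _ (k - 2%:Z)); first by lia.
  have := (leadM (leadM (lead_nat 6) lead_ysinv) ml).1; congr vge; lia.
apply: lead_eq (leadB (leadB (leadD l1 l2) l3) l4) (erefl _) _.
rewrite subr0; congr (_ - _); rewrite -[X in X + _]mul1r -mulrDl; congr (_ * _).
rewrite -half2E; ring.
Qed.

(** The dominant part is multiplication by [- y / s^2], that is [- b^-6 / 4]; the derivative itself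
    only enters from [b^-5] on. *)
Lemma lead_Dsop k m a : lead k m a ->
  lead (k - 6%:Z) (Dsop m) (- ((2^-1)%:P * (2^-1)%:P) * a).
Proof.
move=> ml; rewrite /Dsop.
have le : lead (k - 2%:Z) (Es m) 0.
  by apply: (@lead_hi _ (k - 1)); [lia | exact: (lead_Es ml).1].
have l3 : lead (- 2%:Z) (toL y * sinv R + 3%:R) (2^-1)%:P.
  rewrite -[_%:P]addr0; apply: leadD lead_ysinv _.
  by apply: (@lead_hi _ 0) => //; exact: (lead_nat 3).1.
have l4 := leadM l3 ml; rewrite addrC in l4.
have := leadM lead_sinv (leadB le l4); rewrite sub0r mulrN mulNr.
by congr lead; [lia | rewrite mulrA].
Qed.

Lemma lead_toL_t : lead 4 (toL t) 1.
Proof.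
have -> : toL t = lb ^+ 4 - (lb ^+ 5 * lxi *+ 2 + lb ^+ 6 * lxi ^+ 2).
  have E : toL t + toL y ^+ 2 = toL s by rewrite expr2 -toLM -toLD /tcurve -expr2 subrK.
  apply: (addIr (toL y ^+ 2)); rewrite E toL_s toL_y; ring.
rewrite -[X in lead _ _ X]subr0; apply: leadB.
  by apply: lead_eq (leadX 4 lead_lb) (erefl _) _; rewrite expr1n.
apply: (@lead_hi _ 5) => //; apply: vgeD.
  rewrite mulr2n; have v5 : vge 5 (lb ^+ 5 * lxi) := (leadM (leadX 5 lead_lb) lead_lxi).1.
  exact: vgeD.
by apply: (@vgeW _ 6) => //; exact: (leadM (leadX 6 lead_lb) (leadX 2 lead_lxi)).1.
Qed.

Lemma lead_theta k m a : lead k m a ->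
  lead (k - 2%:Z) (toL t * Dsop m) (- ((2^-1)%:P * (2^-1)%:P) * a).
Proof.
move=> ml; have := leadM lead_toL_t (lead_Dsop ml); rewrite mul1r.
by congr lead; lia.
Qed.

(* On the leading coefficients [D1op] is [h |-> h' / 2 - 'X * h], which is
   injective and never takes a nonzero constant value. *)
Lemma D1op_lead_const k (c : C) m : c != 0 -> ~ lead k (D1op m) c%:P.
Proof.
move=> c0 [v ck].
have m0 : m <> 0.
  move=> m0; move: ck; have E : D1op (0 : L) = 0 := d1_0 (saddle_dmod R).
  by rewrite m0 E => /esym/eqP; rewrite polyC_eq0 (negPf c0).
have [k0 vk0] := vge_ex m.
have [j mj] : exists j, m j != 0.
  apply: contrapT => H; apply: m0; apply: laurent_ext => j.
  by apply/eqP/negPn/negP => mj; apply: H; exists j.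
have ex : exists n : nat, m (k0 + n%:Z) != 0.
  exists (absz (j - k0)%R); have : ~~ (j < k0) by apply: contra mj => /vk0 ->.
  by rewrite -leNgt => le_j; rewrite (_ : k0 + _ = j) //; lia.
case: (ex_minnP ex) => n mn min_n.
pose l := k0 + n%:Z; have vl : vge l m.
  move=> i lt_i; have [/vk0 //|le_i] := ltP i k0.
  apply/eqP/negPn/negP => mi; have := min_n (absz (i - k0)%R).
  rewrite (_ : k0 + _ = i); last lia.
  by move=> /(_ mi); rewrite /l in lt_i; lia.
have [v' cl] := lead_D1op (conj vl (erefl (m l))).
set a := m l in cl; have a0 : a != 0 by [].
pose r : A := (2^-1)%:P * a^`() - 'X * a.
(* Multiplication by ['X] outweighs the derivative, so [r] has degree one more than [a] and cannot
   be constant. *)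
have size_r : size r = (size a).+1.
  have sX : size ('X * a) = (size a).+1 by rewrite mulrC size_mulX.
  rewrite /r addrC size_polyDl size_polyN sX //.
  apply: leq_ltn_trans (size_polyMleq _ _) _.
  rewrite size_polyC invr_eq0 pnatr_eq0 /=.
  by rewrite ltnS; exact: (leq_trans (leq_pred _) (lt_size_deriv a0)).
have r0 : r != 0 by rewrite -size_poly_eq0 size_r.
have kl : k = l - 3%:Z.
  have [lt_k|gt_k|//] := ltgtP k (l - 3%:Z).
    by move/v': lt_k; rewrite ck => /eqP; rewrite polyC_eq0 (negPf c0).
  by move/v: gt_k; rewrite cl => /eqP; rewrite (negPf r0).
move: ck; rewrite kl cl => rc; have := size_r; rewrite /r rc size_polyC c0.
by case=> /esym/eqP; rewrite size_poly_eq0 (negPf a0).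
Qed.

End LeadingTerms.

(** * Irregularity along the curve *)

Section CurveCoordinates.
Variable R : realType.
Local Notation O := (germ R).
Local Notation y := (ycoord (0 : Z R)).
Local Notation t := (tcurve R).
Local Notation e1 := (@curve_deriv R).
Local Notation uop := (uop e1 (@Ds R)).
Implicit Types (f g h : O).

Fact curve_derivD : {morph e1 : f g / f + g}.
Proof. by move=> f g; rewrite /curve_deriv DyD DsD; ring. Qed.

Fact curve_derivM f g : e1 (f * g) = e1 f * g + f * e1 g.
Proof. by rewrite /curve_deriv DyM DsM; ring. Qed.

Fact curve_deriv_Ds f : e1 (Ds f) = Ds (e1 f).
Proof.
rewrite /curve_deriv DyDs mulr2n !DsD DsM Ds_ycoord mul0r add0r.
by rewrite -mulr2n.
Qed.

Definition curve_dmod : dmod e1 (@Ds R) :=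
  @Dmod _ e1 (@Ds R) O^o e1 (@Ds R) curve_derivD (@DsD R) curve_derivM (@DsM R)
    curve_deriv_Ds.
Local Notation Oc := curve_dmod.

Lemma e1_t : e1 t = 0.
Proof.
rewrite /curve_deriv Ds_t /tcurve DyD DyN Dy_scoord expr2 DyM Dy_ycoord; ring.
Qed.
Lemma e1_y : e1 y = 1.
Proof. by rewrite /curve_deriv Dy_ycoord Ds_ycoord mulr0 mul0rn addr0. Qed.
Lemma e1_1 : e1 1 = 0.
Proof. by rewrite /curve_deriv Dy1 Ds1 mulr0 mul0rn addr0. Qed.

Lemma e1_tX n : e1 (t ^+ n) = 0.
Proof.
elim: n => [|n IHn]; first by rewrite expr0 e1_1.
by rewrite exprS curve_derivM e1_t IHn mul0r mulr0 addr0.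
Qed.
Lemma e1_yX n : e1 (y ^+ n) = y ^+ n.-1 *+ n.
Proof.
elim: n => [|[|n] IHn]; first by rewrite expr0 e1_1.
  by rewrite expr1 e1_y.
by rewrite exprS curve_derivM IHn e1_y mul1r mulrnAr -exprS -mulrS.
Qed.
Lemma Ds_yX n : Ds (y ^+ n) = 0.
Proof.
elim: n => [|n IHn]; first by rewrite expr0 Ds1.
by rewrite exprS DsM Ds_ycoord IHn mul0r mulr0 addr0.
Qed.
Lemma Ds_tX n : Ds (t ^+ n) = t ^+ n.-1 *+ n.
Proof.
elim: n => [|[|n] IHn]; first by rewrite expr0 Ds1.
  by rewrite expr1 Ds_t.
by rewrite exprS DsM IHn Ds_t mul1r mulrnAr -exprS -mulrS.
Qed.

Lemma e1Mn f n : e1 (f *+ n) = e1 f *+ n. Proof. exact: (d1Mn (M := Oc)). Qed.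
Lemma DsMn f n : Ds (f *+ n) = Ds f *+ n. Proof. exact: (d2Mn (M := Oc)). Qed.

Lemma iter_Ds_mono k l j :
  iter j (@Ds R) (y ^+ k * t ^+ l) = (y ^+ k * t ^+ (l - j)) *+ (l ^_ j).
Proof.
elim: j => [|j IHj]; first by rewrite subn0.
rewrite iterS IHj DsMn DsM Ds_yX mul0r add0r Ds_tX mulrnAr -mulrnA.
by rewrite ffactnSr subnS mulnC.
Qed.

Lemma iter_e1_mono k l i :
  iter i e1 (y ^+ k * t ^+ l) = (y ^+ (k - i) * t ^+ l) *+ (k ^_ i).
Proof.
elim: i => [|i IHi]; first by rewrite subn0.
rewrite iterS IHi e1Mn curve_derivM e1_tX mulr0 addr0 e1_yX mulrnAl -mulrnA.
by rewrite ffactnSr subnS mulnC.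
Qed.

Lemma dop_mono m c k l : dop m c (y ^+ k * t ^+ l : Oc) =
  \sum_(i < m.+1) \sum_(j < m.+1 - i)
    c i j * (y ^+ (k - i) * t ^+ (l - j)) *+ (k ^_ i * l ^_ j) :> O.
Proof.
apply: eq_bigr => i _; apply: eq_bigr => j _.
rewrite -[LHS]/(c i j * iter i e1 (iter j (@Ds R) (y ^+ k * t ^+ l))) iter_Ds_mono.
have iterMn n f u : iter n e1 (f *+ u) = iter n e1 f *+ u.
  by elim: n => //= n ->; rewrite e1Mn.
by rewrite iterMn iter_e1_mono -mulrnA mulrnAr.
Qed.

(* The coefficients of an operator are read off from its values on the
   monomials [y^k t^l]. *)
Lemma dop_coef (K : nat -> set O) m c :
  (forall l, K l 0) -> (forall l g h, K l g -> K l h -> K l (g - h)) ->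
  (forall l g h, K l g -> K l (h * g)) ->
  (forall l g n, (0 < n)%N -> K l (g *+ n) -> K l g) ->
  (forall l j g, (j <= l)%N -> K j g -> K l (t ^+ (l - j) * g)) ->
  (forall k l, K l (dop m c (y ^+ k * t ^+ l : Oc))) ->
  forall i j, (i + j <= m)%N -> K j (c i j).
Proof.
(* On [y^k t^l] the terms with [i > k] or [j > l] vanish, the term [(k, l)] is [k! l! c_kl], and the
   others have [i + j < k + l]. *)
move=> K0 KB KM Kn Kt Kd k l; have [n] := ubnP (k + l); elim: n k l => // n IHn k l.
rewrite ltnS => le_n le_m.
have KD j g h : K j g -> K j h -> K j (g + h).
  by move=> Kg Kh; rewrite -[h]opprK; apply: (KB) => //; rewrite -sub0r; apply: (KB).
have term i j : (i + j <= m)%N -> (i, j) != (k, l) ->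
    K l (c i j * (y ^+ (k - i) * t ^+ (l - j)) *+ (k ^_ i * l ^_ j)).
  move=> le_ij ij; have [lt_ki|le_ik] := ltnP k i.
    by rewrite ffact_small // mul0n mulr0n.
  have [lt_lj|le_jl] := ltnP l j; first by rewrite [l ^_ j]ffact_small // muln0 mulr0n.
  rewrite mulrCA -mulrnAl; apply: KM; rewrite mulrC; apply: Kt => //; apply: IHn => //.
  apply: leq_trans le_n; move: ij; rewrite xpair_eqE negb_and.
  by case/orP => /eqP; lia.
have ltk : (k < m.+1)%N by lia.
have ltl : (l < m.+1 - k)%N by lia.
have := Kd k l; rewrite dop_mono (bigD1 (Ordinal ltk)) //= (bigD1 (Ordinal ltl)) //=.
set r := \sum_(j < _ | _) _; set r' := \sum_(i < _ | _) _.
have Kr : K l r.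
  apply: (big_ind (K l)) => // [|j]; first exact: KD.
  rewrite -val_eqE /= => jl; apply: term; first by have := ltn_ord j; lia.
  by rewrite xpair_eqE eqxx.
have Kr' : K l r'.
  apply: (big_ind (K l)) => // [|i]; first exact: KD.
  rewrite -val_eqE /= => ik; apply: (big_ind (K l)) => // [|j _]; first exact: KD.
  apply: term; first by have := ltn_ord i; have := ltn_ord j; lia.
  by rewrite xpair_eqE (negPf ik).
move=> H; have {H} := KB _ _ _ (KB _ _ _ H Kr') Kr; rewrite addrK addrK !subnn mulr1 mulr1.
by apply: Kn; rewrite muln_gt0 !ffact_gt0 !leqnn.
Qed.

Definition tpow n : set O := [set f | exists g, f = t ^+ n * g].

Lemma tpow0 n : tpow n 0. Proof. by exists 0; rewrite mulr0. Qed.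
Lemma tpowB n g h : tpow n g -> tpow n h -> tpow n (g - h).
Proof. by move=> [g' ->] [h' ->]; exists (g' - h'); rewrite mulrBr. Qed.
Lemma tpowM n g h : tpow n g -> tpow n (h * g).
Proof. by move=> [g' ->]; exists (h * g'); rewrite mulrCA. Qed.
Lemma germ_natK n g : (0 < n)%N -> gconst n%:R^-1 * (g *+ n) = g.
Proof.
move=> n0; apply: germ_ext => i j; rewrite taylor_gconstM taylorMn -[taylor g i j *+ n]mulr_natl mulrA.
by rewrite mulVf ?mul1r // pnatr_eq0 -lt0n.
Qed.
Lemma tpow_nat d n g : (0 < n)%N -> tpow d (g *+ n) -> tpow d g.
Proof.
by move=> n0 [h gh]; exists (gconst n%:R^-1 * h); rewrite mulrCA -gh germ_natK.
Qed.

(** [curve_deriv] kills [t], so only [Ds] lowers the order along the curve: in [V_(-e)], the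
    coefficient at [D_s^j] must be divisible by [t^(j+e)]. *)
Lemma tpow_coef (e : nat) m c :
  (forall k l, tpow (l + e) (dop m c (y ^+ k * t ^+ l : Oc))) ->
  forall i j, (i + j <= m)%N -> tpow (j + e) (c i j).
Proof.
apply: (dop_coef (K := fun l => tpow (l + e))).
- by move=> l; apply: tpow0.
- by move=> l; apply: tpowB.
- by move=> l; apply: tpowM.
- by move=> l g n; apply: tpow_nat.
move=> l j g le_jl [h ->]; exists h; rewrite mulrA -exprD; congr (_ ^+ _ * _); lia.
Qed.

(** [dop_coef] with the zero ideal: all coefficients vanish. This carries the equation of
    regularity, an identity of maps on germs, over to the saddle module. *)
Lemma dop_eq0 m c : (forall f, dop m c (f : Oc) = 0) ->
  forall (M : dmod e1 (@Ds R)) (x : M), dop m c x = 0.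
Proof.
move=> c0; have cij i j : (i + j <= m)%N -> c i j = 0.
  apply: (dop_coef (K := fun=> [set 0])) => //.
  - by move=> l g h /= -> ->; rewrite subrr.
  - by move=> l g h /= ->; rewrite mulr0.
  - by move=> l g n n0 /= gn; rewrite -(germ_natK g n0) gn mulr0.
  - by move=> l i' g _ /= ->; rewrite mulr0.
  by move=> k l; apply: c0.
move=> M x; rewrite /dop big1 // => i _; rewrite big1 // => j _.
by rewrite cij ?scale0r //; have := ltn_ord i; have := ltn_ord j; lia.
Qed.

Local Notation I := (ideal_of (Y R) 0).

Lemma ideal_expn_Y n : ideal_expn I n = tpow n.
Proof.
rewrite ideal_of_Y; elim: n => [|n IHn] /=.
  by apply/seteqP; split=> // f _; exists f; rewrite mul1r.
rewrite IHn; apply/seteqP; split=> f.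
  move=> [k [g [h [gI hI ->]]]]; elim/big_ind: _ => [||i _].
  - exact: tpow0.
  - move=> u v Hu Hv; rewrite -[v]opprK; apply: tpowB => //.
    by rewrite -sub0r; apply: tpowB => //; apply: tpow0.
  have [g' ->] := gI i; have [h' ->] := hI i; exists (g' * h').
  by rewrite exprS; ring.
move=> [g ->]; exists 1%N, (fun=> t), (fun=> t ^+ n * g); split.
- by move=> _; exists 1; rewrite mulr1.
- by move=> _; exists g.
by rewrite big_ord1 exprS mulrA.
Qed.

Definition theta_curve f : O := t * Ds f.

Lemma theta_curve_euler : euler_lift I theta_curve.
Proof.
have euler l g : theta_curve (t ^+ l * g) - (t ^+ l * g) *+ l = t ^+ l.+1 * Ds g.
  rewrite /theta_curve DsM Ds_tX; case: l => [|l]; last by rewrite /= !exprS; ring.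
  by rewrite !mulr0n mul0r add0r subr0 expr0 mul1r expr1.
have d1 : D_ord 1 theta_curve.
  exists (fun i j => if (i == 0%N) && (j == 1%N) then t else 0).
  apply/funext => f; rewrite /diffop !big_ord_recl !big_ord0 /= /theta_curve; ring.
split=> //.
- split; first by exists 1%N.
  move=> l f; rewrite subr0; case: l => l //=; rewrite !ideal_expn_Y => -[g ->].
  exists (g *+ l + t * Ds g); have := euler l g => /eqP; rewrite subr_eq => /eqP ->.
  by rewrite exprS; ring.
move=> l f; rewrite !ideal_expn_Y => -[g ->]; exists (Ds g); exact: euler.
Qed.

(** The original [D_y], recovered in the frame adapted to the curve; [D_ord_lift] rewrites operators
    with it. *)
Definition lDy : uop := fun M x => d1 x - (y *+ 2) *: d2 x.
Arguments lDy : clear implicits.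

Lemma lDyE f : lDy Oc f = Dy f :> O.
Proof. rewrite /lDy -[LHS]/(Dy f + (y * Ds f) *+ 2 - (y *+ 2) * Ds f); ring. Qed.

Lemma isdo_lDy m (T : uop) : isdo m T -> isdo m.+1 (fun M x => lDy M (T M x)).
Proof. by move=> dT; apply: isdoB (isdo_d1 dT) (isdoZ _ (isdo_d2 dT)). Qed.

Lemma D_ord_lift m (P : O -> O) : D_ord m P ->
  exists T : uop, isdo m T /\ forall f, T Oc f = P f.
Proof.
move=> [c ->]; pose T : uop := fun M x => \sum_(i < m.+1) \sum_(j < m.+1 - i)
  c i j *: iter i (lDy M) (iter j (@d2 _ _ _ M) x).
exists T; split=> [|f].
  apply: isdo_sum => i; apply: isdo_sum => j; apply: isdoZ.
  have dj : isdo (j + 0) (fun (M : dmod e1 (@Ds R)) x => iter j (@d2 _ _ _ M) x).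
    exact: (isdo_iter_d2 j (isdo_id _ _ 0)).
  have di k : isdo (k + (j + 0)) (fun M x => iter k (lDy M) (iter j (@d2 _ _ _ M) x)).
    by elim: k => //= k; apply: isdo_lDy.
  by apply: isdoW (di i); have := ltn_ord i; have := ltn_ord j; lia.
apply: eq_bigr => i _; apply: eq_bigr => j _; congr (_ * _).
set g := iter j _ f.
by elim: (i : nat) => //= k ->; rewrite lDyE.
Qed.

End CurveCoordinates.
Arguments lDy {R} M x.

(** * Evaluation in the saddle module and comparison of orders *)

Section NotRegular.
Variable R : realType.
Local Notation C := R[i].
Local Notation O := (germ R).
Local Notation y := (ycoord (0 : Z R)).
Local Notation s := (scoord (0 : Z R)).
Local Notation t := (tcurve R).
Local Notation e1 := (@curve_deriv R).
Local Notation uop := (uop e1 (@Ds R)).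
Local Notation Oc := (curve_dmod R).
Local Notation M0 := (saddle_dmod R).
Local Notation L := (laurent {poly C}).

Definition lP1 : uop := fun M x => y *: lDy M (lDy M x) + lDy M x *+ 2 + d2 x.
Definition lQ1 : uop := fun M x => s *: d2 x + y *: lDy M x + x *+ 3.
Definition lV : uop := fun M x => s *: lDy M x - x.
Arguments lP1 : clear implicits.
Arguments lQ1 : clear implicits.
Arguments lV : clear implicits.

Lemma lDy_saddle (m : M0) : lDy M0 m = Dyop m :> L.
Proof.
rewrite /lDy -[LHS]/(D1op m - toL (y *+ 2) * Dsop m) toL2 /D1op; ring.
Qed.

(** The image of [e]: in [e = (y D_y + 2) v] put [v = 1] and [Dyop 1 = 1/s]. *)
Definition saddle_gen : L := toL y * sinv R + 2%:R.

Lemma Es_y : Es (toL y) = 0 :> L.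
Proof.
rewrite Es_toL Ds_ycoord (_ : toL 0 = 0) ?mul0r //.
by apply: (addrI (toL 0)); rewrite -toLD !addr0.
Qed.

Lemma Py_ysinv : Py (toL y * sinv R) = sinv R.
Proof. by rewrite (PyM (toL y)) Py_toL Dy_ycoord toL1 Py_sinv mul1r mulr0 addr0. Qed.

Lemma Es_ysinv : Es (toL y * sinv R) = - (toL y * sinv R).
Proof. by rewrite (EsM (toL y)) Es_y Es_sinv mul0r add0r mulrN. Qed.

Lemma Py_nat n : Py (n%:R : L) = 0.
Proof.
elim: n => [|n IHn]; last by rewrite mulrS PyD IHn /Py dxi_1 mulr0 addr0.
by apply: (addrI (Py 0)); rewrite -PyD !addr0.
Qed.

Lemma Es_nat n : Es (n%:R : L) = 0.
Proof.
elim: n => [|n IHn].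
  by apply: (addrI (Es 0)); rewrite -EsD !addr0.
by rewrite mulrS EsD IHn /Es dxi_1 db_1 mulr0 subrr mulr0 addr0.
Qed.

Lemma Dyop_saddle_gen : Dyop saddle_gen = sinv R * (toL y * sinv R + 3%:R).
Proof. rewrite /Dyop /saddle_gen (PyD (toL y * sinv R)) Py_ysinv Py_nat; ring. Qed.

Lemma Dyop2_saddle_gen : Dyop (Dyop saddle_gen) = sinv R ^+ 2 * (toL y * sinv R + 4%:R).
Proof.
rewrite Dyop_saddle_gen /Dyop (PyM (sinv R)) (PyD (toL y * sinv R)) Py_ysinv Py_nat Py_sinv.
ring.
Qed.

Lemma Dsop_saddle_gen : Dsop saddle_gen =
  - (sinv R * (toL y * sinv R + (toL y * sinv R + 3%:R) * (toL y * sinv R + 2%:R))).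
Proof. rewrite /Dsop /saddle_gen (EsD (toL y * sinv R)) Es_ysinv Es_nat; ring. Qed.

Lemma lP1_saddle_gen : lP1 M0 (saddle_gen : M0) = 0.
Proof.
change (toL y * (lDy M0 (lDy M0 (saddle_gen : M0)) : L) +
  (lDy M0 (saddle_gen : M0) : L) *+ 2 + Dsop saddle_gen = 0).
rewrite !lDy_saddle Dyop2_saddle_gen Dyop_saddle_gen Dsop_saddle_gen; ring.
Qed.

Lemma lQ1_saddle_gen : lQ1 M0 (saddle_gen : M0) = 0.
Proof.
change (toL s * Dsop saddle_gen + toL y * (lDy M0 (saddle_gen : M0) : L) + saddle_gen *+ 3 = 0).
rewrite lDy_saddle Dyop_saddle_gen Dsop_saddle_gen /saddle_gen.
transitivity ((1 - sinv R * toL s) * (toL y * sinv R + (toL y * sinv R + 3%:R) * (toL y * sinv R + 2%:R))).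
  ring.
by rewrite sinvE subrr mul0r.
Qed.

Lemma lV_saddle_gen : lV M0 (saddle_gen : M0) = (1 : L).
Proof.
change (toL s * (lDy M0 (saddle_gen : M0) : L) - saddle_gen = 1).
rewrite lDy_saddle Dyop_saddle_gen /saddle_gen.
transitivity ((sinv R * toL s) * (toL y * sinv R + 3%:R) - (toL y * sinv R + 2%:R)); first by ring.
rewrite sinvE; ring.
Qed.

(** Integration by parts along the curves [t = const]: the derivatives move onto the coefficient. *)
Lemma iter_d1_parts (M : dmod e1 (@Ds R)) (c : O) i (x : M) :
  exists (h : O) (x' : M), c *: iter i (@d1 _ _ _ M) x = h *: x + d1 x'.
Proof.
elim: i c => [|i IHi] c; first by exists c, 0; rewrite d1_0 addr0.
have [h [x' E]] := IHi (e1 c); exists (- h), (c *: iter i (@d1 _ _ _ M) x - x').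
rewrite scaleNr d1B d1Z E iterS; set a := d1 (iter _ _ _); mod_ring (germ R) M.
Qed.

Lemma vge_iter_Dsop j : vge (- (6 * j)%N%:Z) (iter j (@Dsop R) (1 : L)).
Proof.
elim: j => [|j IHj]; first by case.
rewrite iterS.
have := (lead_Dsop (conj IHj (erefl _))).1; congr vge; lia.
Qed.

(* Modulo the image of [d1], an operator of order [m] in [V_(-e)] sends the
   generator into [b^(4 e - 2 m)]. *)
Lemma saddle_bound (e m : nat) c :
  (forall i j, (i + j <= m)%N -> tpow (j + e) (c i j)) ->
  exists (w : L) (x : M0), dop m c (1 : M0) = w + d1 x /\ vge (4 * e%:Z - 2 * m%:Z) w.
Proof.
move=> ct; rewrite /dop.
pose good (u : M0) := exists (w : L) (x : M0), u = w + d1 x /\ vge (4 * e%:Z - 2 * m%:Z) w.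
have good0 : good 0 by exists 0, 0; rewrite d1_0 addr0; split=> //; exact: vge0.
have goodD u v : good u -> good v -> good (u + v).
  move=> [w [x [-> vw]]] [w' [x' [-> vw']]]; exists (w + w'), (x + x').
  by split; [rewrite d1D addrACA | apply: vgeD].
have tX n k (u : M0) : iter k (@d1 _ _ _ M0) (t ^+ n *: u) =
    t ^+ n *: iter k (@d1 _ _ _ M0) u.
  by elim: k => [//|k IHk]; rewrite iterS IHk d1Z e1_tX scale0r add0r.
rewrite -/(good _); apply: (big_ind good) => // i _; apply: (big_ind good) => // j _.
have lt_i := ltn_ord i; have lt_j := ltn_ord j.
have [g ->] := ct i j ltac:(lia).
have -> : (t ^+ (j + e) * g) *: iter i (@d1 _ _ _ M0) (iter j (@d2 _ _ _ M0) (1 : M0)) =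
    g *: iter i (@d1 _ _ _ M0) (t ^+ (j + e) *: iter j (@d2 _ _ _ M0) (1 : M0)).
  by rewrite mulrC -scalerA tX.
have [h [x ->]] := iter_d1_parts g i (t ^+ (j + e) *: iter j (@d2 _ _ _ M0) (1 : M0)).
exists (toL h * (toL (t ^+ (j + e)) * iter j (@Dsop R) 1)), x; split=> //.
have -> : toL (t ^+ (j + e)) = toL t ^+ (j + e).
  by elim: (j + e)%N => [|n IHn]; rewrite ?expr0 ?toL1 // !exprS toLM IHn.
have vt := (leadX (j + e) (@lead_toL_t R)).1.
(* The orders add up to [4 (j + e) - 6 j = 4 e - 2 j], and [j <= m]. *)
have H := vgeM (vge_toL h) (vgeM vt (@vge_iter_Dsop j)); refine (vgeW _ H).
rewrite -mulr_natr; lia.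
Qed.

Lemma not_regular_along_Y : ~ regular_along (J R) (Y R).
Proof.
move=> reg.
(* The section tested is [v = (s D_y - 1) e] at the origin, whose image in the saddle module is
   1. *)
have [|N [P [Q [N0 [dP [_ VP]] [dQ [_ VQ]]]]]] :=
    reg 0 _ (theta_curve_euler R) (fun f => s * Dy f - f).
  exists 1%N, (fun i j => match i, j with 1%N, 0%N => s | 0%N, 0%N => -1 | _, _ => 0 end).
  apply/funext => f; rewrite /diffop !big_ord_recl !big_ord0 /=; ring.
move=> [A [B [[a dA] [b dB] E]]].
have [TP [dTP TPE]] := D_ord_lift dP; have [TQ [dTQ TQE]] := D_ord_lift dQ.
have [TA [dTA TAE]] := D_ord_lift dA; have [TB [dTB TBE]] := D_ord_lift dB.
have [cP cPE] := dTP; have [cQ cQE] := dTQ.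
have mono_V k l : ideal_expz (ideal_of (Y R) 0) l%:Z (y ^+ k * t ^+ l).
  by rewrite /= ideal_expn_Y; exists (y ^+ k); rewrite mulrC.
have tP : forall i j, (i + j <= N.-1)%N -> tpow (j + 0) (cP i j).
  apply: tpow_coef => k l; rewrite -cPE TPE.
  by have := VP _ _ (mono_V k l); rewrite subr0 /= ideal_expn_Y addn0.
have tQ : forall i j, (i + j <= N)%N -> tpow (j + 1) (cQ i j).
  apply: tpow_coef => k l; rewrite -cQE TQE.
  by have := VQ _ _ (mono_V k l); rewrite opprK /= ideal_expn_Y.
pose Tth : uop := fun M x => t *: d2 x.
(* The regularity equation with all terms on one side, as an operator on every module. It vanishes
   on germs by [WO], hence on [saddle_gen], where the terms in [lP1] and [lQ1] drop out. *)
pose W : uop := fun M x => iter N (Tth M) (lV M x) + TP M (lV M x) + TQ M (lV M x)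
  - (TA M (lP1 M x) + TB M (lQ1 M x)).
have di := isdo_id e1 (@Ds R) 0.
have dth : isdo 1 Tth by apply/isdoZ/(isdo_d2 di).
have dDy := isdo_lDy di.
have dV : isdo 1 lV by apply: isdoB; [apply: isdoZ | apply: isdoW di].
have dP1 : isdo 2 lP1.
  apply: isdoD; last exact: isdoW (isdo_d2 di).
  apply: isdoD; first by apply: isdoZ; apply: (isdo_lDy dDy).
  by apply: (@isdo_ext _ _ _ _ (fun M x => lDy M x + lDy M x)) => //; apply: isdoD; apply: isdoW dDy.
have dQ1 : isdo 1 lQ1.
  apply: isdoD; first by apply: isdoD; apply: isdoZ; [apply: (isdo_d2 di) | apply: dDy].
  apply: (@isdo_ext _ _ _ _ (fun M x => 3%:R *: x)) => [M x|]; first by rewrite scaler_nat.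
  exact/isdoZ/isdo_id.
have [m [c cW]] : exists m, isdo m W.
  exists (N + a + b + 2)%N; apply: isdoB.
    apply: isdoD; last by apply: isdoW (isdo_comp dTQ dV); lia.
    apply: isdoD; last by apply: isdoW (isdo_comp dTP dV); lia.
    by apply: isdoW (isdo_comp (isdo_iter N dth) dV); lia.
  apply: isdoD; first by apply: isdoW (isdo_comp dTA dP1); lia.
  by apply: isdoW (isdo_comp dTB dQ1); lia.
have WO f : W Oc f = 0.
  have VE g : lV Oc g = s * Dy g - g :> O.
    by rewrite /lV -[LHS]/(s * lDy Oc g - g) lDyE.
  have P1E g : lP1 Oc g = P1 0 g :> O.
    by rewrite /lP1 -[LHS]/(y * lDy Oc (lDy Oc g) + lDy Oc g *+ 2 + Ds g) !lDyE.
  have Q1E g : lQ1 Oc g = Q1 0 g :> O.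
    by rewrite /lQ1 -[LHS]/(s * Ds g + y * lDy Oc g + g *+ 3) lDyE.
  have thE k g : iter k (Tth Oc) g = iter k (@theta_curve R) g by [].
  apply/eqP; rewrite subr_eq0; apply/eqP.
  rewrite TPE TQE TAE TBE thE VE P1E Q1E.
  exact: (congr1 (fun F : O -> O => F f) E).
have := dop_eq0 (fun f => etrans (esym (cW Oc f)) (WO f)) (saddle_gen : M0).
rewrite -cW /W lP1_saddle_gen lQ1_saddle_gen lV_saddle_gen (isdo_zero M0 dTA) (isdo_zero M0 dTB) addr0 subr0.
rewrite cPE cQE.
have [w [x [-> vw]]] := saddle_bound tP; have [w' [x' [-> vw']]] := saddle_bound tQ.
(* Each factor [t D_s] shifts the order by [4 - 6 = -2] and multiplies the leading coefficient by
   [-1/4]. *)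
have leadth k : lead (- (2 * k)%N%:Z) (iter k (Tth M0) (1 : L) : L)
    ((- (2%:R^-1 * 2%:R^-1) : C) ^+ k)%:P.
  elim: k => [|k IHk]; first by split=> // -[].
  have H := lead_theta IHk; rewrite iterS; apply: (lead_eq (k := - (2 * k.+1)%N%:Z) _ (erefl _) (erefl _)).
  move: H; congr lead; first by lia.
  by rewrite exprS polyCM polyCN polyCM.
set c0 := iter N _ _ => H.
(* Modulo the image of [D1op], [P] contributes from [b^(2-2N)] on and [Q] from [b^(4-2N)] on, so
   neither can cancel the constant at [b^(-2N)]. *)
apply: (@D1op_lead_const R (- (2 * N)%N%:Z) ((- (2%:R^-1 * 2%:R^-1) : C) ^+ N) (- (x + x'))).
  by rewrite expf_eq0 oppr_eq0 mulf_eq0 invr_eq0 pnatr_eq0 !andbF.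
have -> : D1op (- (x + x')) = (c0 : L) + (w + w').
  have : c0 + (w + w') = - (d1 x + d1 x') :> M0.
    apply/eqP; rewrite -subr_eq0 opprK -[X in _ == X]H; apply/eqP; mod_ring (germ R) (saddle_dmod R).
  by rewrite -d1D -d1N => ->.
rewrite -[X in lead _ _ X]addr0; apply: leadD (leadth N) _.
rewrite -[X in lead _ _ X]addr0; apply: leadD.
  by apply: (lead_hi _ vw); lia.
by apply: (lead_hi _ vw'); lia.
Qed.

End NotRegular.

Theorem proposition6p3 (R : realType) :
  [/\ holonomic (J R),
      (forall p : Z R, Y R p -> regular_along (J R) [set p]) &
      ~ regular_along (J R) (Y R)].
Proof.
split; [exact: holonomic_J | | exact: not_regular_along_Y].
case=> p1 p2; rewrite /Y /= => ->.
apply: regular_along_set1 => M e gen_e m T dT.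
(* On [Y] the two coordinates vanish together, so the origin is its only point on the axes. *)
have [p0|p0] := eqVneq p1 0; last by apply: (regular_away _ _ gen_e dT); rewrite ?expf_neq0.
by move: gen_e; rewrite p0 expr0n => gen_e; apply: (regular_origin gen_e dT).
Qed.
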